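(* Let $S$ be a locally compact subcartesian space. For $x\in S$ let $O_x$ be the orbit of $\mathrm{Vect}(S)$ through $x$, equipped with its orbit topology $\mathcal{T}$, and let $i:O_x\to S$ be the inclusion. A derivation $X\in\mathrm{Der}\,C^\infty(S)$ is a vector field if and only if for every $x\in S$ and every open neighbourhood $U\subseteq O_x$ of $i^{-1}(x)$, $$X(\mathfrak{n}(i(U)))\subseteq\mathfrak{n}(i(U)).$$
   Context: Differential spaces. A differential structure on a nonempty set $X$ is a nonempty family $\mathcal{F}$ of functions $X\to\mathbb{R}$, with the weakest topology making them continuous, closed under $F(f_1,\dots,f_k)$ for $F\in C^\infty(\mathbb{R}^k)$, and such that any function locally (near each point) agreeing with elements of $\mathcal{F}$ is in $\mathcal{F}$. A map is functionally smooth (here: smooth) if it pulls back functions of the differential structure to functions of the differential structure. A subset $Y\subseteq X$ is a differential subspace with the functions that locally agree with restrictions of elements of $\mathcal{F}$. A subcartesian space is a paracompact, second-countable, Hausdorff differential space $(S,C^\infty(S))$ in which every point has an open neighbourhood diffeomorphic to a differential subspace of some $\mathbb{R}^n$. Vector fields. $\mathrm{Der}\,C^\infty(S)$ is the set of linear maps $X:C^\infty(S)\to C^\infty(S)$ with $X(fg)=fX(g)+gX(f)$. For $X\in\mathrm{Der}\,C^\infty(S)$ and $x\in S$, there is a unique maximal integral curve $t\mapsto\exp(tX)(x)$ through $x$: a smooth map from a connected subset $I^X_x\subseteq\mathbb{R}$ containing $0$ to $S$ with $\exp(0X)(x)=x$ and $\frac{d}{dt}f(\exp(tX)(x))=(Xf)(\exp(tX)(x))$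 for all $f\in C^\infty(S)$, $t\in I_x^X$, with maximal domain among such curves (a map with domain $\{0\}$ counts as an integral curve of every derivation). $X$ is a vector field if $A^X=\{(t,x)\mid x\in S, t\in I^X_x\}$ is open in $\mathbb{R}\times S$. $\mathrm{Vect}(S)$ is the set of vector fields. Orbits. $O_x$ is the set of all points $\exp(t_1X_1)\circ\dots\circ\exp(t_kX_k)(x)$ with $X_j\in\mathrm{Vect}(S)$, $t_j\in\mathbb{R}$ (where defined). For $\xi=(X_1,\dots,X_k)$ and $T=(t_1,\dots,t_k)$ put $\xi_T(y)=\exp(t_kX_k)\circ\dots\circ\exp(t_1X_1)(y)$, defined for $T$ in a set $U_y(\xi)\subseteq\mathbb{R}^k$. The orbit topology $\mathcal{T}$ on $O_x$ is the strongest topology for which all maps $U_y(\xi)\to O_x$, $T\mapsto\xi_T(y)$ ($y\in O_x$, any $\xi$) are continuous; with it each orbit is a smooth manifold and $i$ is smooth. For $A\subseteq S$, $\mathfrak{n}(A)=\{f\in C^\infty(S)\mid f|_A=0\}$. *)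

(* Defs.v *)
From HB Require Import structures.
From mathcomp Require Import all_boot all_order all_algebra.
From mathcomp Require Import all_classical all_reals all_analysis.
Import Order.TTheory GRing.Theory Num.Theory.
Import numFieldNormedType.Exports.

Set Implicit Arguments.
Unset Strict Implicit.
Unset Printing Implicit Defensive.

Local Open Scope classical_set_scope.
Local Open Scope ring_scope.

(* All iterated partial derivatives of order at most m exist and are
   continuous. *)
Fixpoint Cm (R : realType) (n m : nat) (f : 'rV[R]_n -> R) : Prop :=
  continuous f /\
  if m is m'.+1 then
    forall i : 'I_n, (forall x, derivable f x (delta_mx 0 i)) /\
      Cm m' (fun x => 'D_(delta_mx 0 i) f x)
  else True.

Definition Cinfty (R : realType) (n : nat) : set ('rV[R]_n -> R) :=
  [set f | forall m, Cm m f].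
Arguments Cinfty R n : clear implicits.

Definition Cinfty1 (R : realType) : set (R -> R) :=
  [set f | forall n x, derivable (derive1n n f) x 1].
Arguments Cinfty1 R : clear implicits.

(* A differential space is a topological space S together with the set C of
   its smooth functions; [dsp_weakest] forces the topology of S to be the one
   determined by C. *)
Record differential_structure (R : realType) (S : topologicalType)
    (C : set (S -> R)) : Prop := {
  dsp_point : [set: S] !=set0;
  dsp_nonempty : C !=set0;
  dsp_weakest : forall U : set S, open U <->
    @open (sup_topology (fun f : {f : S -> R | C f} =>
             Topological.class (initial_topology (sval f)))) U;
  dsp_comp : forall (k : nat) (F : 'rV[R]_k -> R) (f : 'I_k -> S -> R),
    Cinfty R k F -> (forall i, C (f i)) -> C (fun x => F (\row_i f i x));
  dsp_local : forall g : S -> R,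
    (forall x : S, exists2 f, C f & \forall z \near x, g z = f z) -> C g
}.

Definition smooth_map (R : realType) (S T : Type) (CS : set (S -> R))
    (CT : set (T -> R)) (phi : S -> T) : Prop :=
  forall g, CT g -> CS (g \o phi).

Definition diffeomorphic (R : realType) (S T : Type) (CS : set (S -> R))
    (CT : set (T -> R)) : Prop :=
  exists (phi : S -> T) (psi : T -> S),
    [/\ cancel phi psi, cancel psi phi, smooth_map CS CT phi &
        smooth_map CT CS psi].

Definition subspace_structure (R : realType) (S : topologicalType)
    (C : set (S -> R)) (Y : set S) : set (set_type Y -> R) :=
  [set g | forall y : set_type Y,
     exists2 f, C f & \forall z \near y, g z = f (set_val z)].
Arguments subspace_structure {R S} C Y.

Definition paracompact (S : topologicalType) : Prop :=
  forall A : set (set S), A `<=` open -> \bigcup_(U in A) U = [set: S] ->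
  exists B : set (set S),
    [/\ B `<=` open, \bigcup_(V in B) V = [set: S],
        forall V, B V -> exists2 U, A U & V `<=` U &
        forall x : S, exists2 W, nbhs x W &
          finite_set [set V | B V /\ V `&` W !=set0]].

Record subcartesian (R : realType) (S : topologicalType)
    (C : set (S -> R)) : Prop := {
  sc_structure : differential_structure C;
  sc_paracompact : paracompact S;
  sc_second_countable : @second_countable S;
  sc_hausdorff : hausdorff_space S;
  sc_chart : forall x : S, exists (U : set S) (n : nat) (Y : set 'rV[R]_n),
    open_nbhs x U /\
    diffeomorphic (subspace_structure C U) (subspace_structure (Cinfty R n) Y)
}.

(* A derivation of C is represented by an operator on all real functions, of
   which only the values on C matter, here and in all the notions below. *)
Record derivation (R : realType) (S : Type) (C : set (S -> R))
    (X : (S -> R) -> (S -> R)) : Prop := {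
  der_stable : forall f, C f -> C (X f);
  der_add : forall f g, C f -> C g ->
    X (fun x => f x + g x) = (fun x => X f x + X g x);
  der_scale : forall (a : R) f, C f ->
    X (fun x => a * f x) = (fun x => a * X f x);
  der_leibniz : forall f g, C f -> C g ->
    X (fun x => f x * g x) = (fun x => f x * X g x + g x * X f x)
}.

(* c : I -> S is an integral curve of X through x. The derivative is taken
   within I, so it is one-sided at an end point belonging to I; if I = [set 0]
   then t^' is the improper filter and the condition is void. *)
Definition integral_curve (R : realType) (S : topologicalType)
    (C : set (S -> R)) (X : (S -> R) -> (S -> R)) (x : S)
    (I : set R) (c : set_type I -> S) : Prop :=
  [/\ connected I, I 0,
      smooth_map (subspace_structure (Cinfty1 R) I) C c,
      forall t : set_type I, set_val t = 0 -> c t = x &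
      forall f, C f -> forall t : set_type I,
        (f (c s) - f (c t)) / (set_val s - set_val t) @[s --> t^']
          --> X f (c t)].

Definition maximal_integral_curve (R : realType) (S : topologicalType)
    (C : set (S -> R)) (X : (S -> R) -> (S -> R)) (x : S)
    (I : set R) (c : set_type I -> S) : Prop :=
  integral_curve C X x c /\
  forall (J : set R) (d : set_type J -> S),
    integral_curve C X x d -> J `<=` I.

(* exp(tX)(x) is defined and equal to y. *)
Definition expv (R : realType) (S : topologicalType) (C : set (S -> R))
    (X : (S -> R) -> (S -> R)) (t : R) (x y : S) : Prop :=
  exists (I : set R) (c : set_type I -> S), maximal_integral_curve C X x c /\
    exists2 s : set_type I, set_val s = t & c s = y.

Definition vector_field (R : realType) (S : topologicalType)
    (C : set (S -> R)) (X : (S -> R) -> (S -> R)) : Prop :=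
  derivation C X /\
  open [set p : R * S | exists y, expv C X p.1 p.2 y].

(* xi_t(y) is defined (that is, t belongs to U_y(xi)) and equal to z, where
   xi_t = exp(t_(k-1) X_(k-1)) o ... o exp(t_0 X_0) for xi = (X_0, ...). *)
Definition multi_exp (R : realType) (S : topologicalType) (C : set (S -> R))
    (k : nat) (xi : 'I_k -> (S -> R) -> (S -> R)) (t : 'rV[R]_k) (y z : S)
    : Prop :=
  exists p : nat -> S,
    [/\ p 0%N = y, p k = z &
        forall j : 'I_k, expv C (xi j) (t 0 j) (p j) (p j.+1)].

Definition vorbit (R : realType) (S : topologicalType) (C : set (S -> R))
    (x : S) : set S :=
  [set z | exists (k : nat) (xi : 'I_k -> (S -> R) -> (S -> R))
      (t : 'rV[R]_k),
    (forall j, vector_field C (xi j)) /\ multi_exp C xi t x z].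

Lemma vorbit_refl (R : realType) (S : topologicalType) (C : set (S -> R))
  (x : S) : vorbit C x x.
Proof.
exists 0%N, (fun=> id), 0; split; first by case.
by exists (fun=> x); split=> // -[].
Qed.

Definition orbit_space (R : realType) (S : topologicalType)
  (C : set (S -> R)) (x : S) : Type := set_type (vorbit C x).

(* The strongest topology for which all the maps t |-> xi_t(y), from U_y(xi)
   with the topology induced by R^k, are continuous: a set is open if and only
   if all its preimages are traces on U_y(xi) of open sets of R^k. *)
Definition orbit_open (R : realType) (S : topologicalType)
    (C : set (S -> R)) (x : S) : set (set (orbit_space C x)) :=
  [set V | forall (y : orbit_space C x) (k : nat)
      (xi : 'I_k -> (S -> R) -> (S -> R)),
    (forall j, vector_field C (xi j)) ->
    exists2 W : set 'rV[R]_k, open W &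
      forall (t : 'rV[R]_k) (z : orbit_space C x),
        multi_exp C xi t (set_val y) (set_val z) -> (V z <-> W t)].

Section orbit_topology.
Variables (R : realType) (S : topologicalType) (C : set (S -> R)) (x : S).

Let orbit_openT : orbit_open [set: orbit_space C x].
Proof. by move=> y k xi _; exists setT => //; exact: openT. Qed.

Let orbit_openI : setI_closed (@orbit_open R S C x).
Proof.
move=> V1 V2 o1 o2 y k xi vf.
have [W1 oW1 h1] := o1 y k xi vf; have [W2 oW2 h2] := o2 y k xi vf.
exists (W1 `&` W2); first exact: openI.
move=> t z tz; have {}h1 := h1 _ _ tz; have {}h2 := h2 _ _ tz.
by split=> -[] /=; tauto.
Qed.

Let orbit_open_bigU (I : Type) (V : I -> set (orbit_space C x)) :
  (forall i, orbit_open (V i)) -> orbit_open (\bigcup_i V i).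
Proof.
move=> oV y k xi vf.
have /choice[W hW] : forall i, exists W : set 'rV[R]_k, open W /\
    forall t (z : orbit_space C x),
      multi_exp C xi t (set_val y) (set_val z) -> (V i z <-> W t).
  by move=> i; have [W ? ?] := oV i y k xi vf; exists W.
exists (\bigcup_i W i); first by apply: bigcup_open => i _; have [] := hW i.
move=> t z tz; split=> -[i _ h]; exists i => //.
- by have [_ /(_ _ _ tz) [+ _]] := hW i; apply.
- by have [_ /(_ _ _ tz) [_ +]] := hW i; apply.
Qed.

HB.instance Definition _ := Choice.copy (orbit_space C x)
  (set_type (vorbit C x)).
HB.instance Definition _ := isOpenTopological.Build (orbit_space C x)
  orbit_openT orbit_openI orbit_open_bigU.

Lemma orbit_openE : @open (orbit_space C x) = @orbit_open R S C x.
Proof. by []. Qed.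

End orbit_topology.

Definition orbit_incl (R : realType) (S : topologicalType)
  (C : set (S -> R)) (x : S) (z : orbit_space C x) : S := set_val z.
Arguments orbit_incl {R S} C x z.

Definition vanishing (R : realType) (S : Type) (C : set (S -> R))
    (A : set S) : set (S -> R) :=
  [set f | C f /\ forall z, A z -> f z = 0].

(* Main.v *)
From HB Require Import structures.
Require Import Defs.
From mathcomp Require Import all_boot all_order all_algebra.
From mathcomp Require Import perm ring lra.
From mathcomp Require Import all_classical all_reals all_analysis.
Import Order.TTheory GRing.Theory Num.Theory.
Import numFieldNormedType.Exports.

Set Implicit Arguments.
Unset Strict Implicit.
Unset Printing Implicit Defensive.

Local Open Scope classical_set_scope.
Local Open Scope ring_scope.

(** Why the theorem holds.

The bridge between both sides is Fermat's rule: a derivation X is a vector field if and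
only if X f vanishes at every local maximum of every smooth function f
([vector_fieldP]). If X is a vector field then t |-> f(exp(tX)(s)) is defined on both
sides of 0, because the domain of the flow is open, and has a maximum at 0 when f has
one at s. Conversely, in a chart X is the restriction of a compactly supported field V
on R^n ([fchart]), and Fermat's rule says that V is tangent to S in the sense of Bony:
if q is a nearest point of S to y, then -|y - .|^2 has a local maximum at q, so that
V(q) is orthogonal to y - q. The squared distance to a compact piece of S therefore
obeys a linear differential inequality along the flow lines of V, and those that start
in S stay in S ([flow_stays]); local compactness of S provides nearest points and a time
that is uniform in the starting point. Joint continuity and smoothness of the flow of X
follow from those of the flow of V ([flow_near], [flow_smooth]). Fermat's rule also
shows that vector fields form a module over C^oo(S) and that they can be transported
along flows of vector fields ([vf_sum], [pushforward]).

If X is a vector field, U is open in the orbit topology and f vanishes on U, then for z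
in U the points exp(tX)(z) with t small are in U, so X f(z), the derivative at 0 of
f(exp(tX)(z)), is 0.

For the converse let f have a local maximum at p. Take as many vector fields W_i and
functions x_i as possible with W_i x_j = delta_ij at p; after a change of the W_i by a
matrix of smooth functions this holds near p ([frame_exists]). By transport the maximal
number d of such fields is constant along the orbit, so that near p, at the points of
the orbit, each vector field Z is the combination of the W_i with the coefficients Z x_i
([frame_span]). The composition Psi(t) = exp(t_(d-1) W_(d-1)) o ... o exp(t_0 W_0)(p)
satisfies x_j(Psi(t)) = t_j, and as its partial velocities are velocities of vector
fields, the partial derivatives of f o Psi are the functions (W_i f) o Psi
([Psi_derive]). Hence f o Psi is smooth. Let U be the set of the points z near p with z
= Psi(x(z)). It is open in the orbit topology: along a curve z(s) obtained by moving one
of the times in a composition of flows, the differences between the coordinates of z(s)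
and of Psi(x(z(s))) obey a linear differential inequality, so they stay 0 ([leaf_along],
[leaf_open]). Let F be a smooth function on R^d that extends f o Psi. Then g = f - F(x)
vanishes on U, so by hypothesis X g(p) = 0. Thus X f(p) is the sum of the W_i f(p) X
x_i(p), and W_i f(p) = 0 because the W_i are vector fields. So X obeys Fermat's rule. *)

(** * Calculus of the classes C^m on R^n *)

Lemma near_preim (R : realType) (T : topologicalType) (f : T -> R) x
    (P : set R) :
  {for x, continuous f} -> nbhs (f x) P -> \forall y \near x, P (f y).
Proof. by move=> cf h; exact: (cf _ h). Qed.

Lemma cont_near (R : realType) (T : topologicalType) (f g : T -> R) x :
  {for x, continuous f} -> (\forall y \near x, f y = g y) ->
  {for x, continuous g}.
Proof.
move=> cf fg; have e := nbhs_singleton fg; rewrite /prop_for /continuous_at -e.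
by apply: cvg_trans cf; apply: near_eq_cvg; exact: fg.
Qed.

Lemma cont_add (R : realType) (T : topologicalType) (f g : T -> R) x :
  {for x, continuous f} -> {for x, continuous g} ->
  {for x, continuous (fun y => f y + g y)}.
Proof. exact: continuousD. Qed.

Lemma cont_mul (R : realType) (T : topologicalType) (f g : T -> R) x :
  {for x, continuous f} -> {for x, continuous g} ->
  {for x, continuous (fun y => f y * g y)}.
Proof. exact: continuousM. Qed.

Lemma cont_sum (R : realType) (T : topologicalType) (I : Type) (r : seq I)
    (f : I -> T -> R) x :
  (forall i, {for x, continuous (f i)}) ->
  {for x, continuous (fun y => \sum_(i <- r) f i y)}.
Proof.
move=> cf; elim: r => [|i r IH].
  have -> : (fun y => \sum_(i <- [::]) f i y) = fun=> 0.
    by apply/funext => y; rewrite big_nil.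
  exact: cvg_cst.
have -> : (fun y => \sum_(j <- i :: r) f j y) =
    fun y => f i y + \sum_(j <- r) f j y.
  by apply/funext => y; rewrite big_cons.
exact: cont_add.
Qed.

Lemma is_d_add (R : realType) (V : normedModType R) (f g : V -> R) x v a b :
  is_derive x v f a -> is_derive x v g b ->
  is_derive x v (fun y => f y + g y) (a + b).
Proof. exact: is_deriveD. Qed.

Lemma is_d_mul (R : realType) (V : normedModType R) (f g : V -> R) x v a b :
  is_derive x v f a -> is_derive x v g b ->
  is_derive x v (fun y => f y * g y) (f x * b + g x * a).
Proof. exact: is_deriveM. Qed.

Lemma cont_pairl (T U V : topologicalType) (K : T * U -> V) t :
  continuous K -> continuous (fun u => K (t, u)).
Proof.
move=> cK u; apply: (@continuous_comp _ _ _ (fun u => (t, u)) K); last exact: cK.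
by apply: cvg_pair; [exact: cvg_cst|exact: cvg_id].
Qed.

Lemma mvt_any (R : realType) (F dF : R -> R) (a b : R) :
  (forall u : R, is_derive u 1 F (dF u)) ->
  exists2 c, `|c - a| <= `|b - a| & F b - F a = dF c * (b - a).
Proof.
move=> hF; have cF (A : set R) : {within A, continuous F}.
  apply: continuous_subspaceT => s; apply: differentiable_continuous.
  by apply/derivable1_diffP; exact: (@ex_derive _ _ _ _ _ _ _ (hF s)).
have [ab|/ltW ba] := leP a b.
  have [c] := MVT_segment ab (fun u _ => hF u) (cF _).
  rewrite in_itv/= => /andP[ac cb] e; exists c => //.
  by rewrite !ger0_norm ?subr_ge0// lerB.
have [c] := MVT_segment ba (fun u _ => hF u) (cF _).
rewrite in_itv/= => /andP[ac cb] e; exists c.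
  by rewrite distrC (distrC b) !ger0_norm ?subr_ge0// lerB.
by rewrite -opprB e -mulrN opprB.
Qed.

Lemma cont_comp (T U V : topologicalType) (f : T -> U) (g : U -> V) x :
  {for x, continuous f} -> {for f x, continuous g} ->
  {for x, continuous (fun y => g (f y))}.
Proof. exact: continuous_comp. Qed.

Lemma cont_pair (T U V : topologicalType) (f : T -> U) (g : T -> V) x :
  {for x, continuous f} -> {for x, continuous g} ->
  {for x, continuous (fun y => (f y, g y))}.
Proof. by move=> cf cg; apply: cvg_pair; [exact: cf|exact: cg]. Qed.

Lemma cont_cst (T U : topologicalType) (c : U) (x : T) :
  {for x, continuous (fun=> c)}.
Proof. exact: cvg_cst. Qed.

Lemma cont_sub (R : realType) (T : topologicalType) (f g : T -> R) x :
  {for x, continuous f} -> {for x, continuous g} ->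
  {for x, continuous (fun y => f y - g y)}.
Proof. exact: continuousB. Qed.

Lemma cont_norm (R : realType) (T : topologicalType) (f : T -> R) x :
  {for x, continuous f} -> {for x, continuous (fun y => `|f y|)}.
Proof. by move=> cf; apply: cvg_norm. Qed.

Lemma is_d_cst (R : realType) (V : normedModType R) (c : R) (x v : V) :
  is_derive x v (fun=> c) 0.
Proof. exact: is_derive_cst. Qed.

Lemma is_d_sub (R : realType) (V : normedModType R) (f g : V -> R) x v a b :
  is_derive x v f a -> is_derive x v g b ->
  is_derive x v (fun y => f y - g y) (a - b).
Proof. exact: is_deriveB. Qed.

Lemma is_d_opp (R : realType) (V : normedModType R) (f : V -> R) x v a :
  is_derive x v f a -> is_derive x v (fun y => - f y) (- a).
Proof. exact: is_deriveN. Qed.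

Lemma is_d_scale (R : realType) (V : normedModType R) (c : R) (f : V -> R) x v a :
  is_derive x v f a -> is_derive x v (fun y => c * f y) (c * a).
Proof.
by move=> hf; have := is_d_mul (is_d_cst c x v) hf; rewrite mulr0 addr0.
Qed.

Lemma is_d_sum (R : realType) (V : normedModType R) (I : Type) (r : seq I)
    (f : I -> V -> R) x v a :
  (forall i, is_derive x v (f i) (a i)) ->
  is_derive x v (fun y => \sum_(i <- r) f i y) (\sum_(i <- r) a i).
Proof.
move=> hf; elim: r => [|i r IH].
  rewrite big_nil; have -> : (fun y => \sum_(i <- [::]) f i y) = fun=> 0.
    by apply/funext => y; rewrite big_nil.
  exact: is_d_cst.
rewrite big_cons; have -> : (fun y => \sum_(j <- i :: r) f j y) =
    fun y => f i y + \sum_(j <- r) f j y.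
  by apply/funext => y; rewrite big_cons.
exact: is_d_add.
Qed.

Section Smooth.
Variable R : realType.
Implicit Types (n m : nat).

Lemma continuous_rowE (T : topologicalType) n (f : 'I_n -> T -> R) (t : T) :
  (forall i, {for t, continuous (f i)}) ->
  {for t, continuous (fun x => \row_i f i x)}.
Proof.
move=> cf A [P hP PA].
have H : \forall x \near t, forall i j, P i j ((\row_j f j x) i j).
  apply: filter_forall => i; apply: filter_forall => j.
  have hij := hP i j; rewrite !mxE in hij.
  by have := near_preim (cf j) hij; apply: filterS => x; rewrite mxE.
by apply: filterS H => x; exact: PA.
Qed.

Lemma cvg_rowE (T : Type) (F : set_system T) n (f : 'I_n -> T -> R)
    (l : 'I_n -> R) : Filter F ->
  (forall i, f i x @[x --> F] --> l i) ->
  (\row_i f i x) @[x --> F] --> \row_i l i.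
Proof.
move=> FF cf A [P hP PA].
have H : \forall x \near F, forall i j, P i j ((\row_j f j x) i j).
  apply: filter_forall => i; apply: filter_forall => j.
  have hij := hP i j; rewrite !mxE in hij.
  have h : \forall x \near F, P i j (f j x) := cf j _ hij.
  by apply: filterS h => x; rewrite mxE.
by apply: filterS H => x; exact: PA.
Qed.

Lemma Cm_cont n m (f : 'rV[R]_n -> R) : Cm m f -> continuous f.
Proof. by case: m => [|m] []. Qed.
Arguments Cm_cont {n m f} _ x t _.

Lemma Cm_intro n m (f : 'rV[R]_n -> R) (df : 'I_n -> 'rV[R]_n -> R) :
  continuous f -> (forall i x, is_derive x (delta_mx 0 i) f (df i x)) ->
  (forall i, Cm m (df i)) -> Cm m.+1 f.
Proof.
move=> cf hf hdf; split=> // i; split.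
  by move=> x; exact: (@ex_derive _ _ _ _ _ _ _ (hf i x)).
have -> : (fun x => 'D_(delta_mx 0 i) f x) = df i; last exact: hdf.
by apply/funext => x; exact: (@derive_val _ _ _ _ _ _ _ (hf i x)).
Qed.

Lemma Cm_pd n m (f : 'rV[R]_n -> R) i : Cm m.+1 f ->
  Cm m (fun x => 'D_(delta_mx 0 i) f x).
Proof. by case=> _ /(_ i)[]. Qed.

Lemma Cm_is_derive n m (f : 'rV[R]_n -> R) i x : Cm m.+1 f ->
  is_derive x (delta_mx 0 i) f ('D_(delta_mx 0 i) f x).
Proof. by case=> _ /(_ i)[hf _]; exact: derivableP. Qed.

Lemma CmS n m (f : 'rV[R]_n -> R) : Cm m.+1 f -> Cm m f.
Proof.
elim: m f => [|m IH] f hf; first by split=> //; exact: Cm_cont hf.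
apply: (@Cm_intro _ _ _ (fun i x => 'D_(delta_mx 0 i) f x)).
- exact: Cm_cont hf.
- by move=> i x; exact: Cm_is_derive hf.
- by move=> i; apply: IH; exact: Cm_pd.
Qed.

Lemma Cm_near n m (f : 'rV[R]_n -> R) :
  (forall x : 'rV[R]_n, exists2 g, Cm m g & \forall y \near x, f y = g y) ->
  Cm m f.
Proof.
elim: m f => [|m IH] f hf.
  split=> // x; have [g [cg _] fg] := hf x.
  by apply: (cont_near (cg x)); apply: filterS fg => y ->.
have cf : continuous f.
  move=> x; have [g hg fg] := hf x; have cg := Cm_cont hg.
  by apply: (cont_near (cg x)); apply: filterS fg => y ->.
split=> // i; split.
  move=> x; have [g [_ /(_ i)[dg _]] fg] := hf x.
  by apply: near_eq_derivable (dg x); apply: filterS fg => y ->.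
apply: IH => x; have [g hg fg] := hf x.
exists (fun y => 'D_(delta_mx 0 i) g y); first exact: Cm_pd.
have /nbhs_interior := fg; apply: filterS => y hy.
exact: near_eq_derive.
Unshelve. all: by end_near. Qed.

Lemma Cm_cst n m (c : R) : Cm m (fun _ : 'rV[R]_n => c).
Proof.
elim: m c => [|m IH] c; first by split=> //; exact: cst_continuous.
apply: (@Cm_intro _ _ _ (fun _ _ => 0)); last by move=> _; exact: IH.
exact: cst_continuous.

Qed.

Lemma is_derive_coord n (x v : 'rV[R]_n) (j : 'I_n) :
  is_derive x v (fun y : 'rV[R]_n => y 0 j) (v 0 j).
Proof.
apply: DeriveDef.
  by apply: diff_derivable; exact: differentiable_coord.
rewrite /derive.
apply: cvg_lim => //; apply: cvg_near_cst.
have h : \forall k \near (0 : R)^', k != 0 by exact: nbhs_dnbhs_neq.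
apply: filterS h => h h0.
by rewrite /= !mxE addrK /GRing.scale/= mulrA mulVf ?mul1r.
Qed.

Lemma Cm_coord n m (j : 'I_n) : Cm m (fun x : 'rV[R]_n => x 0 j).
Proof.
case: m => [|m]; first by split=> //; exact: coord_continuous.
apply: (@Cm_intro _ _ _ (fun i _ => delta_mx 0 i 0 j)) => [x|i x|i].
- exact: coord_continuous.
- exact: is_derive_coord.
- exact: Cm_cst.
Qed.

Lemma Cm_add n m (f g : 'rV[R]_n -> R) :
  Cm m f -> Cm m g -> Cm m (fun x => f x + g x).
Proof.
elim: m f g => [|m IH] f g hf hg.
  by have cf := Cm_cont hf; have cg := Cm_cont hg; split=> // x; exact: (cont_add (cf x) (cg x)).
apply: (@Cm_intro _ _ _ (fun i x => 'D_(delta_mx 0 i) f x +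
    'D_(delta_mx 0 i) g x)) => [x|i x|i].
- by have cf := Cm_cont hf; have cg := Cm_cont hg; exact: (cont_add (cf x) (cg x)).
- exact: (is_d_add (Cm_is_derive i x hf) (Cm_is_derive i x hg)).
- by apply: IH; exact: Cm_pd.
Qed.

Lemma Cm_mul n m (f g : 'rV[R]_n -> R) :
  Cm m f -> Cm m g -> Cm m (fun x => f x * g x).
Proof.
elim: m f g => [|m IH] f g hf hg.
  by have cf := Cm_cont hf; have cg := Cm_cont hg; split=> // x; exact: (cont_mul (cf x) (cg x)).
apply: (@Cm_intro _ _ _ (fun i x => f x * 'D_(delta_mx 0 i) g x +
    g x * 'D_(delta_mx 0 i) f x)) => [x|i x|i].
- by have cf := Cm_cont hf; have cg := Cm_cont hg; exact: (cont_mul (cf x) (cg x)).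
- exact: (is_d_mul (Cm_is_derive i x hf) (Cm_is_derive i x hg)).
- by apply: Cm_add; apply: IH; by [exact: CmS|exact: Cm_pd].
Qed.

Lemma Cm_sum n m (I : Type) (r : seq I) (f : I -> 'rV[R]_n -> R) :
  (forall i, Cm m (f i)) -> Cm m (fun x => \sum_(i <- r) f i x).
Proof.
move=> hf; elim: r => [|i r IH].
  by under eq_fun do rewrite big_nil; exact: Cm_cst.
by under eq_fun do rewrite big_cons; exact: Cm_add.
Qed.

Definition mean01 (f : R -> R) : R := \int[lebesgue_measure]_(s in `[0, 1]) f s.

Lemma mean01_itg (f : R -> R) : continuous f ->
  lebesgue_measure.-integrable `[0, 1] (EFin \o f).
Proof.
move=> cf; apply: continuous_compact_integrable; first exact: segment_compact.
by apply: continuous_subspaceT.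
Qed.

Lemma mean01B (f g : R -> R) : continuous f -> continuous g ->
  mean01 f - mean01 g = mean01 (fun s => f s - g s).
Proof. by move=> cf cg; rewrite /mean01 RintegralB//; exact: mean01_itg. Qed.

Lemma mean01_cst (c : R) : mean01 (fun _ => c) = c.
Proof.
rewrite /mean01 Rintegral_cst//= ?lebesgue_measure_itv/=.
by rewrite lte_fin ltr01 /= subr0 mulr1.
Qed.

Lemma le_mean01 (f g : R -> R) : continuous f -> continuous g ->
  (forall s, 0 <= s <= 1 -> f s <= g s) -> mean01 f <= mean01 g.
Proof.
move=> cf cg fg; apply: le_Rintegral; [by []|exact: mean01_itg|exact: mean01_itg|].
by move=> s /=; rewrite in_itv/= => /fg.
Qed.

Lemma mean01_bound (f : R -> R) (M : R) : continuous f ->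
  (forall s, 0 <= s <= 1 -> `|f s| <= M) -> `|mean01 f| <= M.
Proof.
move=> cf fM; rewrite ler_norml; apply/andP; split.
- rewrite -(mean01_cst (- M)); apply: le_mean01 => //; first by move=> x; exact: cvg_cst.
  by move=> s /fM; rewrite ler_norml => /andP[].
- rewrite -(mean01_cst M); apply: le_mean01 => //; first by move=> x; exact: cvg_cst.
  by move=> s /fM; rewrite ler_norml => /andP[].
Qed.

Lemma mean01Z (c : R) (f : R -> R) : continuous f ->
  c * mean01 f = mean01 (fun s => c * f s).
Proof. by move=> cf; rewrite /mean01 RintegralZl//; exact: mean01_itg. Qed.

Lemma mean01_deriv (f df : R -> R) : (forall s : R, is_derive s 1 f (df s)) ->
  continuous df -> mean01 df = f 1 - f 0.
Proof.
move=> fdf cdf; have cf : continuous f.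
  move=> s; apply: differentiable_continuous; apply/derivable1_diffP.
  exact: (@ex_derive _ _ _ _ _ _ _ (fdf s)).
rewrite /mean01 /Rintegral (@continuous_FTC2 _ df f)//.
- by apply: continuous_subspaceT.
- split=> [x _||].
  + exact: (@ex_derive _ _ _ _ _ _ _ (fdf x)).
  + by apply: cvg_at_right_filter; exact: cf.
  + by apply: cvg_at_left_filter; exact: cf.
- by move=> x _; rewrite derive1E; exact: (@derive_val _ _ _ _ _ _ _ (fdf x)).
Qed.

(** Joint continuity is uniform in the variable that ranges over a compact
interval. *)
Lemma tube01 (T : topologicalType) (K : T -> R -> R) w0 (e : R) : 0 < e ->
  continuous (fun p : T * R => K p.1 p.2) ->
  \forall w \near w0, forall s, 0 <= s <= 1 -> `|K w0 s - K w s| <= e.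
Proof.
move=> e0 cK.
have cKw w : continuous (K w) by exact: (cont_pairl (t := w) cK).
have /compact_near_coveringP cpt := @segment_compact R 0 1.
have H : \forall w \near w0, forall s, `[0, 1]%classic s ->
    `|K w0 s - K w s| <= e.
  apply: (cpt _ (nbhs w0) (fun w s => `|K w0 s - K w s| <= e)) => s _.
  have e2 : 0 < e / 2 by rewrite divr_gt0.
  have /cvgrPdist_lt/(_ _ e2) h1 := cK (w0, s).
  have /cvgrPdist_lt/(_ _ e2) h2 := cKw w0 s.
  have [[A B] /= [nA nB] hAB] := h1.
  exists (B `&` [set s' | `|K w0 s - K w0 s'| < e / 2], A).
    by split=> //=; exact: filterI.
  move=> [s' w] /= [[Bs' hs'] Aw].
  have := hAB (w, s') (conj Aw Bs') => /= hw.
  rewrite -(subrKA (K w0 s)) (le_trans (ler_normD _ _))//.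
  by rewrite (splitr e) lerD// ltW// distrC.
by apply: filterS H => w h s s01; apply: h; rewrite /= in_itv.
Qed.

Lemma mean01_cont (T : topologicalType) (K : T -> R -> R) :
  continuous (fun p : T * R => K p.1 p.2) -> continuous (fun w => mean01 (K w)).
Proof.
move=> cK w0.
have cKw w : continuous (K w) by exact: (cont_pairl (t := w) cK).
apply/cvgrPdist_le => e e0; have := tube01 w0 e0 cK.
apply: filterS => w h; rewrite mean01B//; apply: mean01_bound => //.
by move=> s; apply: cvgB; exact: cKw.
Qed.

Lemma is_derive_line (V : normedModType R) (g : V -> R) (a e : V) (k u d : R) :
  is_derive (a + (u * k) *: e) e g d ->
  is_derive u 1 (fun u => g (a + (u * k) *: e)) (k * d).
Proof.
set y := a + _ => hg.
have h0 : is_derive (0 : R) 1 (fun h : R => g (h *: e + y)) d.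
  have [ex_hg val_hg] := hg.
  apply: DeriveDef; first exact: (iffLR (derivable1P _ _ _) ex_hg).
  rewrite -val_hg /derive /=.
  set A := fun h => _; set B := fun h => _; suff -> : A = B by [].
  apply/funext => h; rewrite /A /B.
  by rewrite scale0r add0r addr0 /GRing.scale/= mulr1.
have ha : is_derive u 1 (fun u' => (u' - u) * k) k.
  have -> : (fun u' => (u' - u) * k) = (fun u' => k *: (u' - u)).
    by apply/funext => u'; rewrite mulrC.
  apply: is_derive_eq; rewrite /GRing.scale/=; ring.
rewrite mulrC.
have -> : (fun u' => g (a + (u' * k) *: e)) =
    (fun h : R => g (h *: e + y)) \o (fun u' => (u' - u) * k).
  apply/funext => u' /=; congr g; rewrite /y addrCA -scalerDl; congr (_ + _ *: _).
  by ring.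
by apply: is_derive1_comp ha; rewrite subrr mul0r.
Qed.

(** A motion from a to b, where w = (a, b), with its own clock c_i in each coordinate. *)
Definition mixrow n (c : 'I_n -> R -> R) (w : 'rV[R]_(n + n)) (s : R) : 'rV[R]_n :=
  \row_i ((1 - c i s) * w 0 (lshift n i) + c i s * w 0 (rshift n i)).

Lemma mixrow_cont n (c : 'I_n -> R -> R) : (forall i, continuous (c i)) ->
  continuous (fun p : 'rV[R]_(n + n) * R => mixrow c p.1 p.2).
Proof.
move=> cc p; apply: continuous_rowE => i.
have cs : {for p, continuous (fun p : 'rV[R]_(n + n) * R => c i p.2)}.
  by apply: (@continuous_comp _ _ _ snd (c i)); [exact: cvg_snd|exact: cc].
have co k : {for p, continuous (fun p : 'rV[R]_(n + n) * R => p.1 0 k)}.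
  apply: (@continuous_comp _ _ _ fst (fun w : 'rV_(n + n) => w 0 k)).
    exact: cvg_fst.
  exact: coord_continuous.
apply: cont_add; apply: cont_mul; try exact: co; try exact: cs.
by apply: cvgB; [exact: cvg_cst|exact: cs].
Qed.

Definition mixw n (c : 'I_n -> R -> R) (k : 'I_(n + n)) (s : R) : R :=
  match fintype.split k with inl i => 1 - c i s | inr i => c i s end.

Definition mixi n (k : 'I_(n + n)) : 'I_n :=
  match fintype.split k with inl i => i | inr i => i end.

Lemma mixrow_delta n (c : 'I_n -> R -> R) w k (u s : R) :
  mixrow c (w + u *: delta_mx 0 k) s =
  mixrow c w s + (u * mixw c k s) *: delta_mx 0 (mixi k).
Proof.
apply/rowP => i; rewrite !mxE !eqxx /= /mixw /mixi.
case: (split_ordP k) => j -> /=.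
  rewrite (inj_eq (@lshift_inj _ _)) eq_rlshift /=.
  by case: eqVneq => [->|_] /=; ring.
rewrite eq_lrshift (inj_eq (@rshift_inj _ _)) /=.
by case: eqVneq => [->|_] /=; ring.
Qed.

(** Differentiation under the integral sign: by the mean value theorem the difference
quotients are values of the integrand's derivative at nearby points, and [tube01]
makes their convergence uniform. *)
Lemma mean01_mixrow_Cm m n (g : 'rV[R]_n -> R) (c : 'I_n -> R -> R) (d : R -> R) :
  Cm m g -> (forall i, continuous (c i)) -> continuous d ->
  Cm m (fun w => mean01 (fun s => d s * g (mixrow c w s))).
Proof.
move=> + cc.
have cont0 (h : 'rV[R]_n -> R) (d' : R -> R) : continuous h -> continuous d' ->
    continuous (fun p : 'rV[R]_(n + n) * R => d' p.2 * h (mixrow c p.1 p.2)).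
  move=> ch cd p; apply: cont_mul.
    by apply: (@continuous_comp _ _ _ snd d'); [exact: cvg_snd|exact: cd].
  apply: (@continuous_comp _ _ _ (fun p => mixrow c p.1 p.2) h).
    exact: mixrow_cont.
  exact: ch.
elim: m g d => [|m IH] g d hg cd.
  split=> //; apply: (@mean01_cont _ (fun w s => d s * g (mixrow c w s))).
  by apply: cont0 => //; exact: Cm_cont hg.
pose phi k w s := (d s * mixw c k s) * 'D_(delta_mx 0 (mixi k)) g (mixrow c w s).
have cw k : continuous (mixw c k).
  rewrite /mixw; case: (fintype.split k) => i; last exact: cc.
  by move=> s; apply: cvgB; [exact: cvg_cst|exact: cc].
have cdw k : continuous (fun s => d s * mixw c k s).
  by move=> s; apply: cont_mul; [exact: cd|exact: cw].
have cphi k : continuous (fun p : 'rV[R]_(n + n) * R => phi k p.1 p.2).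
  exact: (cont0 _ _ (Cm_cont (Cm_pd (mixi k) hg)) (cdw k)).
have cG := cont0 _ _ (Cm_cont hg) cd.
apply: (@Cm_intro _ _ _ (fun k w => mean01 (phi k w))).
- exact: (@mean01_cont _ (fun w s => d s * g (mixrow c w s))).
- move=> k w; set e := delta_mx 0 k.
  have cGw w' : continuous (fun s => d s * g (mixrow c w' s)).
    exact: (cont_pairl (t := w') cG).
  have cphiw w' : continuous (phi k w') by exact: (cont_pairl (t := w') (cphi k)).
  suff H : (fun h : R => h^-1 *: (mean01 (fun s => d s * g (mixrow c (h *: e + w) s))
      - mean01 (fun s => d s * g (mixrow c w s)))) @ (0 : R)^' --> mean01 (phi k w).
    by apply: DeriveDef; [apply/cvg_ex; eexists; exact: H|exact/cvg_lim].
  apply/cvgrPdist_le => eps eps0.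
  have := @tube01 R (fun h s => phi k (w + h *: e) s) 0 _ eps0.
  have cH : continuous (fun p : R * R => phi k (w + p.1 *: e) p.2).
    move=> p; apply: (@continuous_comp _ _ _ (fun p : R * R => (w + p.1 *: e, p.2))
      (fun p => phi k p.1 p.2)); last exact: cphi.
    apply: cont_pair; last exact: cvg_snd.
    apply: cvgD; first exact: cvg_cst.
    by apply: cvgZr_tmp; exact: cvg_fst.
  move=> /(_ cH); rewrite scale0r addr0 => /nbhs_ballP[r /= r0 hr].
  have n0 : \forall h \near (0 : R)^', h != 0 by exact: nbhs_dnbhs_neq.
  near=> h.
  have h0 : h != 0 by near: h.
  have hr' : `|h| < r.
    near: h; apply: nbhs_dnbhs; apply/nbhs_ballP; exists r => //= x.
    by rewrite /ball/= sub0r normrN.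
  rewrite mean01B// -[_ *: mean01 _]/(h^-1 * mean01 _) mean01Z; last first.
    by move=> s; apply: cvgB; exact: cGw.
  rewrite mean01B//; last first.
    move=> s; apply: cvgM; first exact: cvg_cst.
    by apply: cvgB; exact: cGw.
  apply: mean01_bound.
    move=> s; apply: cvgB; first exact: cphiw.
    apply: cvgM; first exact: cvg_cst.
    by apply: cvgB; exact: cGw.
  move=> s s01.
  pose F u := d s * g (mixrow c (w + u *: e) s).
  have dF (u : R) : is_derive u 1 F (phi k (w + u *: e) s).
    rewrite /F; have -> : (fun u => d s * g (mixrow c (w + u *: e) s)) =
      (fun u => d s *: g (mixrow c w s + (u * mixw c k s) *: delta_mx 0 (mixi k))).
      by apply/funext => u'; rewrite mixrow_delta.
    apply: is_derive_eq.
      apply: is_deriveZ; apply: is_derive_line; exact: Cm_is_derive hg.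
    by rewrite /phi mixrow_delta /GRing.scale/= mulrA.
  have [th thh] := mvt_any 0 h dF.
  rewrite !subr0 in thh *; rewrite {1}/F {1}/F scale0r addr0 (addrC w).
  move=> ->; rewrite mulrCA mulVf// mulr1.
  by apply: hr => //; rewrite /ball/= sub0r normrN (le_lt_trans thh).
- by move=> k; have := IH _ _ (Cm_pd (mixi k) hg) (cdw k).
Unshelve. all: by end_near. Qed.

(** The coefficients of the telescopic first order expansion of F: the segment
from a to b is replaced by the broken line that changes one coordinate at a
time, so that only partial derivatives enter. *)
Definition hadw n (j i : 'I_n) (s : R) : R :=
  if (i < j)%N then 1 else if i == j then s else 0.

Definition had n (F : 'rV[R]_n -> R) (j : 'I_n) (w : 'rV[R]_(n + n)) : R :=
  mean01 (fun s => 'D_(delta_mx 0 j) F (mixrow (hadw j) w s)).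

Lemma hadw_cont n (j i : 'I_n) : continuous (hadw j i).
Proof.
have -> : hadw j i =
    if (i < j)%N then (fun=> 1) else if i == j then id else (fun=> 0).
  by apply/funext => s; rewrite /hadw; do 2?case: ifP.
case: ifP => _; first exact: cst_continuous.
by case: ifP => _; [move=> s; exact: cvg_id|exact: cst_continuous].
Qed.
Arguments hadw_cont {n} j i x t _.

Lemma had_Cm n m (F : 'rV[R]_n -> R) j : Cm m.+1 F -> Cm m (had F j).
Proof.
move=> hF; rewrite /had.
have -> : (fun w => mean01 (fun s => 'D_(delta_mx 0 j) F (mixrow (hadw j) w s))) =
  (fun w => mean01 (fun s => 1 * 'D_(delta_mx 0 j) F (mixrow (hadw j) w s))).
  by apply/funext => w; congr mean01; apply/funext => s; rewrite mul1r.
have c1 : continuous (fun _ : R => 1 : R) by exact: cst_continuous.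
have := mean01_mixrow_Cm (Cm_pd j hF) (hadw_cont j) c1.
exact.
Qed.

Lemma had_diag n (F : 'rV[R]_n -> R) j a :
  had F j (row_mx a a) = 'D_(delta_mx 0 j) F a.
Proof.
rewrite /had -[RHS]mean01_cst; congr mean01; apply/funext => s; congr ('D_ _ F _).
by apply/rowP => i; rewrite mxE row_mxEl row_mxEr; ring.
Qed.

(** Along each piece of the broken line F changes by the mean of a partial derivative. *)
Lemma hadamard n (F : 'rV[R]_n -> R) (a b : 'rV[R]_n) : Cm 1 F ->
  F b - F a = \sum_j had F j (row_mx a b) * (b 0 j - a 0 j).
Proof.
move=> hF.
pose z k : 'rV[R]_n := \row_(i < n) if (i < k)%N then b 0 i else a 0 i.
have -> : F b - F a = F (z n) - F (z 0%N).
  by congr (F _ - F _); apply/rowP => i; rewrite mxE ?ltn_ord.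
rewrite -(@telescope_sumr _ 0 n (F \o z))// big_mkord; apply: eq_bigr => j _ /=.
have zj s : mixrow (hadw j) (row_mx a b) s =
    z j + (s * (b 0 j - a 0 j)) *: delta_mx 0 j.
  apply/rowP => i; rewrite [LHS]mxE row_mxEl row_mxEr !mxE /hadw eqxx /=.
  case: ltnP => ij; first by rewrite (_ : i == j = false) ?mulr0 ?addr0; [ring|rewrite -val_eqE /= ltn_eqF].
  by case: eqVneq => /= [->|_]; ring.
have d (s : R) : is_derive s 1
    (fun s => F (z j + (s * (b 0 j - a 0 j)) *: delta_mx 0 j))
    ((b 0 j - a 0 j) *
     'D_(delta_mx 0 j) F (z j + (s * (b 0 j - a 0 j)) *: delta_mx 0 j)).
  exact: (is_derive_line (Cm_is_derive j _ hF)).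
have cD : continuous (fun s => 'D_(delta_mx 0 j) F (mixrow (hadw j) (row_mx a b) s)).
  have cm := cont_pairl (t := row_mx a b) (mixrow_cont (hadw_cont j)).
  have cD := Cm_cont (Cm_pd j hF).
  by move=> s; have := cont_comp (cm s) (cD _).
have /[!(mul1r, mul0r, scale0r, addr0)] H := mean01_deriv d.
move: H; rewrite mulrC /had mean01Z//; have -> : z j.+1 = z j + (b 0 j - a 0 j) *: delta_mx 0 j.
  apply/rowP => i; rewrite !mxE eqxx /= ltnS leq_eqVlt.
  have [->|ij] := eqVneq i j; first by rewrite !eqxx ltnn /= mulr1 addrC subrK.
  have -> : (nat_of_ord i == nat_of_ord j) = false by exact/negbTE.
  by rewrite mulr0 addr0.
move=> <-; last first.
  move=> s; apply: cvgM; first exact: cvg_cst.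
  by have := cD s; rewrite (_ : (fun s => 'D_(delta_mx 0 j) F (mixrow _ _ s)) =
    (fun s => 'D_(delta_mx 0 j) F (z j + (s * (b 0 j - a 0 j)) *: delta_mx 0 j))) //;
    apply/funext => s'; rewrite zj.
by congr mean01; apply/funext => s; rewrite zj.
Qed.

Lemma line_cont (V : normedModType R) (f : V -> R) x v : derivable f x v ->
  f (h *: v + x) @[h --> (0 : R)] --> f x.
Proof.
move=> /derivable1P /derivable1_diffP /differentiable_continuous.
by rewrite /prop_for /continuous_at scale0r add0r.
Qed.

(** Only partial derivatives of G are assumed: [hadamard] takes the place of
differentiability. *)
Lemma chain_rule n (V : normedModType R) (G : 'rV[R]_n -> R) (u : 'I_n -> V -> R)
    (du : 'I_n -> R) x v : Cm 1 G ->
  (forall j, is_derive x v (u j) (du j)) ->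
  is_derive x v (fun y => G (\row_j u j y))
    (\sum_j 'D_(delta_mx 0 j) G (\row_j u j x) * du j).
Proof.
move=> hG hu; set a := \row_j u j x.
suff H : (fun h : R => h^-1 *: (G (\row_j u j (h *: v + x)) - G a)) @ (0 : R)^' -->
    \sum_j 'D_(delta_mx 0 j) G a * du j.
  by apply: DeriveDef; [apply/cvg_ex; eexists; exact: H|exact/cvg_lim].
have -> : (fun h : R => h^-1 *: (G (\row_j u j (h *: v + x)) - G a)) =
  (fun h => \sum_j had G j (row_mx a (\row_j u j (h *: v + x))) *
     (h^-1 *: (u j (h *: v + x) - u j x))).
  apply/funext => h; rewrite hadamard// scaler_sumr; apply: eq_bigr => j _.
  by rewrite !mxE /GRing.scale/=; ring.
have cu j : u j (h *: v + x) @[h --> (0 : R)] --> u j x.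
  by apply: line_cont; have [] := hu j.
have crow : {for (0 : R), continuous (fun h : R => \row_j u j (h *: v + x))}.
  by apply: continuous_rowE => j; have := cu j; rewrite /prop_for /continuous_at scale0r add0r.
have cw : {for (0 : R), continuous (fun h : R => row_mx a (\row_j u j (h *: v + x)))}.
  have -> : (fun h : R => row_mx a (\row_j u j (h *: v + x))) =
    (fun h => \row_k match fintype.split k with inl i => a 0 i
              | inr i => u i (h *: v + x) end).
    apply/funext => h; apply/rowP => k; rewrite [RHS]mxE.
    by case: (split_ordP k) => i ->; rewrite ?row_mxEl ?row_mxEr// mxE.
  apply: continuous_rowE => k; case: (fintype.split k) => i; first exact: cvg_cst.
  by have := cu i; rewrite /prop_for /continuous_at scale0r add0r.
apply: cvg_big; first exact: add_continuous.
move=> j _; apply: cvgM.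
  have ch := Cm_cont (had_Cm j hG).
  have := cont_comp cw (ch _); rewrite /prop_for /continuous_at scale0r add0r.
  rewrite -/a had_diag => H; apply: cvg_trans H; apply: cvg_app; exact: nbhs_dnbhs.
by have [ex_u <-] := hu j.
Qed.

Lemma Cm_comp n k m (G : 'rV[R]_k -> R) (u : 'I_k -> 'rV[R]_n -> R) :
  Cm m G -> (forall j, Cm m (u j)) -> Cm m (fun x => G (\row_j u j x)).
Proof.
elim: m G u => [|m IH] G u hG hu.
  split=> // x; apply: (cont_comp (f := fun x => \row_j u j x)).
    by apply: continuous_rowE => j; have := Cm_cont (hu j); exact.
  by have := Cm_cont hG; exact.
have cr : continuous (fun x => \row_j u j x).
  by move=> x; apply: continuous_rowE => j; have := Cm_cont (hu j); exact.
have cG := Cm_cont hG.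
apply: (@Cm_intro _ _ _ (fun i x => \sum_j 'D_(delta_mx 0 j) G (\row_j u j x) *
   'D_(delta_mx 0 i) (u j) x)).
- by move=> x; exact: (cont_comp (cr x) (cG _)).
- move=> i x; apply: chain_rule; last by move=> j; exact: Cm_is_derive.
  by elim: m hG {IH hu} => // m IHm /CmS.
- move=> i; apply: Cm_sum => j; apply: Cm_mul; last exact: Cm_pd.
  apply: (IH (fun y => 'D_(delta_mx 0 j) G y)); first exact: Cm_pd.
  by move=> l; exact: CmS.
Qed.
End Smooth.

(** * Bump functions *)

Section Bump.
Variable R : realType.

Lemma near0_le (e : R) : 0 < e -> \forall h \near (0 : R)^', `|h| <= e.
Proof.
move=> e0; apply: nbhs_dnbhs; apply/nbhs_ballP; exists e => //= h.
by rewrite /ball/= sub0r normrN => /ltW.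
Qed.

Lemma is_d_comp (V : normedModType R) (g : R -> R) (f : V -> R) x v a b :
  is_derive (f x) 1 g a -> is_derive x v f b ->
  is_derive x v (fun y => g (f y)) (a * b).
Proof.
move=> hg hf.
have := @is_derive_line R V f (x - 0 *: v) v 1 0 b.
rewrite scale0r subr0 mul0r scale0r addr0 => /(_ hf); rewrite mul1r => hf0.
have hg0 : is_derive (f (x + (0 * 1) *: v)) 1 g a by rewrite mul0r scale0r addr0.
have H := is_derive1_comp hg0 hf0.
have [ex_H val_H] := H.
suff E : (fun h : R => h^-1 *: ((g \o (fun u => f (x + (u * 1) *: v))) (h *: 1 + 0) -
     (g \o (fun u => f (x + (u * 1) *: v))) 0)) =
  (fun h => h^-1 *: (g (f (h *: v + x)) - g (f x))).
  apply: DeriveDef.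
    by move: ex_H; rewrite /derivable /= E.
  by move: val_H; rewrite /derive /= E.
apply/funext => h /=; rewrite mul0r scale0r addr0 /GRing.scale/= mulr1 addr0 mulr1.
by rewrite [x + _]addrC.
Qed.

(** Meant for the family flat: each derivative is a combination of two other members,
so all of them are differentiable infinitely often. *)
Lemma Cm_lift1 (m : nat) (G : nat -> R -> R) :
  (forall k, exists a b : R, exists i j : nat, forall x : R,
     is_derive x 1 (G k) (a * G i x + b * G j x)) ->
  forall k, Cm m (fun v : 'rV[R]_1 => G k (v 0 0)).
Proof.
move=> dG.
have cG k : continuous (fun v : 'rV[R]_1 => G k (v 0 0)).
  move=> v; apply: (@cont_comp _ _ _ (fun v : 'rV[R]_1 => v 0 0)).
    exact: coord_continuous.
  apply: differentiable_continuous; apply/derivable1_diffP.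
  by have [a [b [i [j /(_ (v 0 0))[]]]]] := dG k.
elim: m => [|m IH] k; first by split=> //; exact: cG.
have [a [b [i [j dGk]]]] := dG k.
apply: (@Cm_intro _ _ _ _ (fun l v => (a * G i (v 0 0) + b * G j (v 0 0)) *
   (delta_mx 0 l : 'rV[R]_1) 0 0)).
- exact: cG.
- by move=> l v; apply: is_d_comp => //; exact: is_derive_coord.
- move=> l; apply: Cm_mul; last exact: Cm_cst.
  by apply: Cm_add; apply: Cm_mul; by [exact: Cm_cst|exact: IH].
Qed.

(** The derivatives of flat 0, that is of exp(-1/x) extended by 0, are combinations of
these functions. *)
Definition flat (k : nat) (x : R) : R :=
  if 0 < x then x^-1 ^+ k * expR (- x^-1) else 0.

Lemma flat_ge0 k x : 0 <= flat k x.
Proof.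
by rewrite /flat; case: ifP => // x0; rewrite mulr_ge0 ?expR_ge0// exprn_ge0// invr_ge0 ltW.
Qed.

(** The exponential dominates a term of its Taylor series, so that flat k is of second
order at 0 and its derivative there is 0. *)
Lemma flat_le k x : 0 < x -> flat k x <= (k.+2)`!%:R * x ^+ 2.
Proof.
move=> x0; rewrite /flat x0 expRN.
have u0 : 0 < x^-1 by rewrite invr_gt0.
have := expR_ge1Dxn k.+1 (ltW u0).
set u := x^-1 in u0 *; set c := _%:R => H.
have c0 : 0 < c by rewrite ltr0n fact_gt0.
have H' : u ^+ k.+2 / c <= expR u by rewrite (le_trans _ H)// lerDr.
rewrite ler_pdivrMr ?expR_gt0//.
rewrite (@le_trans _ _ (c * x ^+ 2 * (u ^+ k.+2 / c)))//; last first.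
  by rewrite ler_wpM2l// mulr_ge0 ?exprn_ge0 ?ltW.
have xu : x * u = 1 by rewrite /u divff// gt_eqF.
have -> : c * x ^+ 2 * (u ^+ k.+2 / c) = (c / c) * (u ^+ k * (x * u) ^+ 2).
  have E (c' x' u' : R) : c' * x' ^+ 2 * (u' ^+ k.+2 / c') =
      (c' / c') * (u' ^+ k * (x' * u') ^+ 2) by rewrite exprMn !exprS expr0; ring.
  exact: E.
by rewrite xu expr1n mulr1 divff ?mul1r// gt_eqF.
Qed.

Lemma is_derive_flat k (x : R) :
  is_derive x 1 (flat k) (- k%:R * flat k.+1 x + 1 * flat k.+2 x).
Proof.
have [x0|x0|x0] := ltgtP x 0.
- rewrite {2 3}/flat ltNge (ltW x0) /= !mulr0 addr0.
  have H0 : is_derive x 1 (fun=> 0 : R) (0 : R) by exact: is_derive_cst.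
  apply: near_eq_is_derive H0.
  have : \forall y \near x, y < 0 by exact: lt_nbhsl.
  by apply: filterS => y y0; rewrite /flat ltNge (ltW y0).
- rewrite {2 3}/flat x0.
  suff H0 : is_derive x 1 (fun y : R => y^-1 ^+ k * expR (- y^-1))
      (- k%:R * (x^-1 ^+ k.+1 * expR (- x^-1)) +
       1 * (x^-1 ^+ k.+2 * expR (- x^-1))).
    apply: near_eq_is_derive H0.
    have : \forall y \near x, 0 < y by exact: lt_nbhsr.
    by apply: filterS => y y0; rewrite /flat y0.
  have xn0 : x != 0 by rewrite gt_eqF.
  have d1 : is_derive x 1 (fun y : R => y^-1) (- x ^- 2 *: 1).
    exact: (@is_deriveV _ id).
  pose p (u : R) := u ^+ k * expR (- u).
  have d2 : is_derive x^-1 1 p (- (x^-1 ^+ k * expR (- x^-1)) +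
      k%:R * x^-1 ^+ k.-1 * expR (- x^-1)).
    have h1 : is_derive x^-1 1 (fun u : R => u ^+ k) (k%:R * x^-1 ^+ k.-1).
      apply: DeriveDef; first exact: exprn_derivable.
      by rewrite exp_derive /GRing.scale/= mulr1.
    have h2 : is_derive x^-1 1 (fun u : R => expR (- u)) (expR (- x^-1) * -1).
      exact: (@is_d_comp _ expR (fun u : R => - u)).
    have := is_d_mul h1 h2; congr (is_derive _ _ _ _); ring.
  have := is_d_comp d2 d1; congr (is_derive _ _ _ _).
  rewrite /GRing.scale/= mulr1 -exprVn !exprS; case: k {p d2} => [|k] /=; first by ring.
  by rewrite exprS; ring.
- rewrite x0 {2 3}/flat ltxx !mulr0 addr0.
  suff H : (fun h : R => h^-1 *: (flat k (h *: 1 + 0) - flat k 0)) @ (0 : R)^' --> (0 : R).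
    by apply: DeriveDef; [apply/cvg_ex; eexists; exact: H|exact/cvg_lim].
  pose c : R := (k.+2)`!%:R.
  have b (h : R) : `|h^-1 *: (flat k (h *: 1 + 0) - flat k 0)| <= c * `|h|.
    rewrite {2}/flat ltxx subr0 addr0 /GRing.scale/= mulr1.
    have [h0|h0] := ltP 0 h; last by rewrite /flat ltNge h0 /= mulr0 normr0 mulr_ge0.
    rewrite !ger0_norm ?mulr_ge0 ?invr_ge0 ?flat_ge0 ?(ltW h0)//.
    rewrite mulrC ler_pdivrMr// -mulrA -expr2; exact: flat_le.
  have c0 : 0 < c by rewrite ltr0n fact_gt0.
  apply/cvgr0Pnorm_le => e e0; near=> h.
  rewrite (le_trans (b h))//.
  rewrite mulrC -ler_pdivlMr//; near: h.
  by apply: near0_le; rewrite divr_gt0.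
Unshelve. all: by end_near. Qed.

Lemma Cm_inv n m (f : 'rV[R]_n -> R) : (forall x, 0 < f x) -> Cm m f ->
  Cm m (fun x => (f x)^-1).
Proof.
move=> f0; elim: m => [|m IH] hf.
  split=> // x; have cf := Cm_cont hf.
  exact: (cvgV (lt0r_neq0 (f0 x)) (cf x)).
have cf := Cm_cont hf.
apply: (@Cm_intro _ _ _ _ (fun i x => - 1 * ((f x)^-1 * (f x)^-1) * 'D_(delta_mx 0 i) f x)).
- by move=> x; exact: (cvgV (lt0r_neq0 (f0 x)) (cf x)).
- move=> i x; apply: (@is_d_comp _ (fun y : R => y^-1) _ _ _ _ _ _
    (Cm_is_derive i x hf)).
  have := @is_deriveV R id (f x) 1 1; rewrite gt_eqF// => /(_ isT (is_derive_id _ _)).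
  by rewrite /GRing.scale/= mulr1 mulN1r -invfM expr2.
- move=> i; apply: Cm_mul; last exact: Cm_pd.
  by apply: Cm_mul; [exact: Cm_cst|apply: Cm_mul; apply: IH; exact: CmS].
Qed.

(** A smooth step: 0 on (-oo, 0], 1 on [1, +oo). *)
Definition step (x : R) : R := flat 0 x / (flat 0 x + flat 0 (1 - x)).

Lemma flat0_gt0 (x : R) : 0 < x -> 0 < flat 0 x.
Proof. by move=> x0; rewrite /flat x0 expr0 mul1r expR_gt0. Qed.

Lemma step_den (x : R) : 0 < flat 0 x + flat 0 (1 - x).
Proof.
have [x0|x0] := ltP 0 x.
  by rewrite ltr_wpDr ?flat_ge0 ?flat0_gt0.
by rewrite ltr_wpDl ?flat_ge0 ?flat0_gt0// subr_gt0 (le_lt_trans x0).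
Qed.

Lemma step_ge0 x : 0 <= step x.
Proof. by rewrite divr_ge0 ?flat_ge0 ?ltW ?step_den. Qed.

Lemma step_le1 x : step x <= 1.
Proof. by rewrite ler_pdivrMr ?step_den// mul1r lerDl flat_ge0. Qed.

Lemma step0 x : x <= 0 -> step x = 0.
Proof. by move=> x0; rewrite /step {1}/flat ltNge x0 /= mul0r. Qed.

Lemma step1 x : 1 <= x -> step x = 1.
Proof.
move=> x1; rewrite /step {3}/flat subr_gt0 ltNge x1 /= addr0 divff//.
by rewrite gt_eqF// flat0_gt0// (lt_le_trans _ x1).
Qed.

Lemma Cm_1comp n m (g : R -> R) (f : 'rV[R]_n -> R) :
  Cm m (fun v : 'rV[R]_1 => g (v 0 0)) -> Cm m f -> Cm m (fun x => g (f x)).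
Proof.
move=> hg hf; have := Cm_comp hg (fun _ : 'I_1 => hf).
by congr (Cm m _); apply/funext => x; rewrite mxE.
Qed.

Lemma Cm_flat m k : Cm m (fun v : 'rV[R]_1 => flat k (v 0 0)).
Proof.
apply: Cm_lift1 => {}k; exists (- k%:R), 1, k.+1, k.+2 => x.
exact: is_derive_flat.
Qed.

Lemma Cm_aff n m (a b : R) (f : 'rV[R]_n -> R) : Cm m f ->
  Cm m (fun x => a * f x + b).
Proof.
by move=> hf; apply: Cm_add; [apply: Cm_mul => //|]; exact: Cm_cst.
Qed.

Lemma Cm_step n m (f : 'rV[R]_n -> R) : Cm m f -> Cm m (fun x => step (f x)).
Proof.
apply: Cm_1comp; apply: Cm_mul; first exact: Cm_flat.
apply: Cm_inv; first by move=> x; exact: step_den.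
apply: Cm_add; first exact: Cm_flat.
apply: (@Cm_1comp _ _ (flat 0) (fun v : 'rV[R]_1 => 1 - v 0 0)); first exact: Cm_flat.
have -> : (fun v : 'rV[R]_1 => 1 - v 0 0) = (fun v => (-1) * v 0 0 + 1).
  by apply/funext => v; ring.
by apply: Cm_aff; exact: Cm_coord.
Qed.

Lemma Cm_prod n m (I : Type) (r : seq I) (f : I -> 'rV[R]_n -> R) :
  (forall i, Cm m (f i)) -> Cm m (fun x => \prod_(i <- r) f i x).
Proof.
move=> hf; elim: r => [|i r IH].
  by under eq_fun do rewrite big_nil; exact: Cm_cst.
by under eq_fun do rewrite big_cons; exact: Cm_mul.
Qed.

(** Equal to 1 on the cube of half-side r1, to 0 outside that of half-side r2. *)
Definition boxbump n (r1 r2 : R) (x : 'rV[R]_n) : R :=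
  \prod_(i < n) (step ((r2 - x 0 i) / (r2 - r1)) * step ((r2 + x 0 i) / (r2 - r1))).

Lemma Cm_boxbump n m r1 r2 : Cm m (@boxbump n r1 r2).
Proof.
apply: Cm_prod => i; apply: Cm_mul; apply: Cm_step.
  have -> : (fun x : 'rV[R]_n => (r2 - x 0 i) / (r2 - r1)) =
    (fun x => - (r2 - r1)^-1 * x 0 i + r2 / (r2 - r1)) by apply/funext => x; ring.
  by apply: Cm_aff; exact: Cm_coord.
have -> : (fun x : 'rV[R]_n => (r2 + x 0 i) / (r2 - r1)) =
  (fun x => (r2 - r1)^-1 * x 0 i + r2 / (r2 - r1)) by apply/funext => x; ring.
by apply: Cm_aff; exact: Cm_coord.
Qed.

Lemma boxbump1 n r1 r2 (x : 'rV[R]_n) : r1 < r2 ->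
  (forall i, `|x 0 i| <= r1) -> boxbump r1 r2 x = 1.
Proof.
move=> r12 hx; rewrite /boxbump big1// => i _.
have d0 : 0 < r2 - r1 by rewrite subr_gt0.
have := hx i; rewrite ler_norml => /andP[h1 h2].
by rewrite !step1 ?mulr1// ler_pdivlMr// mul1r; lra.
Qed.

Lemma boxbump0 n r1 r2 (x : 'rV[R]_n) i : r1 < r2 ->
  r2 <= `|x 0 i| -> boxbump r1 r2 x = 0.
Proof.
move=> r12 hx; rewrite /boxbump (bigD1 i)//=.
have d0 : 0 < r2 - r1 by rewrite subr_gt0.
have [x0|x0] := leP 0 (x 0 i).
  rewrite ger0_norm// in hx; rewrite (@step0 ((r2 - x 0 i) / _)) ?mul0r//.
  by rewrite ler_pdivrMr// mul0r; lra.
rewrite ltr0_norm// in hx; rewrite (@step0 ((r2 + x 0 i) / _)) ?mulr0 ?mul0r//.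
by rewrite ler_pdivrMr// mul0r; lra.
Qed.

End Bump.

(** * Flows of Lipschitz vector fields on R^n *)

Section ODE.
Variable R : realType.

(** An integral from a is differentiable at t for t > a only, so the lower end is moved to
the left of both 0 and t; its choice does not affect the increment from 0 to t. *)
Lemma antideriv (f : R -> R) : continuous f ->
  exists2 F : R -> R, F 0 = 0 & forall t : R, is_derive t 1 F (f t).
Proof.
move=> cf; pose G (a t : R) := \int[lebesgue_measure]_(s in [set` `[a, t]]) f s.
have dG (a t : R) : a < t -> is_derive t 1 (G a) (f t).
  move=> ab; have tu : t < t + 1 by rewrite ltrDl.
  have iab : lebesgue_measure.-integrable `[a, t + 1] (EFin \o f).
    apply: continuous_compact_integrable; first exact: segment_compact.
    exact: continuous_subspaceT.
  have [ex_G val_G] := continuous_FTC1_closed tu iab ab (cf t).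
  by apply: DeriveDef => //; rewrite -derive1E.
have GE (a b t : R) : a < 0 -> b < 0 -> a < t -> b < t ->
    G a t - G a 0 = G b t - G b 0.
  move=> a0 b0 at0 bt.
  suff : (G a t - G b t) = (G a 0 - G b 0) by move=> E; lra.
  pose g u := G a u - G b u.
  have dg u : a < u -> b < u -> is_derive u 1 g 0.
    move=> au bu; have := is_deriveB (dG _ _ au) (dG _ _ bu).
    by rewrite subrr.
  have cg c d : a < c -> b < c -> {within `[c, d], continuous g}.
    move=> ac bc; apply: derivable_within_continuous => x.
    rewrite in_itv/= => /andP[cx _].
    by have [] := dg x (lt_le_trans ac cx) (lt_le_trans bc cx).
  have [t0|/ltW t0] := leP 0 t.
    have [|c _] := @MVT_segment _ g (fun=> 0) 0 t t0 _ (cg _ _ a0 b0).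
      move=> x; rewrite in_itv/= => /andP[x0 _].
      by apply: dg; [exact: lt_trans x0|exact: lt_trans x0].
    by rewrite mul0r => /eqP; rewrite subr_eq0 => /eqP.
  have [|c _] := @MVT_segment _ g (fun=> 0) t 0 t0 _ (cg _ _ at0 bt).
    move=> x; rewrite in_itv/= => /andP[x0 _].
    by apply: dg; [exact: lt_trans x0|exact: lt_trans x0].
  by rewrite mul0r => /eqP; rewrite subr_eq0 => /eqP.
pose a (t : R) := - (`|t| + 1).
have at0 t : a t < 0 by rewrite oppr_lt0 ltr_pwDr.
have att t : a t < t by rewrite /a ltrNl (le_lt_trans (ler_norm _))// normrN ltrDl.
exists (fun t => G (a t) t - G (a t) 0); first by rewrite subrr.
move=> t; pose a0 := - (`|t| + 2).
have a00 : a0 < 0 by rewrite oppr_lt0 ltr_pwDr.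
have a0t : a0 < t by apply: le_lt_trans (att t); rewrite /a0 /a; lra.
apply: (@near_eq_is_derive _ _ _ (fun u => G a0 u - G a0 0)); last first.
  rewrite -[f t]subr0; apply: is_deriveB (dG _ _ a0t) _.
have : \forall u \near t, a0 < u by exact: lt_nbhsr.
by apply: filterS => u au; rewrite (GE (a u) a0).
Qed.

Definition prim (f : R -> R) : R -> R :=
  match pselect (continuous f) with
  | left cf => s2val (cid2 (antideriv cf))
  | right _ => fun=> 0
  end.

Lemma prim0 f : continuous f -> prim f 0 = 0.
Proof. by rewrite /prim => cf; case: pselect => // cf'; case: cid2. Qed.

Lemma is_derive_prim f (t : R) : continuous f -> is_derive t 1 (prim f) (f t).
Proof. by rewrite /prim => cf; case: pselect => // cf'; case: cid2. Qed.

Lemma derive_cont (f df : R -> R) :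
  (forall t : R, is_derive t 1 f (df t)) -> continuous f.
Proof.
move=> h t; apply: differentiable_continuous; apply/derivable1_diffP.
by have [] := h t.
Qed.

Lemma half_cvg (a : nat -> R) (c : R) :
  (forall k, `|a k.+1 - a k| <= c / 2 ^+ k) -> cvgn a.
Proof.
move=> ha.
have c0 : 0 <= c by have := ha 0%N; rewrite expr0 divr1; exact: le_trans.
pose d k := a k.+1 - a k.
have aE : a = (fun n => a 0%N + series d n).
  apply/funext => n; rewrite /series/= /d telescope_sumr//; ring.
rewrite aE; apply: is_cvgD; first exact: is_cvg_cst.
apply: normed_cvg.
apply: (@series_le_cvg _ _ (geometric c (2^-1))) => [n|n|n|].
- exact: normr_ge0.
- by rewrite /geometric/= mulr_ge0 ?exprn_ge0 ?invr_ge0.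
- by rewrite /geometric/= exprVn; exact: ha.
- apply: is_cvg_geometric_series; rewrite ger0_norm ?invr_ge0//.
  by rewrite invf_lt1 ?ltr1n.
Qed.

(** With the weight exp(L|t|), integration gains a factor 1/L. Hence the Picard
iterates converge geometrically on the whole line at once. *)
Lemma ler_expR_cmp (L A : R) (d dd : R -> R) : 0 <= L -> 0 <= A -> d 0 = 0 ->
  (forall t : R, is_derive t 1 d (dd t)) ->
  (forall t, `|dd t| <= L * (A * expR (L * `|t|))) ->
  forall t, `|d t| <= A * expR (L * `|t|).
Proof.
move=> L0 A0 d0 hd hdd.
wlog suff H : d dd d0 hd hdd / forall t, 0 <= t -> d t <= A * expR (L * t).
  move=> t; have [t0|/ltW t0] := leP 0 t.
    rewrite (ger0_norm t0) ler_norml H// andbT lerNl.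
    apply: (H (fun t => - d t) (fun t => - dd t)) => //.
    - by rewrite d0 oppr0.
    - by move=> u; rewrite normrN.
  have dr (s u : R) : is_derive u 1 (fun u => s * d (- u)) (- s * dd (- u)).
    have h1 : is_derive u 1 (fun u : R => d (- u)) (dd (- u) * -1).
      exact: (@is_d_comp _ _ d (fun u : R => - u)).
    by have := is_d_scale s h1; congr (is_derive _ _ _ _); ring.
  have hb (s : R) : `|s| = 1 -> s * d t <= A * expR (L * - t).
    move=> s1; have := H (fun u => s * d (- u)) (fun u => - s * dd (- u)) _ (dr s) _ (- t).
    rewrite opprK; apply; rewrite ?oppr_ge0//; first by rewrite oppr0 d0 mulr0.
    by move=> u; rewrite normrM normrN s1 mul1r -(normrN u).
  rewrite (ler0_norm t0) ler_norml; apply/andP; split.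
    by rewrite lerNl -mulN1r hb// normrN1.
  by rewrite -[d t]mul1r hb// normr1.
move=> t t0.
pose g u := A * expR (L * u) - d u.
have dg (u : R) : is_derive u 1 g (L * (A * expR (L * u)) - dd u).
  have h1 : is_derive u 1 (fun u : R => expR (L * u)) (expR (L * u) * L).
    apply: (@is_d_comp _ _ expR (fun u : R => L * u)).
    by have := is_d_scale L (is_derive_id u 1); rewrite mulr1.
  by have := is_d_sub (is_d_scale A h1) (hd u); congr (is_derive _ _ _ _); ring.
have cg := derive_cont dg.
have [c] := MVT_segment t0 (fun u _ => dg u) (@continuous_subspaceT _ _ _ _ cg).
rewrite in_itv/= => /andP[c0 _] E.
have : 0 <= g t - g 0.
  rewrite E mulr_ge0 ?subr_ge0//.
  by have := hdd c; rewrite (ger0_norm c0) ler_norml => /andP[].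
rewrite /g mulr0 expR0 d0; lra.
Qed.

Record lip_field n (V : 'I_n -> 'rV[R]_n -> R) (K B : R) : Prop := {
  lip_K0 : 0 <= K;
  lip_B0 : 0 <= B;
  lip_bound : forall i x, `|V i x| <= B;
  lip_lip : forall i x y, `|V i x - V i y| <= K * \sum_j `|x 0 j - y 0 j|
}.

Lemma cont_eps (T : topologicalType) (f : T -> R) (x : T) :
  (forall e : R, 0 < e -> \forall y \near x, `|f x - f y| <= e) ->
  {for x, continuous f}.
Proof. by move=> h; apply/cvgrPdist_le => e e0; exact: h. Qed.

Lemma lip_cont n (V : 'I_n -> 'rV[R]_n -> R) K B i : lip_field V K B ->
  continuous (V i).
Proof.
move=> lV x; apply: cont_eps => e e0.
pose s (y : 'rV[R]_n) := K * \sum_j `|x 0 j - y 0 j|.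
have cs : {for x, continuous s}.
  apply: cont_mul; first exact: cont_cst.
  apply: cont_sum => j; apply: cont_norm.
  by apply: cont_sub; [exact: cont_cst|exact: coord_continuous].
have sx : s x = 0 by rewrite /s big1 ?mulr0// => j _; rewrite subrr normr0.
have := near_preim cs (lt_nbhsl (_ : s x < e)); rewrite sx => /(_ e0).
by apply: filterS => y /ltW; apply: le_trans; exact: lip_lip lV _ _ _.
Qed.
Arguments lip_cont {n V K B} i _ x t _.

Definition is_sol n (V : 'I_n -> 'rV[R]_n -> R) (c : R -> 'rV[R]_n) :=
  forall (t : R) i, is_derive t 1 (fun t => c t 0 i) (V i (c t)).

(** Picard iteration.  No integral of the limit is taken: the iterates are
uniformly Lipschitz in time, so their increments over a time step h are
h V + O(h^2) uniformly, and this estimate passes to the pointwise limit. *)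
Lemma picard n (V : 'I_n -> 'rV[R]_n -> R) K B (x : 'rV[R]_n) :
  lip_field V K B -> exists2 c, c 0 = x & is_sol V c.
Proof.
move=> lV; have K0 := lip_K0 lV; have B0 := lip_B0 lV.
pose u := fix u k : R -> 'rV[R]_n :=
  if k is k'.+1 then fun t => \row_i (x 0 i + prim (fun s => V i (u k' s)) t)
  else fun=> x.
have cV i := lip_cont i lV.
have cu k i : continuous (fun s => V i (u k s)).
  elim: k i => [|k IH] i t; first exact: cont_cst.
  apply: (cont_comp (f := u k.+1)); last exact: cV.
  apply: continuous_rowE => j; apply: cont_add; first exact: cvg_cst.
  by apply: (derive_cont (df := fun s => V j (u k s))) => s; exact: is_derive_prim.
have uS k i t : u k.+1 t 0 i = x 0 i + prim (fun s => V i (u k s)) t by rewrite mxE.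
have du k i (t : R) : is_derive t 1 (fun t => u k.+1 t 0 i) (V i (u k t)).
  have -> : (fun t => u k.+1 t 0 i) = fun t => x 0 i + prim (fun s => V i (u k s)) t.
    by apply/funext => s; exact: uS.
  by rewrite -[V i _]add0r; apply: is_d_add; exact: is_derive_prim.
have u0 k i : u k 0 0 i = x 0 i.
  by case: k => // k; rewrite uS prim0 ?addr0.
pose L := 1 + 2 * (K * n%:R).
have L0 : 0 <= L by rewrite addr_ge0// !mulr_ge0.
have L1 : 0 < L by rewrite ltr_pwDl// !mulr_ge0.
pose C := B / L.
have hC k i t : `|u k.+1 t 0 i - u k t 0 i| <= C / 2 ^+ k * expR (L * `|t|).
  elim: k i t => [|k IH] i t.
    apply: (@ler_expR_cmp L _ (fun t => u 1%N t 0 i - u 0%N t 0 i)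
      (fun t => V i x)) => //.
    - by rewrite !divr_ge0 ?exprn_ge0.
    - by rewrite !u0 subrr.
    - by move=> s; rewrite -[V i x]subr0; exact: (is_d_sub (du 0%N i s) (is_d_cst _ _ _)).
    - move=> s; rewrite expr0 divr1 (le_trans (lip_bound lV _ _))// mulrA.
      rewrite /C mulrCA divff ?gt_eqF// mulr1 ler_peMr//.
      by rewrite -expR0 ler_expR mulr_ge0.
  apply: (@ler_expR_cmp L _ (fun t => u k.+2 t 0 i - u k.+1 t 0 i)
      (fun t => V i (u k.+1 t) - V i (u k t))) => //.
  - by rewrite !divr_ge0 ?exprn_ge0.
  - by rewrite !u0 subrr.
  - move=> s; rewrite (le_trans (lip_lip lV _ _ _))//.
    have : \sum_j `|u k.+1 s 0 j - u k s 0 j| <=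
        \sum_(j < n) C / 2 ^+ k * expR (L * `|s|).
      by apply: ler_sum => j _; exact: IH.
    rewrite sumr_const card_ord -[_ *+ n]mulr_natr => /(ler_wpM2l K0); move=> /le_trans; apply.
    set e := expR _; have e0 : 0 <= e by exact: expR_ge0.
    have -> : K * (C / 2 ^+ k * e * n%:R) = (2 * (K * n%:R)) * (C / 2 ^+ k.+1 * e).
      by rewrite exprS invfM; lra.
    by rewrite ler_wpM2r ?lerDr// mulr_ge0// !divr_ge0 ?exprn_ge0.
have cvu i t : cvgn (fun k => u k t 0 i).
  apply: (@half_cvg _ (C * expR (L * `|t|))) => k.
  by rewrite mulrAC.
pose c t : 'rV[R]_n := \row_i limn (fun k => u k t 0 i).
have cc i t : u k t 0 i @[k --> \oo] --> c t 0 i.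
  by rewrite mxE; exact: cvu.
exists c; first by apply/rowP => i; rewrite mxE; apply: lim_near_cst => //; near=> k.
have lipu k t s i : `|u k s 0 i - u k t 0 i| <= B * `|s - t|.
  case: k => [|k]; first by rewrite subrr normr0 mulr_ge0.
  have [r _ ->] := mvt_any t s (fun t => du k i t).
  by rewrite normrM ler_wpM2r// (lip_bound lV).
have est k t s i : `|u k.+1 s 0 i - u k.+1 t 0 i - V i (u k t) * (s - t)| <=
    K * (n%:R * B) * `|s - t| * `|s - t|.
  have [r rt ->] := mvt_any t s (fun t => du k i t).
  rewrite -mulrBl normrM ler_wpM2r// (le_trans (lip_lip lV _ _ _))//.
  rewrite -!mulrA ler_wpM2l//.
  have : \sum_j `|u k r 0 j - u k t 0 j| <= \sum_(j < n) B * `|s - t|.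
    by apply: ler_sum => j _; rewrite (le_trans (lipu _ _ _ _))// ler_wpM2l.
  by rewrite sumr_const card_ord -[_ *+ n]mulr_natl.
have estc t s i : `|c s 0 i - c t 0 i - V i (c t) * (s - t)| <=
    K * (n%:R * B) * `|s - t| * `|s - t|.
  have cr : u k t @[k --> \oo] --> c t.
    have -> : c t = \row_i c t 0 i by apply/rowP => j; rewrite mxE.
    have -> : (fun k => u k t) = (fun k => \row_i u k t 0 i).
      by apply/funext => k; apply/rowP => j; rewrite mxE.
    by apply: cvg_rowE => j; exact: cc.
  have cl : `|u k.+1 s 0 i - u k.+1 t 0 i - V i (u k t) * (s - t)| @[k --> \oo] -->
      `|c s 0 i - c t 0 i - V i (c t) * (s - t)|.
    apply: cvg_norm; apply: cvgB.
      apply: cvgB.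
        by have := cc i s; rewrite -(cvg_shiftS (fun k => u k s 0 i)).
      by have := cc i t; rewrite -(cvg_shiftS (fun k => u k t 0 i)).
    apply: cvgM; last exact: cvg_cst.
    exact: (cvg_comp _ _ cr (cV i (c t))).
  rewrite -(cvg_lim _ cl)//; apply: limr_le; first by apply/cvg_ex; eexists; exact: cl.
  by near=> k; exact: est.
move=> t i.
suff H : (fun h : R => h^-1 *: (c (h *: 1 + t) 0 i - c t 0 i)) @ (0 : R)^' --> V i (c t).
  by apply: DeriveDef; [apply/cvg_ex; eexists; exact: H|exact/cvg_lim].
apply/cvgrPdist_le => e e0.
pose D := 1 + K * (n%:R * B); have D0 : 0 < D by rewrite ltr_pwDl// !mulr_ge0.
have n0 : \forall h \near (0 : R)^', h != 0 by exact: nbhs_dnbhs_neq.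
near=> h.
have h0 : h != 0 by near: h.
have := estc t (h + t) i; rewrite addrK => E.
rewrite /GRing.scale/= mulr1.
have -> : V i (c t) - h^-1 * (c (h + t) 0 i - c t 0 i) =
   - h^-1 * (c (h + t) 0 i - c t 0 i - V i (c t) * h).
  by field.
rewrite normrM normrN normfV ler_pdivrMl ?normr_gt0//.
rewrite (le_trans E)// [leRHS]mulrC ler_wpM2r//.
apply: (@le_trans _ _ (D * `|h|)).
  by rewrite ler_wpM2r// lerDr.
rewrite mulrC -ler_pdivlMr//; near: h.
by apply: near0_le; rewrite divr_gt0.
Unshelve. all: by end_near. Qed.

Lemma sum_norm_sq n (e : 'I_n -> R) :
  (\sum_i `|e i|) * (\sum_i `|e i|) <= n%:R * \sum_i e i ^+ 2.
Proof.
rewrite mulr_suml.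
have H i j : `|e i| * `|e j| <= 2^-1 * (e i ^+ 2 + e j ^+ 2).
  rewrite -(real_normK (num_real (e i))) -(real_normK (num_real (e j))).
  have := sqr_ge0 (`|e i| - `|e j|); rewrite sqrrB; lra.
apply: (@le_trans _ _ (\sum_i \sum_j 2^-1 * (e i ^+ 2 + e j ^+ 2))).
  by apply: ler_sum => i _; rewrite mulr_sumr; apply: ler_sum => j _.
rewrite le_eqVlt; apply/orP; left; apply/eqP.
under eq_bigr => i _ do
  rewrite -mulr_sumr big_split /= sumr_const card_ord -[_ *+ n]mulr_natl.
rewrite -mulr_sumr big_split /= -mulr_sumr sumr_const card_ord -[_ *+ n]mulr_natl.
by set S := \sum_i _; field.
Qed.

(** Gronwall's inequality for the squared Euclidean length. *)
Lemma gronwall n (e de : 'I_n -> R -> R) (K a b : R) : a <= b -> 0 <= K ->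
  (forall i, {within `[a, b], continuous (e i)}) ->
  (forall i t, t \in `]a, b[ -> is_derive t 1 (e i) (de i t)) ->
  (forall i t, t \in `]a, b[ -> `|de i t| <= K * \sum_j `|e j t|) ->
  \sum_i e i b ^+ 2 <= expR (2 * K * n%:R * (b - a)) * \sum_i e i a ^+ 2.
Proof.
move=> ab K0 ce hde hK.
pose L := 2 * K * n%:R.
pose E t := \sum_i e i t ^+ 2.
pose w t := expR (- L * (t - a)) * E t.
have dE (t : R) : t \in `]a, b[ -> is_derive t 1 E (\sum_i 2 * e i t * de i t).
  move=> tab; apply: is_d_sum => i.
  have -> : (fun y => e i y ^+ 2) = (fun y => e i y * e i y).
    by apply/funext => y; rewrite expr2.
  by have := is_d_mul (hde i t tab) (hde i t tab); congr (is_derive _ _ _ _); ring.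
have dw (t : R) : t \in `]a, b[ -> is_derive t 1 w
    (expR (- L * (t - a)) * (\sum_i 2 * e i t * de i t - L * E t)).
  move=> tab.
  have h1 : is_derive t 1 (fun t => expR (- L * (t - a))) (expR (- L * (t - a)) * - L).
    apply: (@is_d_comp _ _ expR (fun t => - L * (t - a))).
    have := is_d_scale (- L) (is_d_sub (is_derive_id t 1) (is_d_cst a t 1)).
    by rewrite subr0 mulr1.
  by have := is_d_mul h1 (dE t tab); congr (is_derive _ _ _ _); ring.
have cE : {within `[a, b], continuous E}.
  move=> x; apply: cont_sum => i.
  have -> : (fun y => e i y ^+ 2) = (fun y => e i y * e i y).
    by apply/funext => y; rewrite expr2.
  exact: (cont_mul (ce i x) (ce i x)).
have cw : {within `[a, b], continuous w}.
  suff c1 : {within `[a, b], continuous (fun t => expR (- L * (t - a)))}.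
    by move=> x; exact: (cont_mul (c1 x) (cE x)).
  apply: continuous_subspaceT => x.
  apply: (cont_comp (f := fun t => - L * (t - a))); last exact: continuous_expR.
  apply: cont_mul; first exact: cont_cst.
  by apply: cont_sub; [exact: cvg_id|exact: cont_cst].
have w_le : w b <= w a.
  have dw1 t : t \in `]a, b[ -> derivable w t 1 by move=> /dw [].
  have dw2 t : t \in `]a, b[ -> (w^`())%classic t <= 0.
    move=> tab; have [_ val_w] := dw t tab; rewrite derive1E val_w.
    rewrite pmulr_rle0 ?expR_gt0// subr_le0.
    apply: (@le_trans _ _ (2 * K * ((\sum_j `|e j t|) * (\sum_j `|e j t|)))).
      rewrite !mulr_sumr; apply: ler_sum => i _.
      apply: (@le_trans _ _ (2 * (`|e i t| * (K * \sum_j `|e j t|)))).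
        rewrite -mulrA ler_wpM2l// (le_trans (ler_norm _))// normrM ler_wpM2l//.
        exact: hK.
      by rewrite le_eqVlt; apply/orP; left; apply/eqP; ring.
    rewrite /L -(mulrA (2 * K)) ler_wpM2l ?mulr_ge0//; exact: sum_norm_sq.
  exact: (ler0_derive1_nincr dw1 dw2 cw (lexx a) ab (lexx b)).
have : expR (L * (b - a)) * w b <= expR (L * (b - a)) * w a.
  by rewrite ler_wpM2l ?expR_ge0.
by rewrite /w subrr mulr0 expR0 mul1r mulrA mulNr -expRD subrr expR0 mul1r.
Qed.

Lemma gronwall0 n (e de : 'I_n -> R -> R) (K a b : R) : a <= b -> 0 <= K ->
  (forall i, {within `[a, b], continuous (e i)}) ->
  (forall i t, t \in `]a, b[ -> is_derive t 1 (e i) (de i t)) ->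
  (forall i t, t \in `]a, b[ -> `|de i t| <= K * \sum_j `|e j t|) ->
  (forall i, e i a = 0) -> forall i, e i b = 0.
Proof.
move=> ab K0 ce hde hK e0 i; have := gronwall ab K0 ce hde hK.
rewrite [X in _ * X]big1 ?mulr0; last by move=> j _; rewrite e0 expr0n.
move=> H; have : e i b ^+ 2 <= 0.
  apply: le_trans H; rewrite (bigD1 i)//= lerDl; apply: sumr_ge0 => j _; exact: sqr_ge0.
by rewrite le_eqVlt ltNge sqr_ge0 orbF sqrf_eq0 => /eqP.
Qed.

Lemma sol_shift n (V : 'I_n -> 'rV[R]_n -> R) c s : is_sol V c ->
  is_sol V (fun t => c (t + s)).
Proof.
move=> hc t i.
have := @is_d_comp _ _ (fun t => c t 0 i) (fun u : R => u + s) t 1 _ (1 + 0) (hc _ _)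
  (is_d_add (is_derive_id t 1) (is_d_cst s t 1)).
by rewrite addr0 mulr1.
Qed.

Lemma lip_opp n (V : 'I_n -> 'rV[R]_n -> R) K B : lip_field V K B ->
  lip_field (fun i x => - V i x) K B.
Proof.
case=> K0 B0 hB hK; split=> // i x; first by rewrite normrN.
by move=> y; rewrite -opprD normrN; exact: hK.
Qed.

Definition sol_at n (V : 'I_n -> 'rV[R]_n -> R) (c : R -> 'rV[R]_n) (t : R) :=
  forall i, is_derive t 1 (fun t => c t 0 i) (V i (c t)).

Lemma sol_dist n (V : 'I_n -> 'rV[R]_n -> R) K B c1 c2 t : lip_field V K B ->
  (forall s, `|s| <= `|t| -> sol_at V c1 s) ->
  (forall s, `|s| <= `|t| -> sol_at V c2 s) ->
  \sum_i (c1 t 0 i - c2 t 0 i) ^+ 2 <=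
  expR (2 * K * n%:R * `|t|) * \sum_i (c1 0 0 i - c2 0 0 i) ^+ 2.
Proof.
move=> lV h1 h2; wlog t0 : V c1 c2 t lV h1 h2 / 0 <= t.
  move=> H; have [t0|/ltW t0] := leP 0 t; first exact: (H V).
  have rev c : (forall s, `|s| <= `|t| -> sol_at V c s) ->
      forall s, `|s| <= `|- t| -> sol_at (fun i x => - V i x) (fun t => c (- t)) s.
    move=> hc s; rewrite normrN => st i.
    have := @is_d_comp _ _ (fun t => c t 0 i) (fun u : R => - u) s 1 _ (- 1) (hc _ _ _)
      (is_d_opp (is_derive_id s 1)).
    by rewrite mulrN1; apply; rewrite normrN.
  have := H _ _ _ (- t) (lip_opp lV) (rev _ h1) (rev _ h2).
  by rewrite opprK oppr0 normrN; apply; rewrite oppr_ge0.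
have dc c i u : (forall s, `|s| <= `|t| -> sol_at V c s) -> u \in `[0, t] ->
    is_derive u 1 (fun t => c t 0 i) (V i (c u)).
  by rewrite in_itv/= => hc /andP[u0 ut]; apply: hc; rewrite !ger0_norm.
have E : `|t| = t - 0 by rewrite subr0 ger0_norm.
have hc i : {within `[0, t], continuous (fun t => c1 t 0 i - c2 t 0 i)}.
  apply: derivable_within_continuous => u ut.
  by have [] := is_d_sub (dc _ i u h1 ut) (dc _ i u h2 ut).
have hd i u : u \in `]0, t[ -> is_derive u 1 (fun t => c1 t 0 i - c2 t 0 i)
    (V i (c1 u) - V i (c2 u)).
  move=> /subset_itv_oo_cc ut.
  exact: (is_d_sub (dc _ i u h1 ut) (dc _ i u h2 ut)).
have hk i u : u \in `]0, t[ -> `|V i (c1 u) - V i (c2 u)| <=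
    K * \sum_j `|c1 u 0 j - c2 u 0 j|.
  by move=> _; exact: lip_lip lV _ _ _.
have H := gronwall t0 (lip_K0 lV) hc hd hk.
by rewrite E; exact: H.
Qed.

Lemma sol_uniq_at n (V : 'I_n -> 'rV[R]_n -> R) K B c1 c2 t : lip_field V K B ->
  (forall s, `|s| <= `|t| -> sol_at V c1 s) ->
  (forall s, `|s| <= `|t| -> sol_at V c2 s) -> c1 0 = c2 0 -> c1 t = c2 t.
Proof.
move=> lV h1 h2 e0; apply/rowP => i.
have := sol_dist lV h1 h2; rewrite e0 [X in _ * X]big1; last first.
  by move=> j _; rewrite subrr expr0n.
rewrite mulr0 => H.
have : (c1 t 0 i - c2 t 0 i) ^+ 2 <= 0.
  apply: le_trans H; rewrite (bigD1 i)//= lerDl; apply: sumr_ge0 => j _; exact: sqr_ge0.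
by rewrite le_eqVlt ltNge sqr_ge0 orbF sqrf_eq0 subr_eq0 => /eqP.
Qed.

Lemma sol_uniq n (V : 'I_n -> 'rV[R]_n -> R) K B c1 c2 : lip_field V K B ->
  is_sol V c1 -> is_sol V c2 -> c1 0 = c2 0 -> c1 = c2.
Proof.
move=> lV h1 h2 e0; apply/funext => t.
exact: (sol_uniq_at lV (fun s _ => h1 s) (fun s _ => h2 s) e0).
Qed.

Definition flow n (V : 'I_n -> 'rV[R]_n -> R) (t : R) (x : 'rV[R]_n) : 'rV[R]_n :=
  match pselect (exists2 c, c 0 = x & is_sol V c) with
  | left h => s2val (cid2 h) t
  | right _ => x
  end.

Section Flow.
Variables (n : nat) (V : 'I_n -> 'rV[R]_n -> R) (K B : R).
Hypothesis lV : lip_field V K B.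

Lemma flow_sol x : is_sol V (fun t => flow V t x).
Proof.
rewrite /flow; case: pselect => [h|]; first by case: cid2.
by have [c c0 hc] := picard x lV; case; exists c.
Qed.

Lemma flow0 x : flow V 0 x = x.
Proof. by rewrite /flow; case: pselect => // h; case: cid2. Qed.

Lemma flow_uniq c t : is_sol V c -> c t = flow V t (c 0).
Proof.
move=> hc; have := sol_uniq lV hc (flow_sol (c 0)).
by rewrite flow0 => /(_ erefl) {1}->.
Qed.

Lemma flowD s t x : flow V (s + t) x = flow V s (flow V t x).
Proof.
have := flow_uniq s (sol_shift t (flow_sol x)).
by rewrite add0r.
Qed.

Lemma flow_lip t x y i : `|flow V t x 0 i - flow V t y 0 i| ^+ 2 <=
  expR (2 * K * n%:R * `|t|) * \sum_j (x 0 j - y 0 j) ^+ 2.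
Proof.
have := @sol_dist _ _ _ _ _ _ t lV (fun s _ => flow_sol x s) (fun s _ => flow_sol y s).
rewrite !flow0.
apply: le_trans; rewrite real_normK ?num_real// (bigD1 i)//= lerDl.
by apply: sumr_ge0 => j _; exact: sqr_ge0.
Qed.

Lemma flow_time t s x i : `|flow V t x 0 i - flow V s x 0 i| <= B * `|t - s|.
Proof.
have [c _ ->] := mvt_any s t (fun t => flow_sol x t i).
by rewrite normrM ler_wpM2r// (lip_bound lV).
Qed.

Lemma flow_cont : continuous (fun p : R * 'rV[R]_n => flow V p.1 p.2).
Proof.
move=> [t x]; have -> : (fun p : R * 'rV[R]_n => flow V p.1 p.2) =
    (fun p => \row_i flow V p.1 p.2 0 i).
  by apply/funext => p; apply/rowP => i; rewrite mxE.
apply: continuous_rowE => i; apply: cont_eps => e e0 /=.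
pose D (y : 'rV[R]_n) := expR (2 * K * n%:R * `|t|) * \sum_j (x 0 j - y 0 j) ^+ 2.
have cD : {for x, continuous D}.
  apply: cont_mul; first exact: cont_cst.
  apply: cont_sum => j.
  have -> : (fun y : 'rV[R]_n => (x 0 j - y 0 j) ^+ 2) =
     (fun y => (x 0 j - y 0 j) * (x 0 j - y 0 j)) by apply/funext => y; rewrite expr2.
  by apply: cont_mul; apply: cont_sub; by [exact: cont_cst|exact: coord_continuous].
have e2 : 0 < e / 2 by rewrite divr_gt0.
have Dx : D x = 0 by rewrite /D big1 ?mulr0// => j _; rewrite subrr expr0n.
have h1 := near_preim cD (lt_nbhsl (_ : D x < (e / 2) ^+ 2)).
rewrite {1}Dx exprn_gt0// in h1; have {}h1 := h1 isT.
pose T (s : R) := B * `|t - s|.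
have cT : {for t, continuous T}.
  apply: cont_mul; first exact: cont_cst.
  by apply: cont_norm; apply: cont_sub; [exact: cont_cst|exact: cvg_id].
have h2 := near_preim cT (lt_nbhsl (_ : T t < e / 2)).
rewrite {1}/T subrr normr0 mulr0 in h2; have {}h2 := h2 e2.
exists ([set s | T s < e / 2], [set y | D y < (e / 2) ^+ 2]) => //.
move=> [s y] /= [hs hy].
rewrite -(subrKA (flow V t y 0 i)) (le_trans (ler_normD _ _))// (splitr e) lerD//.
  have := le_trans (flow_lip t x y i) (ltW hy).
  by rewrite ler_sqr// nnegrE ltW.
by apply: le_trans (ltW hs); exact: flow_time.
Qed.

End Flow.

Definition box n (r : R) : set 'rV[R]_n := [set x | forall i, `[- r, r]%classic (x 0 i)].

Lemma box_compact n r : compact (@box n r).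
Proof.
have -> : @box n r = [set v | forall i, `[- r, r]%classic (v ord0 i)].
  have E (x : 'rV[R]_n) i : x 0 i = x ord0 i by congr (x _ i); exact/val_inj.
  by apply/seteqP; split=> x h i; have := h i; rewrite /= E.
exact: (@rV_compact R n (fun=> `[- r, r]%classic)
  (fun=> @segment_compact R (- r) r)).
Qed.

Lemma boxP n r (x : 'rV[R]_n) : box r x <-> forall i, `|x 0 i| <= r.
Proof.
by split=> h i; have := h i; rewrite /= in_itv/= -ler_norml.
Qed.

Lemma out_box_open n (r : R) (x : 'rV[R]_n) i : r < `|x 0 i| ->
  \forall y \near x, r < `|(y : 'rV[R]_n) 0 i|.
Proof.
move=> h; have c : {for x, continuous (fun y : 'rV[R]_n => `|y 0 i|)}.
  by apply: cont_norm; exact: coord_continuous.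
exact: (near_preim c (lt_nbhsr h)).
Qed.

Lemma supp_bounded n (f : 'rV[R]_n -> R) r : continuous f ->
  (forall x, ~ box r x -> f x = 0) -> exists2 B, 0 <= B & forall x, `|f x| <= B.
Proof.
move=> cf f0.
have [[x0 hx0]|nb] := pselect (@box n r !=set0); last first.
  by exists 0 => // x; rewrite f0 ?normr0// => hx; apply: nb; exists x.
have cnf : {within @box n r, continuous (fun x => `|f x|)}.
  by apply: continuous_subspaceT => x; apply: cont_norm; exact: cf.
have [|c _ hc] := EVT_max_rV _ (@box_compact n r) cnf; first by exists x0.
exists `|f c|; first by [].
move=> x; have [hx|hx] := pselect (box r x); first by apply: hc; rewrite inE.
by rewrite f0 ?normr0.
Qed.

Lemma supp_lip n (f : 'rV[R]_n -> R) r : Cm 1 f ->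
  (forall x, ~ box r x -> f x = 0) ->
  exists2 K, 0 <= K & forall x y, `|f x - f y| <= K * \sum_j `|x 0 j - y 0 j|.
Proof.
move=> hf f0.
have D0 i x : ~ box r x -> 'D_(delta_mx 0 i) f x = 0.
  move=> hx; have [j hj] : exists j, r < `|x 0 j|.
    apply: contrapT => H; apply: hx; apply/boxP => j; rewrite leNgt; apply/negP => h.
    by apply: H; exists j.
  have fn : \near x, f x = (fun=> 0) x.
    have := out_box_open hj; apply: filterS => y hy; apply: f0 => /boxP/(_ j).
    by rewrite leNgt hy.
  by rewrite (near_eq_derive _ fn) derive_cst.
have /choice[M hM] : forall i, exists M, 0 <= M /\ forall x, `|'D_(delta_mx 0 i) f x| <= M.
  move=> i; have [M M0 hM] := supp_bounded (Cm_cont (Cm_pd i hf)) (D0 i).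
  by exists M.
pose K := \sum_i M i.
have MK i : M i <= K.
  by rewrite /K (bigD1 i)//= lerDl; apply: sumr_ge0 => j _; have [] := hM j.
exists K; first by apply: sumr_ge0 => j _; have [] := hM j.
move=> x y; rewrite hadamard// mulr_sumr (le_trans (ler_norm_sum _ _ _))//.
apply: ler_sum => j _; rewrite normrM ler_wpM2r//.
apply: mean01_bound.
  have c1 := cont_pairl (t := row_mx y x) (mixrow_cont (@hadw_cont R n j)).
  have c2 := Cm_cont (Cm_pd j hf).
  by move=> s; have := cont_comp (c1 s) (c2 _).
by move=> s _; apply: le_trans (MK j); have [_] := hM j; apply.
Qed.

(** Fields with coefficients in C^oo, zero outside a box, satisfy the hypotheses
of the global theory. *)
Definition csfield n (V : 'I_n -> 'rV[R]_n -> R) :=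
  (forall i m, Cm m (V i)) /\ exists r, forall i x, ~ box r x -> V i x = 0.

Lemma csfield_lip n (V : 'I_n -> 'rV[R]_n -> R) : csfield V ->
  exists K B, lip_field V K B.
Proof.
move=> [hV [r V0]].
have /choice[M hM] : forall i, exists M, 0 <= M /\ forall x, `|V i x| <= M.
  move=> i; have [M M0 hM] := supp_bounded (Cm_cont (hV i 0%N)) (V0 i).
  by exists M.
have /choice[L hL] : forall i, exists L, 0 <= L /\ forall x y,
    `|V i x - V i y| <= L * \sum_j `|x 0 j - y 0 j|.
  by move=> i; have [L L0 hL] := supp_lip (hV i 1%N) (V0 i); exists L.
exists (\sum_i L i), (\sum_i M i); split.
- by apply: sumr_ge0 => j _; have [] := hL j.
- by apply: sumr_ge0 => j _; have [] := hM j.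
- move=> i x; apply: (@le_trans _ _ (M i)); first by have [_] := hM i; apply.
  by rewrite (bigD1 i)//= lerDl; apply: sumr_ge0 => j _; have [] := hM j.
- move=> i x y; apply: (@le_trans _ _ (L i * \sum_j `|x 0 j - y 0 j|)).
    by have [_] := hL i; apply.
  rewrite ler_wpM2r ?sumr_ge0//.
  by rewrite (bigD1 i)//= lerDl; apply: sumr_ge0 => j _; have [] := hL j.
Qed.

End ODE.

(** * Flows of compactly supported smooth fields are smooth *)

Section FlowSmooth.
Variable R : realType.

Lemma Cm_sel n k m (F : 'rV[R]_k -> R) (s : 'I_k -> 'I_n) : Cm m F ->
  Cm m (fun x : 'rV[R]_n => F (\row_j x 0 (s j))).
Proof. by move=> hF; apply: Cm_comp => // j; exact: Cm_coord. Qed.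

Lemma nbhs_box n (x : 'rV[R]_n) (r : R) : 0 < r ->
  \forall y \near x, forall i, `|(y : 'rV[R]_n) 0 i - x 0 i| <= r.
Proof.
move=> r0.
have H i : nbhs x [set y : 'rV[R]_n | `|y 0 i - x 0 i| <= r].
  have c : {for x, continuous (fun y : 'rV[R]_n => `|y 0 i - x 0 i|)}.
    by apply: cont_norm; apply: cont_sub; [exact: coord_continuous|exact: cont_cst].
  have := near_preim c (lt_nbhsl (_ : `|x 0 i - x 0 i| < r)).
  by rewrite subrr normr0 => /(_ r0); apply: filterS => y /ltW.
exact: (filter_forall _ H).
Qed.

Section Prolong.
Variables (n : nat) (V : 'I_n -> 'rV[R]_n -> R).

Definition mk3 (x y w : 'rV[R]_n) : 'rV[R]_(n + n + n) := row_mx (row_mx x y) w.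

(** The field (x, y, w)' = (V x, V y, A(x, y) w), where A is the matrix of
coefficients of the first order expansion of V.  If x and y are integral curves
of V, then (y - x) / h solves the third equation, for every h. *)
Definition prolong (r : R) (k : 'I_(n + n + n)) (p : 'rV[R]_(n + n + n)) : R :=
  boxbump r (r + 1) p *
  match fintype.split k with
  | inl k' => match fintype.split k' with
    | inl i => V i (\row_j p 0 (lshift n (lshift n j)))
    | inr i => V i (\row_j p 0 (lshift n (rshift n j)))
    end
  | inr i => \sum_j had (V i) j (\row_k p 0 (lshift n k)) * p 0 (rshift (n + n) j)
  end.

Lemma prolong_cs r : csfield V -> csfield (prolong r).
Proof.
move=> [hV _]; split.
  move=> k m; apply: Cm_mul; first exact: Cm_boxbump.
  case: (fintype.split k) => [k'|i].
    by case: (fintype.split k') => i; exact: Cm_sel.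
  apply: Cm_sum => j; apply: Cm_mul; last exact: Cm_coord.
  by apply: Cm_sel; exact: had_Cm.
exists (r + 1) => k p hp; rewrite /prolong.
have [j hj] : exists j, r + 1 < `|p 0 j|.
  apply: contrapT => H; apply: hp; apply/boxP => j; rewrite leNgt; apply/negP => h.
  by apply: H; exists j.
by rewrite (@boxbump0 _ _ _ _ _ j) ?mul0r ?ltW// ltrDl.
Qed.

Lemma mk3_sel1 x y w : \row_j mk3 x y w 0 (lshift n (lshift n j)) = x.
Proof. by apply/rowP => j; rewrite mxE /mk3 !row_mxEl. Qed.
Lemma mk3_sel2 x y w : \row_j mk3 x y w 0 (lshift n (rshift n j)) = y.
Proof. by apply/rowP => j; rewrite mxE /mk3 row_mxEl row_mxEr. Qed.
Lemma mk3_sel12 x y w : \row_k mk3 x y w 0 (lshift n k) = row_mx x y.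
Proof. by apply/rowP => j; rewrite mxE /mk3 row_mxEl. Qed.

End Prolong.

Lemma flow_cont_x n (V : 'I_n -> 'rV[R]_n -> R) K B t : lip_field V K B ->
  continuous (flow V t).
Proof. by move=> lV; have := cont_pairl (t := t) (flow_cont lV). Qed.
Arguments flow_cont_x {n V K B} t _ x t _.

(** The difference quotients of the flow in the direction e are components of the flow
of the prolonged field at (x, x + h e, e); the latter depends continuously on the
point, so the derivatives are components of the prolonged flow at (x, x, e). The
prolonged field has compact support too, hence induction on m. *)
Lemma flow_Cm m : forall n (V : 'I_n -> 'rV[R]_n -> R), csfield V ->
  forall t j, Cm m (fun x => flow V t x 0 j).
Proof.
elim: m => [|m IH] n V csV t j; have [K [B lV]] := csfield_lip csV;
    have cphi : continuous (fun x => flow V t x 0 j).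
- move=> x; have c := @coord_continuous R 1 n 0 j (flow V t x).
  exact: cont_comp (flow_cont_x t lV x) c.
- by split.
- move=> x; have c := @coord_continuous R 1 n 0 j (flow V t x).
  exact: cont_comp (flow_cont_x t lV x) c.
have hV1 i : Cm 1 (V i) by have [hV _] := csV; exact: hV.
have key (x0 : 'rV[R]_n) (i : 'I_n) : exists2 G, Cm m G &
    \forall x \near x0, is_derive x (delta_mx 0 i) (fun x => flow V t x 0 j) (G x).
  set e : 'rV[R]_n := delta_mx 0 i.
  pose E := expR (2 * K * n%:R * `|t|).
  have B0 := lip_B0 lV; have K0 := lip_K0 lV.
  (* Up to time t the curves below stay in the box of radius r, on which the cut-off
     factor of the prolonged field is 1. *)
  pose r : R := \sum_j `|x0 0 j| + 2 + B * `|t| + E + 1.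
  have x0r l : `|x0 0 l| <= \sum_j `|x0 0 j|.
    by rewrite (bigD1 l)//= lerDl sumr_ge0.
  pose P := prolong V r.
  have csP : csfield P by exact: prolong_cs.
  have [KP [BP lP]] := csfield_lip csP.
  pose G x := flow P t (mk3 x x e) 0 (rshift (n + n) j).
  exists G.
    have := Cm_comp (u := fun k x => mk3 x x e 0 k) (IH _ _ csP t (rshift (n + n) j)).
    have -> : (fun x => flow P t (\row_k mk3 x x e 0 k) 0 (rshift (n + n) j)) = G.
      apply/funext => x; rewrite /G; congr (flow P t _ _ _).
      by apply/rowP => k; rewrite mxE.
    apply => k; rewrite /mk3.
    case: (split_ordP k) => k1 ->.
      case: (split_ordP k1) => k2 ->.
        by under eq_fun do rewrite !row_mxEl; exact: Cm_coord.
      by under eq_fun do rewrite row_mxEl row_mxEr; exact: Cm_coord.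
    by under eq_fun do rewrite row_mxEr; exact: Cm_cst.
  have := nbhs_box x0 ltr01; apply: filterS => x xx0.
  have xr l : `|x 0 l| <= \sum_j `|x0 0 j| + 1.
    rewrite -(subrK (x0 0 l) (x 0 l)) (le_trans (ler_normD _ _))// addrC lerD//.
  have el l : `|e 0 l| <= 1.
    by rewrite mxE; case: (_ && _); rewrite ?normr1 ?normr0.
  have quot (h : R) : h != 0 -> `|h| <= 1 ->
      h^-1 * (flow V t (h *: e + x) 0 j - flow V t x 0 j) =
      flow P t (mk3 x (h *: e + x) e) 0 (rshift (n + n) j).
    move=> h0 h1; set y := h *: e + x.
    pose w s : 'rV[R]_n := h^-1 *: (flow V s y - flow V s x).
    pose c s := mk3 (flow V s x) (flow V s y) (w s).
    have yr l : `|y 0 l| <= \sum_j `|x0 0 j| + 2.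
      rewrite !mxE (le_trans (ler_normD _ _))// [leRHS](_ : _ = 1 + (\sum_j `|x0 0 j| + 1)); last by ring.
      apply: lerD => //; rewrite normrM.
      have := el l; rewrite mxE => el'; apply: le_trans h1.
      by rewrite ler_piMr.
    have flr s (z : 'rV[R]_n) l (a : R) : `|s| <= `|t| -> `|z 0 l| <= a -> `|flow V s z 0 l| <= a + B * `|t|.
      move=> st za; rewrite -(subrK (z 0 l) (flow V s z 0 l)) (le_trans (ler_normD _ _))//.
      rewrite addrC lerD//; have := flow_time lV s 0 z l; rewrite flow0 subr0.
      by move=> /le_trans; apply; rewrite ler_wpM2l.
    have E0 : 0 <= E by exact: expR_ge0.
    have wr s l : `|s| <= `|t| -> `|w s 0 l| <= E + 1.
      move=> st; rewrite !mxE.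
      have H : `|h^-1 * (flow V s y 0 l - flow V s x 0 l)| ^+ 2 <= E.
        rewrite normrM exprMn.
        have := flow_lip lV s y x l => H.
        have : `|h^-1| ^+ 2 * `|flow V s y 0 l - flow V s x 0 l| ^+ 2 <=
           `|h^-1| ^+ 2 * (expR (2 * K * n%:R * `|s|) * \sum_j (y 0 j - x 0 j) ^+ 2).
          by rewrite ler_wpM2l// exprn_ge0.
        move=> /le_trans; apply.
        have -> : \sum_j (y 0 j - x 0 j) ^+ 2 = h ^+ 2.
          rewrite (bigD1 i)//= big1 => [|l' l'i].
            by rewrite !mxE !eqxx /= mulr1 addrK addr0.
          by rewrite !mxE eqxx (negbTE l'i) /= mulr0 add0r subrr expr0n.
        rewrite normfV exprVn real_normK ?num_real// mulrCA mulVf ?mulr1; last by rewrite sqrf_eq0.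
        by rewrite ler_expR ler_wpM2l// !mulr_ge0.
      rewrite leNgt; apply/negP => H2.
      have : (E + 1) ^+ 2 < `|h^-1 * (flow V s y 0 l - flow V s x 0 l)| ^+ 2.
        by rewrite ltrXn2r// ?nnegrE// addr_ge0.
      move=> /lt_le_trans/(_ H); rewrite sqrrD; nra.
    have Bt0 : 0 <= B * `|t| by rewrite mulr_ge0.
    have cr s : `|s| <= `|t| -> forall k, `|c s 0 k| <= r.
      move=> st k; rewrite /c /mk3.
      case: (split_ordP k) => k1 ->; last first.
        rewrite row_mxEr (le_trans (wr _ _ st))// /r.
        have : 0 <= \sum_j `|x0 0 j| by apply: sumr_ge0.
        lra.
      rewrite row_mxEl; case: (split_ordP k1) => k2 ->; rewrite ?row_mxEl ?row_mxEr.
        by have := flr s x k2 _ st (xr k2); move=> /le_trans; apply; rewrite /r; lra.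
      by have := flr s y k2 _ st (yr k2); move=> /le_trans; apply; rewrite /r; lra.
    have solc s : `|s| <= `|t| -> sol_at P c s.
      move=> st k; rewrite /P /prolong boxbump1 ?mul1r ?ltrDl//; last exact: cr.
      rewrite mk3_sel1 mk3_sel2 mk3_sel12 /c /mk3.
      case: (split_ordP k) => k1 -> /=; last first.
        under eq_fun do rewrite row_mxEr !mxE.
        have -> : \sum_j had (V k1) j (row_mx (flow V s x) (flow V s y)) *
             row_mx (row_mx (flow V s x) (flow V s y)) (w s) 0 (rshift (n + n) j) =
             h^-1 * (V k1 (flow V s y) - V k1 (flow V s x)).
          rewrite (hadamard _ _ (hV1 k1)) mulr_sumr; apply: eq_bigr => l _.
          by rewrite row_mxEr !mxE; ring.
        exact: (is_d_scale _ (is_d_sub (flow_sol lV y s k1) (flow_sol lV x s k1))).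
      under eq_fun do rewrite row_mxEl.
      case: (split_ordP k1) => k2 -> /=.
        by under eq_fun do rewrite row_mxEl; exact: flow_sol lV x s k2.
      by under eq_fun do rewrite row_mxEr; exact: flow_sol lV y s k2.
    have := sol_uniq_at lP solc (fun s _ => flow_sol lP (c 0) s).
    rewrite flow0 => /(_ erefl) E1.
    have : c t 0 (rshift (n + n) j) = h^-1 * (flow V t y 0 j - flow V t x 0 j).
      by rewrite /c /mk3 row_mxEr !mxE.
    move=> <-; rewrite E1; congr (flow P t _ 0 _).
    rewrite /c !flow0; congr (mk3 _ _ _).
    apply/rowP => l; rewrite /w !flow0 !mxE addrK mulrA mulVf ?mul1r//.
  suff H : (fun h : R => h^-1 *: (flow V t (h *: e + x) 0 j - flow V t x 0 j)) @ (0 : R)^'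
      --> G x.
    by apply: DeriveDef; [apply/cvg_ex; eexists; exact: H|exact/cvg_lim].
  pose Q (h : R) := flow P t (mk3 x (h *: e + x) e) 0 (rshift (n + n) j).
  have cQ : {for (0 : R), continuous Q}.
    suff cm : {for (0 : R), continuous (fun h : R => mk3 x (h *: e + x) e)}.
      have c1 := cont_comp cm (flow_cont_x t lP _).
      exact: cont_comp c1 (@coord_continuous R 1 _ 0 (rshift (n + n) j) _).
    have -> : (fun h : R => mk3 x (h *: e + x) e) = (fun h => \row_k mk3 x (h *: e + x) e 0 k).
      by apply/funext => h; apply/rowP => k; rewrite mxE.
    apply: continuous_rowE => k; rewrite /mk3.
    case: (split_ordP k) => k1 ->.
      case: (split_ordP k1) => k2 ->.
        have -> : (fun h : R => row_mx (row_mx x (h *: e + x)) e 0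
            (lshift n (lshift n k2))) = (fun=> x 0 k2).
          by apply/funext => h; rewrite !row_mxEl.
        exact: cont_cst.
      have -> : (fun h : R => row_mx (row_mx x (h *: e + x)) e 0
            (lshift n (rshift n k2))) = (fun h => h * e 0 k2 + x 0 k2).
        by apply/funext => h; rewrite row_mxEl row_mxEr !mxE.
      apply: cont_add; last exact: cont_cst.
      by apply: cont_mul; [exact: cvg_id|exact: cont_cst].
    have -> : (fun h : R => row_mx (row_mx x (h *: e + x)) e 0
          (rshift (n + n) k1)) = (fun=> e 0 k1).
      by apply/funext => h; rewrite row_mxEr.
    exact: cont_cst.
  have QG : Q 0 = G x by rewrite /Q scale0r add0r.
  rewrite -QG.
  have cQ' : Q h @[h --> (0 : R)^'] --> Q 0.
    by apply: cvg_trans cQ; apply: cvg_app; exact: nbhs_dnbhs.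
  apply: cvg_trans cQ'; apply: near_eq_cvg.
  have n0 : \forall h \near (0 : R)^', h != 0 by exact: nbhs_dnbhs_neq.
  near=> h; have h0 : h != 0 by near: h.
  have h1 : `|h| <= 1 by near: h; exact: near0_le.
  by rewrite /Q -quot.
split=> // i; split.
  move=> x; have [G _ hG] := key x i.
  by have [] := nbhs_singleton hG.
apply: Cm_near => x; have [G cG hG] := key x i; exists G => //.
by apply: filterS hG => y [_ ->].
Unshelve. all: by end_near. Qed.

End FlowSmooth.

(** * Differential spaces, derivations and charts *)

Section DiffSpace.
Variables (R : realType) (S : topologicalType) (C : set (S -> R)).
Hypothesis dC : differential_structure C.

Lemma C_cst (c : R) : C (fun=> c).
Proof.
have h : Cinfty R 0 (fun=> c) by move=> m; exact: Cm_cst.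
exact: (@dsp_comp _ _ _ dC 0 _ (fun _ _ => 0) h (fun i => match i with Ordinal _ h => False_ind _ (notF h) end)).
Qed.

Lemma C_comp1 (F : 'rV[R]_1 -> R) f : Cinfty R 1 F -> C f ->
  C (fun x => F (\row_i f x)).
Proof. by move=> hF hf; exact: (dsp_comp dC (f := fun _ => f) hF (fun _ => hf)). Qed.

Lemma C_comp2 (F : 'rV[R]_2 -> R) f g : Cinfty R 2 F -> C f -> C g ->
  C (fun x => F (\row_i if i == 0 then f x else g x)).
Proof.
move=> hF hf hg.
have := dsp_comp dC (f := fun i : 'I_2 => if i == 0 then f else g) hF.
have -> : (fun x => F (\row_i (if i == 0 then f else g) x)) =
    (fun x => F (\row_i if i == 0 then f x else g x)).
  by apply/funext => x; congr F; apply/rowP => i; rewrite !mxE; case: ifP.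
by apply=> i; case: ifP.
Qed.

Lemma C_add f g : C f -> C g -> C (fun x => f x + g x).
Proof.
move=> hf hg; have h : Cinfty R 2 (fun v => v 0 0 + v 0 1).
  by move=> m; apply: Cm_add; exact: Cm_coord.
by have := C_comp2 h hf hg; congr C; apply/funext => x; rewrite !mxE.
Qed.

Lemma C_mul f g : C f -> C g -> C (fun x => f x * g x).
Proof.
move=> hf hg; have h : Cinfty R 2 (fun v => v 0 0 * v 0 1).
  by move=> m; apply: Cm_mul; exact: Cm_coord.
by have := C_comp2 h hf hg; congr C; apply/funext => x; rewrite !mxE.
Qed.

Lemma C_scale (a : R) f : C f -> C (fun x => a * f x).
Proof. by move=> hf; apply: C_mul => //; exact: C_cst. Qed.

Lemma C_sub f g : C f -> C g -> C (fun x => f x - g x).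
Proof.
move=> hf hg; have := C_add hf (C_scale (-1) hg).
by congr C; apply/funext => x; ring.
Qed.

Lemma C_sum (I : Type) (r : seq I) (f : I -> S -> R) : (forall i, C (f i)) ->
  C (fun x => \sum_(i <- r) f i x).
Proof.
move=> hf; elim: r => [|i r IH].
  by under eq_fun do rewrite big_nil; exact: C_cst.
by under eq_fun do rewrite big_cons; exact: C_add.
Qed.

Lemma C_prod (I : Type) (r : seq I) (f : I -> S -> R) : (forall i, C (f i)) ->
  C (fun x => \prod_(i <- r) f i x).
Proof.
move=> hf; elim: r => [|i r IH].
  by under eq_fun do rewrite big_nil; exact: C_cst.
by under eq_fun do rewrite big_cons; exact: C_mul.
Qed.

Lemma C_step f : C f -> C (fun x => step (f x)).
Proof.
move=> hf; have h : Cinfty R 1 (fun v => step (v 0 0)).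
  by move=> m; apply: Cm_step; exact: Cm_coord.
by have := C_comp1 h hf; congr C; apply/funext => x; rewrite mxE.
Qed.

Local Notation supS := (sup_topology (fun f : {f : S -> R | C f} =>
  Topological.class (initial_topology (sval f)))).

Lemma nbhs_weakest (s : S) (M : set S) :
  nbhs s M <-> nbhs (s : supS) (M : set supS).
Proof.
split=> H.
  have := H; rewrite (@nbhsE S) => [] [G [oG Gs] GM].
  apply: (@filterS _ (nbhs (s : supS)) _ _ _ GM).
  by apply: open_nbhs_nbhs; split=> //; exact/(dsp_weakest dC).
have := H; rewrite (@nbhsE supS) => [] [G [oG Gs] GM].
apply: (filterS GM); apply: open_nbhs_nbhs; split=> //; exact/(dsp_weakest dC).
Qed.

Lemma C_cont f : C f -> continuous f.
Proof.
move=> hf s A fA; apply/nbhs_weakest.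
have := (@supremum_topology.cvg_sup S _ (fun f : {f : S -> R | C f} =>
  Topological.class (initial_topology (sval f))) (nbhs (s : supS)) s (@nbhs_filter supS s)).1.
move=> /(_ (fun B hB => hB) (exist _ f hf)); apply.
exact: (@initial_continuous S R f).
Qed.

(** The sets rho < 1 with rho of this kind form a base of the neighbourhoods of s in the
topology defined by C: a sum of two such functions serves for the intersection. *)
Lemma nbhs_rho (s : S) (M : set S) : nbhs s M ->
  exists rho, [/\ C rho, forall z, 0 <= rho z, rho s = 0 &
    forall z, rho z < 1 -> M z].
Proof.
pose F : set_system S := [set A | exists rho, [/\ C rho, forall z, 0 <= rho z,
  rho s = 0 & forall z, rho z < 1 -> A z]].
have FF : Filter F.
  split.
  - exists (fun=> 0); split=> //; exact: C_cst.
  - move=> A B [r1 [C1 p1 z1 h1]] [r2 [C2 p2 z2 h2]].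
    exists (fun z => r1 z + r2 z); split.
    + exact: C_add.
    + by move=> z; rewrite addr_ge0.
    + by rewrite z1 z2 addr0.
    + move=> z hz; split.
        by apply: h1; apply: le_lt_trans hz; rewrite lerDl.
      by apply: h2; apply: le_lt_trans hz; rewrite lerDr.
  - by move=> A B AB [r [C1 p1 z1 h1]]; exists r; split=> // z /h1 /AB.
move=> /nbhs_weakest; apply: (@supremum_topology.cvg_sup S _ (fun f : {f : S -> R | C f} =>
  Topological.class (initial_topology (sval f))) F s FF).2.
move=> [f hf] A [B [[G oG <-] /= Gs] BA].
have /nbhs_ballP[e /= e0 he] : nbhs (f s) G by exact: open_nbhs_nbhs.
exists (fun z => (e ^- 2) * ((f z - f s) * (f z - f s))); split.
- apply: C_scale; apply: C_mul; by apply: C_sub => //; exact: C_cst.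
- by move=> z; rewrite mulr_ge0 ?invr_ge0 ?exprn_ge0 ?(ltW e0)// -expr2 sqr_ge0.
- by rewrite subrr !mulr0.
- move=> z; rewrite ltr_pdivrMl ?exprn_gt0// mulr1 -expr2 -(real_normK (num_real (f z - f s))).
  rewrite ltr_sqr ?nnegrE ?(ltW e0)// => hz; apply: BA; apply: he.
  by rewrite /ball/= distrC.
Qed.

(** The last clause says that the support of beta lies in M. *)
Lemma C_bump (s : S) (M : set S) : nbhs s M ->
  exists beta, [/\ C beta, forall z, 0 <= beta z <= 1,
    \forall z \near s, beta z = 1 &
    forall z, ~ M z -> \forall w \near z, beta w = 0].
Proof.
move=> /nbhs_rho[rho [Cr r0 rs rM]].
exists (fun z => step (2 - 3 * rho z)).
have Ch : C (fun z => 2 - 3 * rho z) by apply: C_sub; [exact: C_cst|exact: C_scale].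
have cr := C_cont Cr; split.
- exact: C_step.
- by move=> z; rewrite step_ge0 step_le1.
- have := near_preim (cr s) (lt_nbhsl (_ : rho s < 1/3)).
  rewrite rs => /(_ ltac:(lra)); apply: filterS => z hz.
  by apply: step1; lra.
- move=> z nMz; have rz : 1 <= rho z by rewrite leNgt; apply/negP => /rM.
  have := near_preim (cr z) (lt_nbhsr (_ : 2/3 < rho z)).
  move=> /(_ ltac:(lra)); apply: filterS => w hw.
  by apply: step0; lra.
Qed.

Definition locC (h : S -> R) (s : S) := exists2 f, C f & \forall z \near s, h z = f z.

Lemma C_cut beta h (M : set S) : C beta ->
  (forall z, ~ M z -> \forall w \near z, beta w = 0) ->
  (forall z, M z -> locC h z) -> C (fun z => beta z * h z).
Proof.
move=> Cb b0 hM; apply: (dsp_local dC) => z.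
have [Mz|nMz] := pselect (M z).
  have [f Cf hf] := hM z Mz; exists (fun z => beta z * f z); first exact: C_mul.
  by apply: filterS hf => w ->.
exists (fun=> 0); first exact: C_cst.
by apply: filterS (b0 z nMz) => w ->; rewrite mul0r.
Qed.

(** The function u |-> 1/u is replaced near 0 by a smooth positive one, and 1/f is written
as f/f^2. *)
Lemma locC_inv f s : C f -> f s != 0 -> locC (fun z => (f z)^-1) s.
Proof.
move=> hf fs; pose c := f s * f s.
have c0 : 0 < c by rewrite /c -expr2 exprn_even_gt0.
pose th (u : R) := step (4 / c * u - 1).
pose P (u : R) := u * th u + (1 - th u).
have P0 u : 0 < P u.
  have [t0|t0] := eqVneq (th u) 0; first by rewrite /P t0 mulr0 add0r subr0.
  have tp : 0 < th u by rewrite lt_neqAle eq_sym t0 step_ge0.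
  have u0 : 0 < u.
    rewrite ltNge; apply/negP => u0; move/eqP: t0; apply; apply: step0.
    have : 4 / c * u <= 0 by rewrite mulr_ge0_le0// divr_ge0// ltW.
    lra.
  have := step_le1 (4 / c * u - 1); rewrite -/(th u) => t1.
  have := mulr_gt0 u0 tp; rewrite /P; lra.
have hP : Cinfty R 1 (fun v => (P (v 0 0))^-1).
  move=> m; apply: Cm_inv; first by move=> x; exact: P0.
  have hth : Cm m (fun v : 'rV[R]_1 => th (v 0 0)).
    apply: Cm_step.
    by apply: Cm_aff; exact: Cm_coord.
  apply: Cm_add; first by apply: Cm_mul => //; exact: Cm_coord.
  have -> : (fun v : 'rV[R]_1 => 1 - th (v 0 0)) = (fun v => (-1) * th (v 0 0) + 1).
    by apply/funext => v; ring.
  exact: Cm_aff.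
exists (fun z => f z * (P (f z * f z))^-1).
  apply: C_mul => //; have := C_comp1 hP (C_mul hf hf).
  by congr C; apply/funext => x; rewrite mxE.
have cf := C_cont (C_mul hf hf).
have := near_preim (cf s) (lt_nbhsr (_ : c / 2 < f s * f s)).
move=> /(_ ltac:(rewrite /c in c0 *; lra)); apply: filterS => z hz.
have t1 : th (f z * f z) = 1.
  apply: step1; rewrite lerBrDr.
  have : 4 / c * (c / 2) <= 4 / c * (f z * f z).
    by rewrite ler_wpM2l ?(ltW hz)//; apply: divr_ge0 => //; exact: ltW.
  have -> : 4 / c * (c / 2) = 2 by field; rewrite gt_eqF.
  by apply: le_trans; lra.
rewrite /P t1 subrr addr0 mulr1 invfM mulrA divff ?mul1r//.
by apply/eqP => fz; move: hz; rewrite fz mul0r; rewrite ltNge divr_ge0// ltW.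
Qed.

Section Derivation.
Variable X : (S -> R) -> S -> R.
Hypothesis dX : derivation C X.

Lemma der_cst (c : R) : X (fun=> c) = fun=> 0.
Proof.
have h1 : X (fun=> 1) = fun=> 0.
  have := Defs.der_leibniz dX (C_cst 1) (C_cst 1).
  rewrite (_ : (fun=> 1 * 1) = fun=> 1); last by apply/funext => x; rewrite mul1r.
  by move=> E; apply/funext => x; have := congr1 (fun g => g x) E => /=; lra.
have := Defs.der_scale dX c (C_cst 1); rewrite h1.
rewrite (_ : (fun=> c * 1) = fun=> c); last by apply/funext => x; rewrite mulr1.
by move=> ->; apply/funext => x; rewrite mulr0.
Qed.

Lemma derD f g x : C f -> C g -> X (fun z => f z + g z) x = X f x + X g x.
Proof. by move=> hf hg; rewrite (Defs.der_add dX). Qed.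

Lemma derZ a f x : C f -> X (fun z => a * f z) x = a * X f x.
Proof. by move=> hf; rewrite (Defs.der_scale dX). Qed.

Lemma derM f g x : C f -> C g -> X (fun z => f z * g z) x = f x * X g x + g x * X f x.
Proof. by move=> hf hg; rewrite (Defs.der_leibniz dX). Qed.

Lemma derB f g x : C f -> C g -> X (fun z => f z - g z) x = X f x - X g x.
Proof.
move=> hf hg; have -> : (fun z => f z - g z) = (fun z => f z + (-1) * g z).
  by apply/funext => z; ring.
by rewrite derD ?derZ//; [ring|exact: C_scale].
Qed.

Lemma der_sum (I : Type) (r : seq I) (f : I -> S -> R) x : (forall i, C (f i)) ->
  X (fun z => \sum_(i <- r) f i z) x = \sum_(i <- r) X (f i) x.
Proof.
move=> hf; elim: r => [|i r IH].
  have -> : (fun z => \sum_(i <- [::]) f i z) = fun=> 0.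
    by apply/funext => z; rewrite big_nil.
  by rewrite der_cst big_nil.
have -> : (fun z => \sum_(j <- i :: r) f j z) = (fun z => f i z + \sum_(j <- r) f j z).
  by apply/funext => z; rewrite big_cons.
by rewrite derD ?big_cons ?IH//; exact: C_sum.
Qed.

(** The product of f - g with a bump function at s is identically 0. *)
Lemma der_local f g s : C f -> C g -> (\forall z \near s, f z = g z) ->
  X f s = X g s.
Proof.
move=> hf hg /[dup] fgn /C_bump[beta [Cb _ b1 b0]].
have fg := nbhs_singleton fgn; have bs := nbhs_singleton b1.
have E : (fun z => beta z * (f z - g z)) = fun=> 0.
  apply/funext => z; have [e|ne] := pselect (f z = g z); first by rewrite e subrr mulr0.
  by rewrite (nbhs_singleton (b0 z ne)) mul0r.
have := derM s Cb (C_sub hf hg); rewrite E der_cst fg subrr mul0r addr0 bs mul1r.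
by rewrite derB// => /esym/eqP; rewrite subr_eq0 => /eqP.
Qed.

(** Up to a constant, F(f) is a sum of products with the factors f_j - f_j(s), to which
the Leibniz rule applies; this is Hadamard's argument. *)
Lemma der_chain k (F : 'rV[R]_k -> R) (f : 'I_k -> S -> R) s : Cinfty R k F ->
  (forall i, C (f i)) ->
  X (fun z => F (\row_i f i z)) s =
  \sum_j 'D_(delta_mx 0 j) F (\row_i f i s) * X (f j) s.
Proof.
move=> hF hf; set a := \row_i f i s.
have hG j : Cinfty R k (fun y => had F j (row_mx a y)).
  move=> m; have h := had_Cm j (hF m.+1).
  have := Cm_comp (u := fun l y => row_mx a y 0 l) h.
  have -> : (fun y => had F j (\row_l row_mx a y 0 l)) = (fun y => had F j (row_mx a y)).
    by apply/funext => y; congr (had F j _); apply/rowP => l; rewrite mxE.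
  apply=> l; case: (split_ordP l) => i ->.
    by under eq_fun do rewrite row_mxEl; exact: Cm_cst.
  by under eq_fun do rewrite row_mxEr; exact: Cm_coord.
have -> : (fun z => F (\row_i f i z)) = (fun z => F a +
    \sum_j had F j (row_mx a (\row_i f i z)) * (f j z - f j s)).
  apply/funext => z; have := hadamard a (\row_i f i z) (hF 1%N).
  move=> /(canRL (subrK _)) ->; rewrite addrC; congr (_ + _).
  by apply: eq_bigr => j _; rewrite !mxE.
have CG j : C (fun z => had F j (row_mx a (\row_i f i z))).
  exact: (dsp_comp dC (hG j)).
have Cd j : C (fun z => f j z - f j s) by apply: C_sub => //; exact: C_cst.
rewrite derD; [|exact: C_cst|by apply: C_sum => j; exact: C_mul].
rewrite der_cst add0r der_sum; last by move=> j; exact: C_mul.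
apply: eq_bigr => j _; rewrite derM// subrr mul0r addr0 had_diag; congr (_ * _).
by rewrite derB// ?der_cst ?subr0//; exact: C_cst.
Qed.

End Derivation.

End DiffSpace.

(** * Charts *)

Section Subtype.
Variables (T : topologicalType) (A : set T).

Definition mkset z (Az : A z) : set_type A := exist _ z (mem_set Az).

Lemma mksetE z (Az : A z) : set_val (mkset Az) = z.
Proof. by rewrite set_valE. Qed.

Lemma near_set_type (y : set_type A) (P : set (set_type A)) :
  nbhs y P <-> exists2 N, nbhs (set_val y) N & forall z : set_type A, N (set_val z) -> P z.
Proof.
split=> [|[N nN NP]].
  rewrite (@nbhsE (set_type A)) => [] [_ [[W oW <-] Wy] WP].
  by exists W; [exact: open_nbhs_nbhs|move=> z Wz; exact: WP].
apply: (@filterS _ (nbhs y) _ (set_val @^-1` N)); first by move=> z; exact: NP.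
exact: (@initial_continuous (set_type A) T set_val y _ nN).
Qed.

End Subtype.

Section Charts.
Variables (R : realType) (S : topologicalType) (C : set (S -> R)).
Hypothesis sC : subcartesian C.
Let dC := sc_structure sC.

Lemma box_ball n (x y : 'rV[R]_n) e : 0 < e ->
  (forall i, `|x 0 i - y 0 i| < e) -> ball x e y.
Proof. by move=> e0 h; split=> // i j; rewrite (ord1 i); exact: h. Qed.

(** The coordinate functions are defined on the whole of S; they are coordinates
on M only. *)
Definition chart n (k : 'I_n -> S -> R) (M : set S) := [/\ open M, forall i, C (k i) &
  forall q f, M q -> C f -> exists2 F, Cinfty R n F & exists2 e : R, 0 < e &
    forall z, M z -> (forall i, `|k i z - k i q| < e) -> f z = F (\row_i k i z)].

Lemma chart_sub n (k : 'I_n -> S -> R) M N : chart k M -> open N -> N `<=` M ->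
  chart k N.
Proof.
move=> [oM Ck hM] oN NM; split=> // q f Nq Cf.
have [F hF [e e0 he]] := hM q f (NM _ Nq) Cf.
by exists F => //; exists e => // z Nz; apply: he; exact: NM.
Qed.

(** The coordinates are the pullbacks of those of R^n, each of which agrees near p with
a function smooth on all of S. *)
Lemma chart_exists p : exists n (k : 'I_n -> S -> R) M, chart k M /\ M p.
Proof.
have [U [n [Y [[oU Up] [phi [psi [phiK psiK sphi spsi]]]]]]] := sc_chart sC p.
pose p' := mkset Up.
have /choice[k hk] : forall i : 'I_n, exists k, C k /\
    exists2 N, nbhs p N & forall z : set_type U, N (set_val z) ->
      set_val (phi z) 0 i = k (set_val z).
  move=> i.
  have CTi : subspace_structure (Cinfty R n) Y (fun y => set_val y 0 i).
    move=> y; exists (fun v : 'rV[R]_n => v 0 i); first by move=> m; exact: Cm_coord.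
    by apply/near_set_type; exists setT => //; exact: filterT.
  have [f Cf /near_set_type[N nN hN]] := sphi _ CTi p'.
  by exists f; split=> //; exists N => //; rewrite mksetE in nN.
have /choice[N hN] : forall i, exists N, nbhs p N /\ forall z : set_type U,
    N (set_val z) -> set_val (phi z) 0 i = k i (set_val z).
  by move=> i; have [_ [N nN h]] := hk i; exists N.
pose M0 := [set z | U z /\ forall i, N i z].
have nM0 : nbhs p M0.
  apply: filterI; first exact: open_nbhs_nbhs.
  by apply: filter_forall => i; have [] := hN i.
exists n, k, (interior M0); split; last exact: nM0.
have MU z : interior M0 z -> U z by move=> /interior_subset[].
have kE z (Mz : interior M0 z) i : k i z = set_val (phi (mkset (MU z Mz))) 0 i.
  have [_ hi] := hN i; rewrite hi mksetE//.
  by have /interior_subset[_] := Mz; apply.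
split; [exact: open_interior|by move=> i; have [] := hk i|].
move=> q f Mq Cf.
have CSf : subspace_structure C U (fun z => f (set_val z)).
  move=> y; exists f => //; apply/near_set_type; exists setT => //; exact: filterT.
pose q' := mkset (MU q Mq).
have [F hF /near_set_type[W nW hW]] := spsi _ CSf (phi q').
have /nbhs_ballP[e /= e0 he] := nW.
exists F => //; exists e => // z Mz hz.
pose z' := mkset (MU z Mz).
have -> : \row_i k i z = set_val (phi z').
  by apply/rowP => i; rewrite mxE (kE z Mz).
rewrite -hW /= ?phiK ?mksetE//; apply: he; apply: box_ball => // i.
by rewrite -(kE z Mz) -(kE q Mq) distrC.
Qed.

Lemma C_separates x y : (forall f, C f -> f x = f y) -> x = y.
Proof.
move=> hxy; apply: contrapT => /eqP xy.
have oy : open [set z | z != y].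
  have -> : [set z | z != y] = ~` [set y].
    by apply/seteqP; split=> z /=; [move=> /eqP|move=> h; apply/eqP].
  by apply: closed_openC; exact: (accessible_closed_set1 (hausdorff_accessible (sc_hausdorff sC))).
have /(nbhs_rho dC)[rho [Cr _ r0 hr]] : nbhs x [set z | z != y].
  exact: open_nbhs_nbhs.
by have := hr y; rewrite /= eqxx -(hxy _ Cr) r0 ltr01 => /(_ isT).
Qed.

(** Smooth functions separate points, and on M they factor locally through k. *)
Lemma chart_inj n (k : 'I_n -> S -> R) M q z : chart k M -> M q -> M z ->
  (forall i, k i z = k i q) -> z = q.
Proof.
move=> [oM Ck hM] Mq Mz hz; apply: C_separates => f Cf.
have [F _ [e e0 he]] := hM q f Mq Cf.
rewrite (he z Mz) ?(he q Mq) => [|i|i]; rewrite ?hz ?subrr ?normr0//.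
by congr F; apply/rowP => i; rewrite !mxE hz.
Qed.

Lemma chart_nbhs n (k : 'I_n -> S -> R) M q N : chart k M -> M q -> nbhs q N ->
  exists2 e : R, 0 < e & forall z, M z -> (forall i, `|k i z - k i q| < e) -> N z.
Proof.
move=> [oM Ck hM] Mq /(nbhs_rho dC)[rho [Cr _ r0 hr]].
have [F hF [e e0 he]] := hM q rho Mq Cr.
have cF : continuous F := Cm_cont (hF 0%N).
pose a := \row_i k i q.
have Fa : F a = 0 by rewrite /a -(he q Mq)// => i; rewrite subrr normr0.
have := near_preim (cF a) (lt_nbhsl (_ : F a < 1)); rewrite Fa ltr01 => /(_ isT).
move=> /nbhs_ballP[d /= d0 hd]; exists (Num.min e d); first by rewrite lt_min e0.
move=> z Mz hz; apply: hr; rewrite (he z Mz); last first.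
  by move=> i; apply: lt_le_trans (hz i) _; rewrite ge_min lexx.
apply: hd; apply: box_ball => // i; rewrite !mxE distrC.
by apply: lt_le_trans (hz i) _; rewrite ge_min lexx orbT.
Qed.

Lemma near_coord n (k : 'I_n -> S -> R) q (e : R) : (forall i, C (k i)) -> 0 < e ->
  \forall z \near q, forall i, `|k i z - k i q| < e.
Proof.
move=> Ck e0; apply: filter_forall => i; have ck := C_cont dC (Ck i).
have := near_preim (ck q) (nbhsx_ballx (k i q) e e0); apply: filterS => z.
by rewrite /ball/= distrC.
Qed.

Section Field.
Variable X : (S -> R) -> S -> R.
Hypothesis dX : derivation C X.

(** In the coordinates k, the derivation X is the restriction to k(M) of a field V
with compact support on R^n; this is what makes ordinary differential equations
available although k(M) is an arbitrary set. *)
Record fchart n (k : 'I_n -> S -> R) (M : set S) (V : 'I_n -> 'rV[R]_n -> R) := {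
  fc_chart : chart k M;
  fc_cs : csfield V;
  fc_eq : forall z i, M z -> X (k i) z = V i (\row_j k j z) }.

Lemma fchart_in n (k : 'I_n -> S -> R) M p : chart k M -> M p ->
  exists N V, [/\ fchart k N V, N p & N `<=` M].
Proof.
move=> cM Mp; have [oM Ck hM] := cM.
have /choice[F hF] : forall i, exists F, Cinfty R n F /\ exists2 e : R, 0 < e &
    forall z, M z -> (forall i, `|k i z - k i p| < e) -> X (k i) z = F (\row_i k i z).
  move=> i; have [F ? ?] := hM p (X (k i)) Mp (Defs.der_stable dX (Ck i)).
  by exists F.
pose r := \sum_i `|k i p| + 1.
pose W := [set z | (forall i, `|k i z - k i p| < 1) /\
  forall i, X (k i) z = F i (\row_j k j z)].
have nW : nbhs p W.
  apply: filterI; first exact: near_coord.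
  apply: filter_forall => i; have [_ [e e0 he]] := hF i.
  have nM : nbhs p M by exact: open_nbhs_nbhs.
  by apply: filterS2 nM (near_coord p Ck e0); exact: he.
exists (M `&` interior W), (fun i x => F i x * boxbump r (r + 1) x); split.
- split.
  + by apply: chart_sub cM _ _ => [|z []//]; apply: openI => //; exact: open_interior.
  + split=> [i m|].
      by apply: Cm_mul; [have [] := hF i|exact: Cm_boxbump].
    exists (r + 1) => i x /boxP/existsNP[j /negP]; rewrite -ltNge => /ltW rj.
    by rewrite (boxbump0 (i := j)) ?mulr0// ltrDl.
  + move=> z i [Mz /interior_subset[h1 ->]]; rewrite boxbump1 ?mulr1// ?ltrDl// => j.
    rewrite mxE; have := h1 j; have : `|k j p| <= \sum_i `|k i p|.
      by rewrite (bigD1 j)//= lerDl sumr_ge0.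
    by have := ler_normD (k j z - k j p) (k j p); rewrite subrK /r; lra.
- by split.
- by move=> z [].
Qed.

Lemma fchart_exists p : exists n (k : 'I_n -> S -> R) M V, fchart k M V /\ M p.
Proof.
have [n [k [M [cM Mp]]]] := chart_exists p.
by have [N [V [fN Np _]]] := fchart_in cM Mp; exists n, k, N, V.
Qed.

Lemma fchart_sub n (k : 'I_n -> S -> R) M N V : fchart k M V -> open N -> N `<=` M ->
  fchart k N V.
Proof.
move=> [cM cs h] oN NM; split=> //; first exact: chart_sub cM oN NM.
by move=> z i /NM; exact: h.
Qed.

(** That F represents f near q only is enough, as derivations are local. *)
Lemma chart_der n (k : 'I_n -> S -> R) M F (e : R) q f : chart k M -> M q -> C f ->
  Cinfty R n F -> 0 < e ->
  (forall z, M z -> (forall i, `|k i z - k i q| < e) -> f z = F (\row_i k i z)) ->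
  X f q = \sum_j 'D_(delta_mx 0 j) F (\row_i k i q) * X (k j) q.
Proof.
move=> [oM Ck hM] Mq Cf hF e0 he; rewrite -(der_chain dC dX)//.
apply: (der_local dC dX) => //; first exact: (dsp_comp dC).
have nM : nbhs q M by exact: open_nbhs_nbhs.
by apply: filterS2 nM (near_coord q Ck e0); exact: he.
Qed.

End Field.

End Charts.

(** * Integral curves on a subcartesian space *)

Section RealLine.
Variable R : realType.

Lemma nbhsR (t : R) (P : set R) :
  (\forall s \near t, P s) <-> exists2 e : R, 0 < e & forall s, `|s - t| < e -> P s.
Proof.
split=> [/nbhs_ballP[e /= e0 h]|[e e0 h]].
  by exists e => // s hs; apply: h; rewrite /ball/= distrC.
by apply/nbhs_ballP; exists e => //= s; rewrite /ball/= distrC; exact: h.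
Qed.

(** Being linear up to an error e|s - t| makes sense within any subset of the line;
this is the form in which one-sided derivatives enter. *)
Lemma is_deriveR (f : R -> R) (t l : R) : is_derive t 1 f l <->
  forall e, 0 < e -> \forall s \near t, `|f s - f t - l * (s - t)| <= e * `|s - t|.
Proof.
split.
  move=> /is_derive1_caratheodory[g [hg cg gt]] e e0.
  have := near_preim cg (nbhsx_ballx (g t) e e0); apply: filterS => s.
  rewrite /ball/= gt distrC => /ltW hs.
  by rewrite hg -mulrBl normrM ler_wpM2r.
move=> h; apply/is_derive1_caratheodory.
exists (fun s => if s == t then l else (f s - f t) / (s - t)); split; last by rewrite eqxx.
  move=> z; case: eqVneq => [->|zt]; first by rewrite !subrr mulr0.
  by rewrite divfK// subr_eq0.
apply: cont_eps => e e0; rewrite eqxx; have e2 : 0 < e / 2 by lra.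
apply: filterS (h _ e2) => s; case: eqVneq => [-> _|st]; first by rewrite subrr normr0 ltW.
have d0 : 0 < `|s - t| by rewrite normr_gt0 subr_eq0.
move=> hs; apply: (@le_trans _ _ (e / 2)); last by lra.
rewrite -(ler_pM2r d0) -normrM; apply: le_trans hs; rewrite le_eqVlt; apply/orP; left.
apply/eqP; rewrite -normrN; congr (`|_|).
by rewrite mulrBl divfK ?subr_eq0//; ring.
Qed.

(** By connectedness: local constancy makes P both open and closed in J. *)
Lemma interval_const (J : set R) (P : set R) : is_interval J ->
  (forall u, J u -> \forall s \near u, J s -> (P s <-> P u)) ->
  forall a b, J a -> J b -> P a -> P b.
Proof.
move=> /connected_intervalP iJ lc a b Ja Jb Pa.
suff E : J `&` P = J by move: Jb; rewrite -E => -[].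
apply: iJ; first by exists a.
- exists (interior [set s | J s -> P s]); first exact: open_interior.
  apply/seteqP; split=> s [Js].
    by move=> Ps; split=> //; apply: filterS (lc s Js) => v hv /hv; case=> _; exact.
  by move=> h; split=> //; exact: (interior_subset h).
- exists (~` interior [set s | J s -> ~ P s]).
    by apply: open_closedC; exact: open_interior.
  apply/seteqP; split=> s [Js].
    by move=> Ps; split=> // /interior_subset /(_ Js).
  move=> nP; split=> //; apply: contrapT => nPs; apply: nP.
  by apply: filterS (lc s Js) => v hv /hv; case=> h _ /h.
Qed.

Lemma within_eps (a b : R) (e : R -> R) :
  (forall u, a <= u <= b -> forall d, 0 < d ->
     \forall v \near u, a <= v <= b -> `|e v - e u| < d) ->
  {within `[a, b], continuous e}.
Proof.
move=> h; apply/subspace_continuousP => u; rewrite /= in_itv /= => hu.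
apply/cvgrPdist_lt => d d0; rewrite near_withinE.
by apply: filterS (h u hu d d0) => v hv; rewrite /= in_itv /= distrC => /hv.
Qed.

Lemma interior_itv (J : set R) (a b u : R) : is_interval J -> J a -> J b ->
  a < u < b -> nbhs u J.
Proof.
move=> iJ Ja Jb /andP[au ub]; have h1 := lt_nbhsr au; have h2 := lt_nbhsl ub.
by apply: filterS2 h1 h2 => v av vb; apply: (iJ a b) => //; rewrite !ltW.
Qed.

(** Coinduction: it proves that all smooth functions are smooth along a flow line at
once, the derivative of one of them being another of them. *)
Lemma Cinfty1_coind (Phi : set (R -> R)) :
  (forall f, Phi f -> exists2 g, Phi g & forall x : R, is_derive x 1 f (g x)) ->
  Phi `<=` Cinfty1 R.
Proof.
move=> h f Pf n x; suff [g Pg gE] : exists2 g, Phi g & derive1n n f = g.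
  by rewrite gE; have [d _ hd] := h g Pg; exact: (@ex_derive _ _ _ _ _ _ _ (hd x)).
elim: n => [|n [g Pg gE]]; first by exists f.
have [d Pd hd] := h g Pg; exists d => //; rewrite derive1nS gE.
by apply/funext => y; rewrite derive1E; exact: (@derive_val _ _ _ _ _ _ _ (hd y)).
Qed.

End RealLine.

Section FlowMore.
Variable R : realType.
Variables (n : nat) (V : 'I_n -> 'rV[R]_n -> R).
Hypothesis csV : csfield V.

Let lip := csfield_lip csV.

Lemma flowD_cs s t x : flow V (s + t) x = flow V s (flow V t x).
Proof. by have [K [B lV]] := lip; exact: (flowD lV). Qed.

Lemma flow_derive (F : 'rV[R]_n -> R) x (t s : R) : Cinfty R n F ->
  is_derive s 1 (fun s => F (flow V (s - t) x))
    (\sum_j 'D_(delta_mx 0 j) F (flow V (s - t) x) * V j (flow V (s - t) x)).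
Proof.
move=> hF; have [K [B lV]] := lip.
have h j := sol_shift (- t) (flow_sol lV x) s j.
have := chain_rule (hF 1%N) h.
have -> : \row_j flow V (s - t) x 0 j = flow V (s - t) x by apply/rowP => i; rewrite mxE.
have -> // : (fun y => F (\row_j flow V (y - t) x 0 j)) = (fun s => F (flow V (s - t) x)).
by apply/funext => y; congr F; apply/rowP => i; rewrite mxE.
Qed.

Lemma flow_Cinfty1 (F : 'rV[R]_n -> R) x t : Cinfty R n F ->
  Cinfty1 R (fun s => F (flow V (s - t) x)).
Proof.
move=> hF; apply: (@Cinfty1_coind R [set f | exists2 F, Cinfty R n F &
  f = (fun s => F (flow V (s - t) x))]); last by exists F.
move=> _ [{}F {}hF ->].
exists (fun s => (fun y => \sum_j 'D_(delta_mx 0 j) F y * V j y) (flow V (s - t) x)).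
  exists (fun y => \sum_j 'D_(delta_mx 0 j) F y * V j y) => // m.
  by apply: Cm_sum => j; apply: Cm_mul; [exact: Cm_pd (hF m.+1)|exact: csV.1].
by move=> s; exact: flow_derive.
Qed.

End FlowMore.

Section Curves.
Variables (R : realType) (S : topologicalType) (C : set (S -> R)).
Hypothesis sC : subcartesian C.
Let dC := sc_structure sC.

(** An integral curve on the interval J, as a total function whose values outside J
are irrelevant. Differentiability is required in the interior of J only: it follows
at the end points by continuity. *)
Definition icurve (X : (S -> R) -> S -> R) (J : set R) (c : R -> S) :=
  is_interval J /\ forall f t, C f -> J t ->
    (forall e, 0 < e -> \forall s \near t, J s -> `|f (c s) - f (c t)| < e) /\
    (nbhs t J -> is_derive t 1 (fun s => f (c s)) (X f (c t))).

Lemma icurve_near X J c t N : icurve X J c -> J t -> nbhs (c t) N ->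
  \forall s \near t, J s -> N (c s).
Proof.
move=> [_ h] Jt /(nbhs_rho dC)[rho [Cr p0 r0 hr]].
have [h1 _] := h rho t Cr Jt; apply: filterS (h1 1 ltr01) => s hs /hs.
by rewrite r0 subr0 ger0_norm//; exact: hr.
Qed.

Lemma near_shift (t a : R) (P : set R) :
  (\forall s \near t + a, P s) <-> \forall s \near t, P (s + a).
Proof.
split=> /nbhsR[e e0 he]; apply/nbhsR; exists e => // s hs.
  by apply: he; rewrite opprD addrACA subrr addr0.
by have := he (s - a); rewrite subrK; apply; rewrite -addrA -opprD (addrC a).
Qed.

Lemma icurve_shift X J c a : icurve X J c ->
  icurve X [set s | J (s + a)] (fun s => c (s + a)).
Proof.
move=> [iJ h]; split.
  move=> x y /= Jx Jy z /andP[xz zy]; apply: (iJ _ _ Jx Jy).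
  by rewrite !lerD2r xz.
move=> f t Cf /= Jt; have [h1 h2] := h f (t + a) Cf Jt; split.
  move=> e e0; exact: ((near_shift _ _ _).1 (h1 e e0)).
move=> /near_shift /h2 H; apply/is_deriveR => e e0.
have := (is_deriveR _ _ _).1 H e e0 => /near_shift; apply: filterS => s.
by rewrite opprD addrACA subrr addr0.
Qed.

Lemma icurve_intro X J c : is_interval J ->
  (forall f (t : R), C f -> J t -> exists2 G : R -> R, is_derive t 1 G (X f (c t)) &
     \forall s \near t, J s -> f (c s) = G s) -> icurve X J c.
Proof.
move=> iJ h; split=> // f t Cf Jt; have [G dG hG] := h f t Cf Jt.
have Gt : f (c t) = G t by exact: nbhs_singleton hG Jt.
split=> [e e0|nJ].
  have cG : {for t, continuous G}.
    apply: differentiable_continuous; apply/derivable1_diffP.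
    exact: (@ex_derive _ _ _ _ _ _ _ dG).
  have := near_preim cG (nbhsx_ballx (G t) e e0); apply: filterS2 hG => s hs + Js.
  by rewrite /ball/= Gt hs// distrC.
apply: near_eq_is_derive dG.
by apply: filterS2 nJ hG => s Js /(_ Js) ->.
Qed.

Section Field.
Variable X : (S -> R) -> S -> R.
Hypothesis dX : derivation C X.

(** Gronwall's inequality for the distance between the curve and the flow line. *)
Lemma icurve_flow_fwd n (k : 'I_n -> S -> R) M V J c t s : fchart C X k M V ->
  icurve X J c -> J t -> J s -> t <= s -> (forall u, t <= u <= s -> M (c u)) ->
  \row_i k i (c s) = flow V (s - t) (\row_i k i (c t)).
Proof.
move=> fc [iJ hc] Jt Js ts hM; have [cM csV fE] := fc; have [_ Ck _] := cM.
have [K [B lV]] := csfield_lip csV; set a := \row_i k i (c t).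
pose e i u := k i (c u) - flow V (u - t) a 0 i.
pose de i u := V i (\row_j k j (c u)) - V i (flow V (u - t) a).
have inJ u : t <= u <= s -> J u by move=> hu; exact: (iJ t s).
have dfl i (u : R) : is_derive u 1 (fun u => flow V (u - t) a 0 i) (V i (flow V (u - t) a)).
  exact: (sol_shift (- t) (flow_sol lV a)).
suff H i : e i s = 0.
  by apply/rowP => i; rewrite mxE; apply/eqP; rewrite -subr_eq0; apply/eqP; exact: H.
apply: (@gronwall0 _ _ e de K t s) => //; first exact: lip_K0 lV.
- move=> j; apply: within_eps => u hu d d0; have d2 : 0 < d / 2 by lra.
  have [h1 _] := hc (k j) u (Ck j) (inJ u hu).
  have cf : {for u, continuous (fun u => flow V (u - t) a 0 j)}.
    apply: differentiable_continuous; apply/derivable1_diffP.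
    exact: (@ex_derive _ _ _ _ _ _ _ (dfl j u)).
  have := near_preim cf (nbhsx_ballx _ _ d2); apply: filterS2 (h1 _ d2) => v hv.
  rewrite /ball/= => hv2 /inJ /hv hv1; rewrite /e.
  have -> : k j (c v) - flow V (v - t) a 0 j - (k j (c u) - flow V (u - t) a 0 j) =
    (k j (c v) - k j (c u)) + (flow V (u - t) a 0 j - flow V (v - t) a 0 j) by ring.
  by apply: le_lt_trans (ler_normD _ _) _; lra.
- move=> j u /[!in_itv]/= hu; have hu' : t <= u <= s by case/andP: hu => /ltW -> /ltW.
  have [_ h2] := hc (k j) u (Ck j) (inJ u hu').
  have := h2 (interior_itv iJ Jt Js hu); rewrite (fE _ j (hM u hu')) => h3.
  exact: (is_d_sub h3 (dfl j u)).
- move=> j u _; apply: le_trans (lip_lip lV _ _ _) _.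
  apply: ler_wpM2l; first exact: lip_K0 lV.
  by apply: ler_sum => l _; rewrite /e mxE.
- by move=> j; rewrite /e subrr (flow0 V a) /a mxE subrr.
Qed.

Lemma icurve_flow n (k : 'I_n -> S -> R) M V J c t s : fchart C X k M V ->
  icurve X J c -> J t -> J s -> (forall u, J u -> `|u - t| <= `|s - t| -> M (c u)) ->
  \row_i k i (c s) = flow V (s - t) (\row_i k i (c t)).
Proof.
move=> fc hc Jt Js hM; have iJ := hc.1; have [ts|/ltW st] := leP t s.
  apply: (icurve_flow_fwd fc hc Jt Js ts) => u hu; apply: hM; first exact: (iJ t s Jt Js).
  by case/andP: hu => h1 h2; rewrite !ger0_norm; lra.
rewrite [X in flow V _ X](@icurve_flow_fwd _ k M V J c s t)//; last first.
  move=> u hu; apply: hM; first exact: (iJ s t Js Jt).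
  by case/andP: hu => h1 h2; rewrite !ler0_norm; lra.
by rewrite -(flowD_cs (fc_cs fc)) addrA subrK subrr flow0.
Qed.

Lemma icurve_flow_near n (k : 'I_n -> S -> R) M V J c t : fchart C X k M V ->
  icurve X J c -> J t -> M (c t) ->
  \forall s \near t, J s -> \row_i k i (c s) = flow V (s - t) (\row_i k i (c t)).
Proof.
move=> fc hc Jt Mt; have [oM _ _] := fc_chart fc.
have /nbhsR[e e0 he] := icurve_near hc Jt (open_nbhs_nbhs (conj oM Mt)).
apply/nbhsR; exists e => // s hs Js; apply: icurve_flow fc hc Jt Js _ => u Ju us.
by apply: he => //; exact: le_lt_trans hs.
Qed.

(** The function G describes f along every integral curve through q, including those
that are defined on one side of q only. Hence one-sided pieces can be glued. *)
Definition curve_germ (q : S) (f : S -> R) (G : R -> R) :=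
  [/\ forall t, Cinfty1 R (fun s => G (s - t)),
      forall t : R, is_derive t 1 (fun s : R => G (s - t)) (X f q) &
      forall J c (t : R), icurve X J c -> J t -> c t = q ->
        \forall s \near t, J s -> f (c s) = G (s - t)].

(** In a chart the germ is F along the flow line of V through k(q). *)
Lemma curve_germ_exists q f : C f -> exists G, curve_germ q f G.
Proof.
move=> Cf; have [n [k [M [V [fc Mq]]]]] := fchart_exists sC dX q.
have [cM csV fE] := fc; have [oM Ck hM] := cM.
have [F hF [e e0 he]] := hM q f Mq Cf.
exists (fun u => F (flow V u (\row_i k i q))); split.
- by move=> t; exact: flow_Cinfty1.
- move=> t; have := flow_derive csV (\row_i k i q) t t hF.
  rewrite subrr flow0 (chart_der sC dX cM Mq Cf hF e0 he).
  by under [X in is_derive _ _ _ X -> _]eq_bigr do rewrite -fE//.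
- move=> J c t hc Jt ct; have Mt : M (c t) by rewrite ct.
  have h1 := icurve_flow_near fc hc Jt Mt.
  have h2 := icurve_near hc Jt (near_coord sC (c t) Ck e0).
  have h3 := icurve_near hc Jt (open_nbhs_nbhs (conj oM Mt)).
  apply: filterS3 h1 h2 h3 => s E1 E2 E3 Js.
  by rewrite he ?E1 ?ct//; [exact: E3|move=> i; rewrite -ct; exact: E2].
Qed.

(** Near a common point both curves follow the same flow line, and charts are
injective; so the set where they agree is open, and it is closed by continuity. *)
Lemma icurve_uniq J1 J2 c1 c2 u t : icurve X J1 c1 -> icurve X J2 c2 ->
  J1 u -> J2 u -> J1 t -> J2 t -> c1 u = c2 u -> c1 t = c2 t.
Proof.
move=> h1 h2 u1 u2 t1 t2.
apply: (@interval_const R (J1 `&` J2) [set s | c1 s = c2 s]) => //.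
  move=> x y [x1 x2] [y1 y2] z hz; split; [exact: (h1.1 x y)|exact: (h2.1 x y)].
move=> v [v1 v2]; have [E|NE] := pselect (c1 v = c2 v).
  have [n [k [M [V [fc Mq]]]]] := fchart_exists sC dX (c1 v).
  have [oM _ _] := fc_chart fc; have nM := open_nbhs_nbhs (conj oM Mq).
  have Mq2 : M (c2 v) by rewrite -E.
  have n1 := icurve_near h1 v1 nM; rewrite E in nM; have n2 := icurve_near h2 v2 nM.
  have g1 := icurve_flow_near fc h1 v1 Mq; have g2 := icurve_flow_near fc h2 v2 Mq2.
  apply: filterS2 (filterI n1 n2) (filterI g1 g2) => s [m1 m2] [e1 e2] [s1 s2].
  split=> // _; apply: (chart_inj sC (fc_chart fc) (m2 s2) (m1 s1)) => i.
  by have := e1 s1; rewrite E -(e2 s2) => /rowP/(_ i); rewrite !mxE.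
have [f Cf /eqP nf] : exists2 f, C f & f (c1 v) <> f (c2 v).
  apply: contrapT => H; apply: NE; apply: (C_separates sC) => f Cf.
  by apply: contrapT => nf; apply: H; exists f.
pose d := `|f (c1 v) - f (c2 v)| / 2.
have d0 : 0 < d by rewrite divr_gt0// normr_gt0 subr_eq0.
have [n1 _] := h1.2 f v Cf v1; have [n2 _] := h2.2 f v Cf v2.
apply: filterS2 (n1 d d0) (n2 d d0) => s m1 m2 [s1 s2]; split=> // E.
have := m1 s1; have := m2 s2; rewrite -E => e1 e2; exfalso.
have := ler_distD (f (c1 s)) (f (c1 v)) (f (c2 v)); rewrite (distrC (f (c1 v)) (f (c1 s))).
by move: e1 e2; rewrite /d; lra.
Qed.

(** Glueing: the curves that describe c to the right and to the left of t have the same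
germ at t. *)
Lemma icurve_locally J c : is_interval J ->
  (forall t, J t -> exists J1 c1 J2 c2, [/\ icurve X J1 c1, icurve X J2 c2, J1 t /\ J2 t,
     c1 t = c t /\ c2 t = c t & \forall s \near t, J s ->
       (t <= s -> J1 s /\ c1 s = c s) /\ (s <= t -> J2 s /\ c2 s = c s)]) ->
  icurve X J c.
Proof.
move=> iJ h; apply: icurve_intro => // f t Cf Jt.
have [J1 [c1 [J2 [c2 [h1 h2 [t1 t2] [e1 e2] hs]]]]] := h t Jt.
have [G [_ dG hG]] := curve_germ_exists (c t) Cf.
exists (fun s => G (s - t)); first exact: dG.
apply: filterS3 hs (hG _ _ _ h1 t1 e1) (hG _ _ _ h2 t2 e2) => s + g1 g2 Js.
move=> /(_ Js)[k1 k2]; have [ts|/ltW st] := leP t s.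
  by have [js <-] := k1 ts; exact: g1.
by have [js <-] := k2 st; exact: g2.
Qed.

(** The maximal integral curve is the union of all of them. *)
Lemma icurve_max x : exists J c, [/\ icurve X J c, J 0, c 0 = x &
  forall J' c', icurve X J' c' -> J' 0 -> c' 0 = x ->
    forall t, J' t -> J t /\ c' t = c t].
Proof.
pose through J c := [/\ icurve X J c, J 0 & c 0 = x].
have th0 : through [set 0] (fun=> x).
  split=> //; apply: icurve_intro => [a b /= -> -> z|f t Cf ->].
    by rewrite -eq_le => /eqP.
  exists (fun s => X f x * s + f x).
    have := is_d_add (is_d_scale (X f x) (is_derive_id (0 : R) (1 : R)))
      (is_d_cst (f x) (0 : R) (1 : R)).
    by rewrite mulr1 addr0.
  by apply: (filterS _ (@filterT _ (nbhs (0 : R)) _)) => s _ ->; rewrite mulr0 add0r.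
pose J := [set t | exists J' c', through J' c' /\ J' t].
have /choice[c hc] : forall t, exists y, forall J' c', through J' c' -> J' t -> c' t = y.
  move=> t; have [[J' [c' [[h1 h2 h3] h4]]]|N] := pselect (J t).
    exists (c' t) => J2 c2 [k1 k2 k3] k4.
    by apply: (icurve_uniq k1 h1 k2 h2 k4 h4); rewrite k3.
  by exists x => J' c' h1 h2; exfalso; apply: N; exists J', c'.
have J0 : J 0 by exists [set 0], (fun=> x).
have cE J' c' : through J' c' -> forall t, J' t -> J t /\ c' t = c t.
  by move=> h t Jt; split; [exists J', c'|exact: hc h Jt].
exists J, c; split=> //; last by move=> J' c' h1 h2 h3; exact: cE.
  apply: icurve_locally.
    move=> a b [J1 [c1 [h1 j1]]] [J2 [c2 [h2 j2]]] z /andP[az zb].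
    have [z0|/ltW z0] := leP 0 z.
      by exists J2, c2; split=> //; have [[iJ _] k _] := h2; apply: (iJ 0 b) => //; rewrite z0.
    by exists J1, c1; split=> //; have [[iJ _] k _] := h1; apply: (iJ a 0) => //; rewrite az.
  move=> t Jt.
  have right_nbhd : exists J1 c1, [/\ through J1 c1, J1 t &
      \forall s \near t, J s -> t <= s -> J1 s].
    have [J' [c' [h' j']]] := Jt; have [[iJ' _] j0 _] := h'.
    have [t0|t0] := ltP t 0.
      exists J', c'; split=> //; apply: filterS (lt_nbhsl t0) => s s0 _ ts.
      by apply: (iJ' t 0) => //; rewrite ts ltW.
    have [[t' tt' [J1 [c1 [h1 j1]]]]|N] := pselect (exists2 t', t < t' & J t').
      have [[iJ1 _] j10 _] := h1.
      exists J1, c1; split=> //; first by apply: (iJ1 0 t') => //; rewrite t0 ltW.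
      apply: filterS (lt_nbhsl tt') => s st' _ ts.
      by apply: (iJ1 0 t') => //; rewrite (le_trans t0 ts) ltW.
    exists J', c'; split=> //; apply: (filterS _ (@filterT _ (nbhs t) _)) => s _ Js; rewrite le_eqVlt => /orP[/eqP<-//|ts].
    by exfalso; apply: N; exists s.
  have left_nbhd : exists J1 c1, [/\ through J1 c1, J1 t &
      \forall s \near t, J s -> s <= t -> J1 s].
    have [J' [c' [h' j']]] := Jt; have [[iJ' _] j0 _] := h'.
    have [t0|t0] := ltP 0 t.
      exists J', c'; split=> //; apply: filterS (lt_nbhsr t0) => s s0 _ ts.
      by apply: (iJ' 0 t) => //; rewrite ts ltW.
    have [[t' tt' [J1 [c1 [h1 j1]]]]|N] := pselect (exists2 t', t' < t & J t').
      have [[iJ1 _] j10 _] := h1.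
      exists J1, c1; split=> //; first by apply: (iJ1 t' 0) => //; rewrite t0 ltW.
      apply: filterS (lt_nbhsr tt') => s st' _ ts.
      by apply: (iJ1 t' 0) => //; rewrite (le_trans ts t0) ltW.
    exists J', c'; split=> //; apply: (filterS _ (@filterT _ (nbhs t) _)) => s _ Js; rewrite le_eqVlt => /orP[/eqP->//|ts].
    by exfalso; apply: N; exists s.
  have [J1 [c1 [h1 t1 n1]]] := right_nbhd; have [J2 [c2 [h2 t2 n2]]] := left_nbhd.
  exists J1, c1, J2, c2; split=> //; [by case: h1|by case: h2| |].
    by split; [exact: (cE _ _ h1 t t1).2|exact: (cE _ _ h2 t t2).2].
  apply: filterS2 n1 n2 => s m1 m2 Js; split=> [ts|st].
    by have js := m1 Js ts; split=> //; exact: (cE _ _ h1 s js).2.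
  by have js := m2 Js st; split=> //; exact: (cE _ _ h2 s js).2.
by have [_ h2 h3] := th0; rewrite -(cE _ _ th0 0 erefl).2.
Qed.

End Field.

End Curves.

(** * The local group of a derivation *)

Section Exponential.
Variables (R : realType) (S : topologicalType) (C : set (S -> R)).
Hypothesis sC : subcartesian C.
Let dC := sc_structure sC.

Lemma set_val_inj (T : Type) (A : set T) : injective (@set_val T A).
Proof. by move=> x y; rewrite !set_valE; exact: val_inj. Qed.

Section Field.
Variable X : (S -> R) -> S -> R.
Hypothesis dX : derivation C X.

Lemma integral_icurve x (J : set R) (c : set_type J -> S) : integral_curve C X x c ->
  exists c', [/\ icurve C X J c', J 0, c' 0 = x & forall s, c' (set_val s) = c s].
Proof.
move=> [/connected_intervalP iJ J0 sm cx dc].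
pose c' s := match pselect (J s) with left h => c (mkset h) | right _ => x end.
have cE s : c' (set_val s) = c s.
  rewrite /c'; case: pselect => [h|[]]; last exact: set_valP.
  by congr c; apply: set_val_inj; exact: mksetE.
have cE' s (Js : J s) : c' s = c (mkset Js) by rewrite -cE mksetE.
exists c'; split=> //; last by rewrite (cE' 0 J0) cx// mksetE.
split=> // f t Cf Jt.
have [G hG] := sm f Cf (mkset Jt).
move=> /near_set_type[N + hN]; rewrite mksetE => nN.
have fG s : N s -> J s -> f (c' s) = G s.
  by move=> Ns Js; rewrite (cE' s Js); have := hN (mkset Js); rewrite mksetE; apply.
have Nt := nbhs_singleton nN; split=> [e e0|nJ].
  have cG : {for t, continuous G}.
    apply: differentiable_continuous; apply/derivable1_diffP.
    exact: (hG 0%N t).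
  have := near_preim cG (nbhsx_ballx (G t) e e0); apply: filterS2 nN => s hs + Js.
  by rewrite /ball/= (fG s hs Js) (fG t Nt Jt) distrC.
apply/is_deriveR => e e0.
have := dc f Cf (mkset Jt) => /cvgrPdist_lt/(_ e e0).
rewrite /dnbhs near_withinE => /near_set_type[N' + hN']; rewrite mksetE => nN'.
apply: filterS2 nN' nJ => s hs Js.
have [->|st] := eqVneq s t; first by rewrite !subrr mulr0 subrr normr0 mulr0.
have := hN' (mkset Js); rewrite mksetE => /(_ hs) H.
have {H} := H _; rewrite -!cE' => H; have d0 : 0 < `|s - t| by rewrite normr_gt0 subr_eq0.
have : `|X f (c' t) - (f (c' s) - f (c' t)) / (s - t)| < e.
  by apply: H; apply: contra_neq st => /(congr1 set_val); rewrite !mksetE.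
rewrite -(ltr_pM2r d0) -normrM mulrBl divfK ?subr_eq0// distrC => /ltW.
by apply: le_trans; rewrite lexx.
Qed.

Lemma icurve_integral x J c : icurve C X J c -> J 0 -> c 0 = x ->
  integral_curve C X x (fun s : set_type J => c (set_val s)).
Proof.
move=> hc J0 c0; split=> //.
- by apply/connected_intervalP; exact: hc.1.
- move=> f Cf t; have Jt : J (set_val t) := set_valP t.
  have [G [hG _ nG]] := curve_germ_exists sC dX (c (set_val t)) Cf.
  exists (fun s => G (s - set_val t)); first exact: hG.
  apply/near_set_type; exists [set s | J s -> f (c s) = G (s - set_val t)].
    exact: (nG _ _ _ hc Jt).
  by move=> z /= -> //; exact: set_valP.
- by move=> t ->.
- move=> f Cf t; have Jt : J (set_val t) := set_valP t.
  have [G [_ dG nG]] := curve_germ_exists sC dX (c (set_val t)) Cf.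
  apply/cvgrPdist_le => e e0; rewrite /dnbhs near_withinE; apply/near_set_type.
  have := (is_deriveR _ _ _).1 (dG (set_val t)) e e0.
  move=> h; exists [set s | J s -> `|f (c s) - f (c (set_val t)) -
      X f (c (set_val t)) * (s - set_val t)| <= e * `|s - set_val t|].
    have n1 := nG _ _ _ hc Jt erefl; have := nbhs_singleton n1 Jt => /= E.
    by apply: filterS2 h n1 => s + E2 Js; rewrite E E2.
  move=> z /= /(_ (set_valP z)) hz zt.
  have st : set_val z - set_val t != 0.
    by rewrite subr_eq0; apply: contra_neq zt => /set_val_inj.
  have d0 : 0 < `|set_val z - set_val t| by rewrite normr_gt0.
  by rewrite -(ler_pM2r d0) -normrM mulrBl divfK// distrC.
Qed.

(** From here on, [expv] is handled through these total curves. *)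
Lemma exp_curve x : exists J c, [/\ icurve C X J c, J 0, c 0 = x &
  forall t y, expv C X t x y <-> J t /\ c t = y].
Proof.
have [J [c [hc J0 c0 mc]]] := icurve_max sC dX x.
exists J, c; split=> // t y; split.
  move=> [I [d [[/integral_icurve[d' [hd I0 d0 dE]] _] [s <- <-]]]].
  by have := mc _ _ hd I0 d0 (set_val s) (set_valP s); rewrite dE => -[? ->].
move=> [Jt <-]; exists J, (fun s => c (set_val s)); split.
  split; first exact: icurve_integral.
  move=> I d /integral_icurve[d' [hd I0 d0 dE]] s Is.
  exact: (mc _ _ hd I0 d0 s Is).1.
by exists (mkset Jt); rewrite mksetE.
Qed.

Lemma expv_of_curve J c t : icurve C X J c -> J 0 -> J t -> expv C X t (c 0) (c t).
Proof.
move=> hc J0 Jt; have [I [d [hd I0 d0 mc]]] := icurve_max sC dX (c 0).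
have [It dE] := mc _ _ hc J0 erefl t Jt.
exists I, (fun s => d (set_val s)); split; last by exists (mkset It); rewrite mksetE.
split; first exact: icurve_integral.
move=> I' d1 /integral_icurve[d' [hd' I0' d0' _]] s Is.
exact: (mc _ _ hd' I0' d0' s Is).1.
Qed.

Lemma expv_intro J c s t : icurve C X J c -> J s -> J t ->
  expv C X (t - s) (c s) (c t).
Proof.
move=> hc Js Jt; have := expv_of_curve (t := t - s) (icurve_shift s hc).
by rewrite /= add0r subrK; apply.
Qed.

Lemma expv0 x : expv C X 0 x x.
Proof. by have [J [c [_ J0 c0 ->]]] := exp_curve x. Qed.

Lemma expv_fun t x y y' : expv C X t x y -> expv C X t x y' -> y = y'.
Proof. by have [J [c [_ J0 c0 h]]] := exp_curve x => /h[_ <-] /h[_ <-]. Qed.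

Lemma expv_sub s t x y z : expv C X s x y -> expv C X t x z -> expv C X (t - s) y z.
Proof.
have [J [c [hc J0 c0 h]]] := exp_curve x => /h[Js <-] /h[Jt <-].
exact: (expv_intro hc Js Jt).
Qed.

Lemma expv_opp t x y : expv C X t x y -> expv C X (- t) y x.
Proof. by move=> h; rewrite -sub0r; apply: expv_sub h (expv0 x). Qed.

Lemma expv_add s t x y z : expv C X s x y -> expv C X t y z -> expv C X (t + s) x z.
Proof. by move=> /expv_opp h1 h2; have := expv_sub h1 h2; rewrite opprK. Qed.

(** Converse to [icurve_flow]: every smooth function is read in the chart. *)
Lemma flow_icurve n (k : 'I_n -> S -> R) M V J c t0 a : fchart C X k M V ->
  is_interval J -> (forall t, J t -> M (c t) /\ \row_i k i (c t) = flow V (t - t0) a) ->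
  icurve C X J c.
Proof.
move=> fc iJ h; apply: icurve_intro => // f t Cf Jt.
have [cM csV fE] := fc; have [oM Ck hM] := cM; have [Mt Et] := h t Jt.
have [F hF [e e0 he]] := hM (c t) f Mt Cf.
exists (fun s => F (flow V (s - t0) a)).
  have := flow_derive csV a t0 t hF.
  rewrite (chart_der sC dX cM Mt Cf hF e0 he) -Et.
  by under [X in is_derive _ _ _ X -> _]eq_bigr do rewrite -fE//.
have [K [B lV]] := csfield_lip csV.
have B0 : 0 < B + 1 by rewrite ltr_wpDl// (lip_B0 lV).
apply/nbhsR; exists (e / (B + 1)); first by rewrite divr_gt0.
move=> s; rewrite ltr_pdivlMr// => hs Js; have [Ms Es] := h s Js.
rewrite he ?Es// => i; have := congr1 (fun v : 'rV[R]_n => v 0 i) Es; rewrite mxE => ->.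
have := congr1 (fun v : 'rV[R]_n => v 0 i) Et; rewrite mxE => ->.
apply: le_lt_trans (flow_time lV _ _ _ _) _.
have -> : s - t0 - (t - t0) = s - t by ring.
by apply: le_lt_trans hs; rewrite mulrC ler_wpM2l// lerDl.
Qed.

End Field.

Lemma derivation_opp X : derivation C X -> derivation C (fun f z => - X f z).
Proof.
move=> dX; split.
- by move=> f Cf; have := C_scale dC (-1) (Defs.der_stable dX Cf);
    congr C; apply/funext => z; rewrite mulN1r.
- by move=> f g Cf Cg; apply/funext => z; rewrite (derD dX)// opprD.
- by move=> a f Cf; apply/funext => z; rewrite (derZ dX)// mulrN.
- by move=> f g Cf Cg; apply/funext => z; rewrite (derM dX)// opprD !mulrN.
Qed.

End Exponential.

(** * Vector fields are the derivations vanishing at local maxima *)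

Section RealInduction.
Variable R : realType.

(** The supremum of the t such that P holds on [0, t] is b. *)
Lemma real_induction (P : set R) (b : R) : 0 <= b -> P 0 ->
  (forall t, 0 < t <= b -> (forall s, 0 <= s < t -> P s) -> P t) ->
  (forall t, 0 <= t < b -> P t -> \forall s \near t, t <= s -> P s) -> P b.
Proof.
move=> b0 P0 Pcl Pop.
pose A := [set t | 0 <= t <= b /\ forall s, 0 <= s <= t -> P s].
have A0 : A 0.
  by split=> [|s]; [rewrite lexx|rewrite -eq_le => /eqP <-].
have ubA : ubound A b by move=> t [/andP[]].
have supA : has_sup A by split; [exists 0|exists b].
pose u := sup A.
have u0 : 0 <= u by exact: (ub_le_sup supA.2 A0).
have ub : u <= b by apply: ge_sup => //; exists 0.
have Plt s : 0 <= s < u -> P s.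
  move=> /andP[s0 su]; have d0 : 0 < u - s by rewrite subr_gt0.
  have [t [_ tP] ut] := sup_adherent d0 supA.
  by apply: tP; rewrite s0 ltW//; move: ut; rewrite -/u; lra.
have Pu : P u.
  have [->//|un0] := eqVneq u 0.
  by apply: Pcl => //; rewrite ub andbT lt_neqAle eq_sym un0.
move: (ub); rewrite le_eqVlt => /orP[/eqP <-//|ub'].
have hu : 0 <= u < b by rewrite u0.
have /nbhsR[d d0 hd] := Pop u hu Pu.
pose v := Num.min b (u + d / 2).
have uv : u < v by rewrite /v lt_min ub' ltrDl divr_gt0.
have Av : A v.
  split; first by rewrite (le_trans u0 (ltW uv)) /v ge_min lexx.
  move=> s /andP[s0 sv]; have [su|us] := ltP s u; first by apply: Plt; rewrite s0.
  have : v <= u + d / 2 by rewrite /v ge_min lexx orbT.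
  by move=> hv; apply: hd => //; rewrite ger0_norm ?subr_ge0//; lra.
have := ub_le_sup supA.2 Av; rewrite -/u => vu.
by move: uv; rewrite ltNge vu.
Qed.

Lemma max_derive0 (f : R -> R) (t l : R) : is_derive t 1 f l ->
  (\forall s \near t, f s <= f t) -> l = 0.
Proof.
move=> /is_deriveR h fmax; apply/eqP; apply: contrapT => /negP l0.
have l2 : 0 < `|l| / 2 by rewrite divr_gt0// normr_gt0.
have /nbhsR[d d0 hd] : \forall s \near t, f s <= f t /\
    `|f s - f t - l * (s - t)| <= `|l| / 2 * `|s - t|.
  by apply: filterI => //; exact: h.
have d2 : 0 < d / 2 by rewrite divr_gt0.
have ld := mulr_gt0 l2 d2.
have [lp|ln] := ltP 0 l.
  have := hd (t + d / 2); rewrite addrC addKr (gtr0_norm d2) => /(_ ltac:(lra))[h1].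
  by move: ld; rewrite (gtr0_norm lp) ler_norml => ld /andP[h2 _]; lra.
have := hd (t - d / 2); rewrite addrC addKr normrN (gtr0_norm d2) => /(_ ltac:(lra))[h1].
by move: ld; rewrite (ler0_norm ln) ler_norml => ld /andP[h2 _]; lra.
Qed.

End RealInduction.

Section Bony.
Variables (R : realType) (S : topologicalType) (C : set (S -> R)).
Hypothesis sC : subcartesian C.
Let dC := sc_structure sC.
Hypothesis lcS : locally_compact [set: S].

(** Fermat's rule. It will turn out to characterize vector fields; in contrast to the
definition of the latter it is linear in X and makes no reference to flows. *)
Definition max_der (X : (S -> R) -> S -> R) := derivation C X /\
  forall f s, C f -> (\forall z \near s, f z <= f s) -> X f s = 0.

(** As the domain of the flow is open, t |-> f(exp(tX)(s)) is defined on both sides of 0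
and has a maximum there. *)
Lemma vector_field_max X : vector_field C X -> max_der X.
Proof.
move=> [dX oX]; split=> // f s Cf fs.
have [J [c [hc J0 c0 hJ]]] := exp_curve sC dX s.
have n0 : nbhs 0 J.
  have : nbhs ((0 : R), s) [set p : R * S | exists y, expv C X p.1 p.2 y].
    by apply: open_nbhs_nbhs; split=> //=; exists s; exact: expv0.
  move=> [[A B] /= [nA nB] AB]; apply: filterS nA => t At.
  by have [y /= /hJ[]] := AB (t, s) (conj At (nbhs_singleton nB)).
have [_ /(_ n0) H] := hc.2 f 0 Cf J0; rewrite c0 in H.
apply: max_derive0 H _; rewrite -c0 in fs.
by apply: filterS2 n0 (icurve_near sC hc J0 fs) => t Jt; exact.
Qed.

Lemma compact_nbhs (p : S) M : nbhs p M -> exists K, [/\ nbhs p K, compact K & K `<=` M].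
Proof.
move=> /(nbhs_rho dC)[rho [Cr _ r0 hr]].
have [//|U + [cU clU]] := @lcS p; rewrite withinET => nU.
have cr := C_cont dC Cr.
exists (U `&` [set z | rho z <= 1/2]); split.
- apply: filterI => //.
  have := near_preim (cr p) (lt_nbhsl (_ : rho p < 1/2)); rewrite r0 => /(_ ltac:(lra)).
  by apply: filterS => z /ltW.
- apply: compact_closedI => //.
  have -> : [set z | rho z <= 1/2] = rho @^-1` [set x | x <= 1/2] by [].
  by apply: closed_comp => [z _|]; [exact: cr|exact: closed_le].
- by move=> z [_ /= hz]; apply: hr; lra.
Qed.

Section Tangency.
Variables (X : (S -> R) -> S -> R).
Hypothesis mX : max_der X.
Let dX := mX.1.
Variables (n : nat) (k : 'I_n -> S -> R) (M : set S) (V : 'I_n -> 'rV[R]_n -> R).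
Hypothesis fc : fchart C X k M V.

Definition sqdist (y : 'rV[R]_n) (q : S) := \sum_i (y 0 i - k i q) ^+ 2.

Let Ck i : C (k i).
Proof. by have [_] := fc_chart fc; exact. Qed.

Lemma C_sqdist y : C (sqdist y).
Proof.
apply: (C_sum dC) => i; have h : C (fun q => y 0 i - k i q).
  by apply: (C_sub dC) => //; exact: C_cst.
exact: (C_mul dC h h).
Qed.

(** Fermat's rule for the function - sqdist y. *)
Lemma nearest_orth y q : M q -> (\forall w \near q, sqdist y q <= sqdist y w) ->
  \sum_i (y 0 i - k i q) * V i (\row_j k j q) = 0.
Proof.
move=> Mq hq; pose f w := - 1 * sqdist y w.
have Cs i : C (fun q => y 0 i - k i q) by apply: (C_sub dC) => //; exact: C_cst.
have : X f q = 0.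
  apply: mX.2; first by apply: (C_scale dC); exact: C_sqdist.
  by apply: filterS hq => w; rewrite /f !mulN1r lerN2.
rewrite /f (derZ dX)//; last exact: C_sqdist.
rewrite /sqdist (der_sum dC dX); last by move=> i; exact: (C_mul dC (Cs i) (Cs i)).
rewrite mulN1r => /eqP; rewrite oppr_eq0 => /eqP E.
apply/eqP; rewrite -(mulrI_eq0 _ (mulfI (_ : (- 2 : R) != 0))) ?oppr_eq0 ?pnatr_eq0//.
apply/eqP; rewrite -[RHS]E mulr_sumr; apply: eq_bigr => i _.
rewrite (derM dX (f := fun w => y 0 i - k i w) (g := fun w => y 0 i - k i w))//.
rewrite (derB dC dX)//; last exact: C_cst.
by rewrite (der_cst dC dX) sub0r (fc_eq fc)//; ring.
Qed.

(** Following the flow line of V through a point of S, the squared distance m to a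
compact part of S satisfies m' <= 2 L n m, in the sense of upper right derivatives, by the
orthogonality at nearest points; so m stays 0. *)
Lemma flow_stays p : M p -> exists M1, [/\ nbhs p M1, M1 `<=` M & exists2 tau : R, 0 < tau &
  forall z t, M1 z -> 0 <= t <= tau ->
    exists2 q, M q & \row_i k i q = flow V t (\row_i k i z)].
Proof.
move=> Mp; have [cM csV fE] := fc; have [oM _ _] := cM.
have [L [B lV]] := csfield_lip csV; have L0 := lip_K0 lV; have B0 := lip_B0 lV.
have [K [nK cK KM]] := compact_nbhs (open_nbhs_nbhs (conj oM Mp)).
have [e e0 he] := chart_nbhs sC cM Mp nK.
pose N : R := n%:R + 1; pose b := B + 1.
have N1 : 1 <= N by rewrite /N lerDr ler0n.
have b0 : 0 < b by rewrite /b ltr_wpDl.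
have N0 : 0 < N by exact: lt_le_trans N1.
(* Up to time tau the coordinates change by at most rho = e / 8, even after
   multiplication by N, which compares the Euclidean norm with the coordinates. *)
pose tau := e / (8 * N * b).
have tau0 : 0 < tau by rewrite divr_gt0// !mulr_gt0.
have rho8 : N * b * tau = e / 8 by rewrite /tau; field; rewrite !gt_eqF.
pose rho := e / 8; have rho0 : 0 < rho by rewrite divr_gt0.
have btau : b * tau <= rho.
  by rewrite /rho -rho8 -mulrA ler_peMl// mulr_ge0 ?ltW.
exists (K `&` [set z | forall i, `|k i z - k i p| < e / 4]); split.
- by apply: filterI => //; apply: (near_coord sC) => //; rewrite divr_gt0.
- by move=> z [/KM].
exists tau => // z; move=> T [Kz zp] /andP[T0 Ttau].
pose a := \row_i k i z; pose g t := flow V t a; pose phi t q := sqdist (g t) q.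
have K0 : K !=set0 by exists p; exact: nbhs_singleton.
have /choice[q hq] : forall t, exists q, K q /\ forall q', K q' -> phi t q <= phi t q'.
  move=> t; have cphi : {within K, continuous (phi t)}.
    by apply: continuous_subspaceT; apply: (C_cont dC); exact: C_sqdist.
  have [q /set_mem Kq hq] := compact_EVT_min K0 cK cphi.
  by exists q; split=> // q' /mem_set; exact: hq.
pose m t := phi t (q t).
have gB s t i : `|g s 0 i - g t 0 i| <= b * `|s - t|.
  apply: le_trans (flow_time lV _ _ _ _) _; rewrite ler_wpM2r//.
  by rewrite /b lerDl.
have gz0 t i : 0 <= t -> `|g t 0 i - k i z| <= b * t.
  move=> t0; have := gB t 0 i; have -> : g 0 0 i = k i z by rewrite /g (flow0 V a) mxE.
  by rewrite subr0 (ger0_norm t0).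
have gz t i : 0 <= t <= tau -> `|g t 0 i - k i z| <= rho.
  move=> /andP[t0 tt]; apply: le_trans (gz0 t i t0) _; apply: le_trans btau.
  by rewrite ler_wpM2l// ltW.
have gq t i : 0 <= t <= tau -> `|g t 0 i - k i (q t)| <= rho.
  move=> ht; have : m t <= n%:R * (b * tau) ^+ 2.
    apply: le_trans ((hq t).2 z Kz) _; rewrite /phi /sqdist.
    apply: (@le_trans _ _ (\sum_(i < n) (b * tau) ^+ 2)); last first.
      by rewrite sumr_const card_ord mulr_natl.
    apply: ler_sum => j _; rewrite -(real_normK (num_real (g t 0 j - k j z))).
    have bt0 : 0 <= b * tau by exact: ltW (mulr_gt0 b0 tau0).
    apply: lerXn2r; rewrite ?nnegrE//.
    have /andP[t0 tt] := ht; apply: le_trans (gz0 t j t0) _.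
    by rewrite ler_wpM2l// ltW.
  have : (g t 0 i - k i (q t)) ^+ 2 <= m t.
    rewrite /m /phi /sqdist (bigD1 i)//= lerDl.
    by apply: sumr_ge0 => j _; exact: sqr_ge0.
  move=> /le_trans h /h; rewrite -(real_normK (num_real (g t 0 i - k i (q t)))) => h2.
  have : `|g t 0 i - k i (q t)| ^+ 2 <= rho ^+ 2.
    apply: le_trans h2 _; rewrite /rho -rho8 -mulrA [leRHS]exprMn.
    apply: ler_wpM2r; first exact: sqr_ge0.
    by rewrite /N; have := ler0n R n; nra.
  by rewrite ler_sqr ?nnegrE// ltW.
have near_q t : 0 <= t <= tau -> nbhs (q t) K.
  move=> ht; have Mq := KM _ (hq t).1.
  apply: filterS2 (open_nbhs_nbhs (conj oM Mq)) (near_coord sC (q t) Ck rho0) => w Mw hw.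
  apply: he => // i; have h1 := hw i; have h2 := gq t i ht; have h3 := gz t i ht.
  have h4 := zp i.
  have -> : k i w - k i p = (k i w - k i (q t)) + (- (g t 0 i - k i (q t))) +
    (g t 0 i - k i z) + (k i z - k i p) by ring.
  apply: le_lt_trans (ler_normD _ _) _.
  apply: (@le_lt_trans _ _ (rho + rho + rho + `|k i z - k i p|)); last by rewrite /rho; lra.
  rewrite lerD2r; apply: le_trans (ler_normD _ _) _; apply: lerD => //.
  by apply: le_trans (ler_normD _ _) _; rewrite normrN; apply: lerD => //; exact: ltW.
(* The rate 2 L n of the differential inequality; 1 is added to absorb the error terms
   of first order. *)
pose Lam := 2 * L * n%:R + 1.
pose c := n%:R * (2 * rho * b + b * b * tau).
have mlip s t : 0 <= s <= tau -> 0 <= t <= tau -> s <= t -> m t <= m s + c * (t - s).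
  move=> hs ht st; apply: le_trans ((hq t).2 (q s) (hq s).1) _.
  rewrite /m /phi /sqdist /c -mulrA mulr_natl -[n in _ *+ n]card_ord -sumr_const -big_split.
  apply: ler_sum => i _ /=; have := gB t s i; have := gq s i hs.
  set x := g s 0 i - k i (q s); rewrite (ger0_norm (_ : 0 <= t - s)) ?subr_ge0//.
  have -> : g t 0 i - k i (q s) = x + (g t 0 i - g s 0 i) by rewrite /x; ring.
  set y := g t 0 i - g s 0 i; rewrite sqrrD => hx hy.
  have xy : x * y <= rho * (b * (t - s)).
    apply: le_trans (ler_norm _) _; rewrite normrM; exact: ler_pM.
  have yy : y ^+ 2 <= (b * tau) * (b * (t - s)).
    rewrite -(real_normK (num_real y)) expr2; apply: ler_pM => //.
    apply: le_trans hy _; rewrite ler_wpM2l ?(ltW b0)//.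
    by case/andP: hs => s0 _; case/andP: ht => _ tt; lra.
  by rewrite mulr2n; lra.
suff m0 : m T = 0.
  exists (q T); first exact: KM (hq T).1.
  apply/rowP => i; rewrite mxE; apply/eqP; rewrite eq_sym -subr_eq0 -sqrf_eq0; apply/eqP.
  have := m0; rewrite /m /phi /sqdist => /psumr_eq0P; apply=> // j _; exact: sqr_ge0.
apply/eqP; rewrite eq_le; apply/andP; split; last first.
  by apply: sumr_ge0 => j _; exact: sqr_ge0.
(* Since m may vanish, it is compared with a positive solution of y' = Lam y. *)
suff H eps : 0 < eps -> m T <= eps * expR (Lam * T).
  apply/ler_addgt0Pr => d d0; rewrite add0r.
  have := H (d / expR (Lam * T)); rewrite divfK ?gt_eqF ?expR_gt0//; apply.
  by rewrite divr_gt0// expR_gt0.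
move=> eps0; apply: (@real_induction _ (fun t => m t <= eps * expR (Lam * t)) T T0).
- rewrite mulr0 expR0 mulr1; apply: le_trans (ltW eps0).
  apply: le_trans ((hq 0).2 z Kz) _; rewrite /phi /sqdist big1// => i _.
  by rewrite /g (flow0 V a) mxE subrr expr0n.
- move=> t /andP[t0 tT] ht; apply/ler_addgt0Pr => d d0.
  have c0 : 0 <= c.
    have b0' := ltW b0; have r0' := ltW rho0; have t0' := ltW tau0.
    rewrite /c; apply: mulr_ge0; first exact: ler0n.
    apply: addr_ge0; apply: mulr_ge0 => //; apply: mulr_ge0 => //; exact: ler0n.
  pose h := Num.min t (d / (c + 1)).
  have h0 : 0 < h by rewrite lt_min t0 divr_gt0// ltr_wpDl.
  have hts : 0 <= t - h < t by rewrite subr_ge0 /h ge_min lexx /= ltrBlDr ltrDl.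
  have [h1 h2] := andP hts.
  have H : m t <= m (t - h) + c * h.
    have := @mlip (t - h) t; rewrite (_ : t - (t - h) = h); last by ring.
    by apply; lra.
  have ch : c * h <= d.
    apply: (@le_trans _ _ ((c + 1) * h)); first by rewrite ler_wpM2r ?lerDl// ltW.
    by rewrite mulrC -ler_pdivlMr ?ltr_wpDl// /h ge_min lexx orbT.
  have ee : eps * expR (Lam * (t - h)) <= eps * expR (Lam * t).
    rewrite ler_wpM2l ?(ltW eps0)// ler_expR ler_wpM2l//.
      rewrite /Lam; apply: addr_ge0 => //; apply: mulr_ge0; last exact: ler0n.
      by apply: mulr_ge0 => //; exact: ler0n.
    by rewrite gerBl ltW.
  by have := ht _ hts; lra.
- move=> t /andP[t0 tT] ht; have ht' : 0 <= t <= tau by rewrite t0 (le_trans (ltW tT)).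
  set E := eps * expR (Lam * t) in ht.
  have E0 : 0 < E by rewrite mulr_gt0// expR_gt0.
  have Kq := (hq t).1; have Mq := KM _ Kq.
  pose D := \sum_i ((g t 0 i - k i (q t)) * V i (g t) + (g t 0 i - k i (q t)) * V i (g t)).
  have dphi : is_derive t 1 (fun s => phi s (q t)) D.
    rewrite /phi /sqdist /D; apply: is_d_sum => i.
    have h1 := is_d_sub (flow_sol lV a t i) (is_d_cst (k i (q t)) t (1 : R)).
    rewrite subr0 in h1; have := is_d_mul h1 h1.
    by rewrite /g; under [in X in X -> _]eq_fun do rewrite -expr2.
  have DE : D <= (Lam - 1) * E.
    have orth := nearest_orth Mq (y := g t) (filterS (fun w => (hq t).2 w) (near_q t ht')).
    have -> : D = 2 * \sum_i (g t 0 i - k i (q t)) * (V i (g t) - V i (\row_j k j (q t))).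
      under eq_bigr do rewrite mulrBr; rewrite sumrB orth subr0 /D big_split/=.
      by rewrite -mulr2n mulr_natl.
    apply: (@le_trans _ _ (2 * (L * (n%:R * m t)))); last first.
      have -> : (Lam - 1) * E = 2 * (L * (n%:R * E)) by rewrite /Lam; ring.
      by rewrite !ler_wpM2l.
    rewrite ler_wpM2l//; apply: (@le_trans _ _ (L * ((\sum_i `|g t 0 i - k i (q t)|) *
        (\sum_i `|g t 0 i - k i (q t)|)))); last by rewrite ler_wpM2l//; exact: sum_norm_sq.
    rewrite mulrCA mulr_suml; apply: ler_sum => i _.
    apply: le_trans (ler_norm _) _; rewrite normrM ler_wpM2l//.
    apply: le_trans (lip_lip lV _ _ _) _; rewrite ler_wpM2l//.
    by apply: ler_sum => j _; rewrite mxE.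
  have := (is_deriveR _ _ _).1 dphi E E0; apply: filterS2 (lt_nbhsl tT) => s sT hs ts.
  apply: le_trans ((hq s).2 (q t) Kq) _.
  move: hs; rewrite ler_norml => /andP[_]; rewrite (ger0_norm (_ : 0 <= s - t)) ?subr_ge0//.
  move=> hs; have st0 : 0 <= s - t by rewrite subr_ge0.
  have h1 : D * (s - t) <= (Lam - 1) * E * (s - t) by rewrite ler_wpM2r.
  apply: (@le_trans _ _ (E * (1 + Lam * (s - t)))).
    rewrite /m in ht; lra.
  have -> : eps * expR (Lam * s) = E * expR (Lam * (s - t)).
    by rewrite /E -mulrA -expRD; congr (_ * expR _); ring.
  by rewrite ler_wpM2l ?(ltW E0)// expR_ge1Dx.
Qed.

End Tangency.

Lemma max_der_opp X : max_der X -> max_der (fun f z => - X f z).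
Proof.
move=> [dX hX]; split; first exact: derivation_opp.
by move=> f s Cf hf; rewrite hX// oppr0.
Qed.

Lemma csfield_opp n (V : 'I_n -> 'rV[R]_n -> R) : csfield V ->
  csfield (fun i x => - V i x).
Proof.
move=> [hV [r hr]]; split=> [i m|]; last by exists r => i x /hr ->; rewrite oppr0.
have -> : (fun x => - V i x) = (fun x => (-1) * V i x).
  by apply/funext => x; rewrite mulN1r.
by apply: Cm_mul => //; exact: Cm_cst.
Qed.

Lemma fchart_opp X n (k : 'I_n -> S -> R) M V : fchart C X k M V ->
  fchart C (fun f z => - X f z) k M (fun i x => - V i x).
Proof.
by move=> [cM cs h]; split=> //; [exact: csfield_opp|move=> z i Mz; rewrite h].
Qed.

Lemma flow_opp n (V : 'I_n -> 'rV[R]_n -> R) t x : csfield V ->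
  flow (fun i x => - V i x) t x = flow V (- t) x.
Proof.
move=> cs; have [K [B lV]] := csfield_lip cs.
have h : is_sol (fun i x => - V i x) (fun t => flow V (- t) x).
  move=> s i; have := @is_d_comp _ _ (fun t => flow V t x 0 i) (fun u : R => - u) s 1 _ _
    (flow_sol lV x _ i) (is_d_opp (is_derive_id s (1 : R))).
  by rewrite mulrN1.
by have := flow_uniq (lip_opp lV) t h; rewrite oppr0 (flow0 V x) => <-.
Qed.

Section Good.
Variable X : (S -> R) -> S -> R.
Hypothesis mX : max_der X.
Let dX := mX.1.

(** For negative times, [flow_stays] is applied to - X. *)
Lemma flow_box_in n (k : 'I_n -> S -> R) M V p : fchart C X k M V -> M p ->
  exists M1, [/\ nbhs p M1, M1 `<=` M & exists2 tau : R, 0 < tau &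
    forall z t, M1 z -> `|t| < tau ->
      exists q, [/\ M q, \row_i k i q = flow V t (\row_i k i z) & expv C X t z q]].
Proof.
move=> fc Mp; have csV := fc_cs fc.
have [N1 [n1 NM1 [t1 t10 h1]]] := flow_stays mX fc Mp.
have [N2 [n2 NM2 [t2 t20 h2]]] := flow_stays (max_der_opp mX) (fchart_opp fc) Mp.
exists (N1 `&` N2); split; [exact: filterI|by move=> z [/NM1]|].
exists (Num.min t1 t2); first by rewrite lt_min t10.
move=> z t [Nz1 Nz2]; rewrite lt_min => /andP[lt1 lt2].
have Mz := NM1 _ Nz1.
pose T := Num.min t1 t2.
have /choice[c hc] : forall s, exists q, `|s| < T -> M q /\
    \row_i k i q = flow V s (\row_i k i z).
  move=> s; have [hs|hs] := ltP `|s| T; last by exists z.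
  move: hs; rewrite lt_min => /andP[s1 s2].
  have [s0|/ltW s0] := leP 0 s.
    rewrite ger0_norm// in s1; have [|q Mq Eq] := h1 z s Nz1; first by rewrite s0 ltW.
    by exists q.
  rewrite ler0_norm// in s2; have [|q Mq Eq] := h2 z (- s) Nz2.
    by rewrite oppr_ge0 s0 ltW.
  by exists q => _; rewrite Eq flow_opp// opprK.
have T0 : 0 < T by rewrite lt_min t10.
have iJ : is_interval [set s : R | `|s| < T].
  move=> x y /=; rewrite !ltr_norml => /andP[x1 x2] /andP[y1 y2] w /andP[xw wy].
  by rewrite ltr_norml (lt_le_trans x1 xw) (le_lt_trans wy y2).
have hJ := flow_icurve sC dX (t0 := 0) (a := \row_i k i z) (c := c) fc iJ.
have {}hJ : icurve C X [set s : R | `|s| < T] c.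
  by apply: hJ => s /hc; rewrite subr0.
have J0 : `|0 : R| < T by rewrite normr0.
have Jt : `|t| < T by rewrite lt_min lt1.
have [Mc0 E0] := hc 0 J0; have [Mct Et] := hc t Jt.
have c0 : c 0 = z.
  apply: (chart_inj sC (fc_chart fc) Mz Mc0) => i.
  by move: E0 => /rowP/(_ i); rewrite (flow0 V) !mxE.
exists (c t); split=> //; rewrite -c0.
exact: (expv_of_curve sC dX hJ J0 Jt).
Qed.

(** Continuity of the flow at (t0, x0), and smoothness of exp(t0 X) near x0. *)
Definition flow_regular t0 x0 := forall y0, expv C X t0 x0 y0 ->
  (forall N, nbhs y0 N -> \forall p \near (t0, x0), exists2 y, expv C X p.1 p.2 y & N y) /\
  (forall g, C g -> exists2 g', C g' & \forall x \near x0, forall y, expv C X t0 x y -> g y = g' x).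

Lemma nbhs_pairP (t : R) (x : S) (P : set (R * S)) :
  nbhs (t, x) P <-> exists A B, [/\ nbhs t A, nbhs x B & forall s y, A s -> B y -> P (s, y)].
Proof.
split=> [[[A B] /= [nA nB] AB]|[A [B [nA nB AB]]]].
  by exists A, B; split=> // s y As By; exact: AB.
by exists (A, B) => //= -[s y] [/=]; exact: AB.
Qed.

(** In a chart the flow of X is the flow of V, which is jointly continuous and smooth in
the initial point. *)
Lemma flow_regular_local (p : S) : exists2 N, nbhs p N & exists2 tau : R, 0 < tau &
  forall z t, N z -> `|t| < tau -> flow_regular t z.
Proof.
have [n [k [M [V [fc Mp]]]]] := fchart_exists sC dX p.
have [M1 [nM1 M1M [tau tau0 h]]] := flow_box_in fc Mp.
have [K [B lV]] := csfield_lip (fc_cs fc).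
have [oM Ck hM] := fc_chart fc.
exists (interior M1); first exact: nbhs_interior.
exists tau => // z t M1z tt y0 hy0.
have nM1z : nbhs z M1 := M1z; have Mz := M1M _ (nbhs_singleton nM1z).
have expE x s y : M1 x -> `|s| < tau -> expv C X s x y ->
    M y /\ \row_i k i y = flow V s (\row_i k i x).
  move=> M1x sx e1; have [q [Mq Eq e2]] := h x s M1x sx.
  by rewrite (expv_fun sC dX e1 e2).
have [My0 Ey0] := expE z t y0 (nbhs_singleton nM1z) tt hy0.
split=> [N nN|g Cg].
  have [e e0 he] := chart_nbhs sC (fc_chart fc) My0 nN.
  have n1 : \forall p \near (t, z), `|p.1| < tau /\ M1 p.2.
    apply/nbhs_pairP; exists [set s : R | `|s| < tau], M1; split=> //.
    have cn : continuous (fun s : R => `|s|) by move=> s; exact: norm_continuous.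
    exact: near_preim (cn t) (lt_nbhsl tt).
  have ck : {for (t, z), continuous (fun p : R * S => \row_i k i p.2)}.
    apply: continuous_rowE => i; apply: (cont_comp (f := fun p : R * S => p.2) (g := k i)).
      exact: cvg_snd.
    exact: (C_cont dC (Ck i)).
  have cf : {for (t, z), continuous (fun p : R * S => flow V p.1 (\row_i k i p.2))}.
    apply: (cont_comp (f := fun p : R * S => (p.1, \row_i k i p.2))
      (g := fun p : R * 'rV[R]_n => flow V p.1 p.2)); last exact: flow_cont lV _.
    by apply: cont_pair => //; exact: cvg_fst.
  have e2 : 0 < e / 2 by rewrite divr_gt0.
  have := cf _ (nbhs_box (flow V t (\row_i k i z)) e2).
  apply: filterS2 n1 => -[s x] /= [hs M1x] hb.
  have [q [Mq Eq eq]] := h x s M1x hs; exists q => //; apply: he => // i.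
  have := hb i; rewrite -Eq -Ey0 !mxE; lra.
have [F hF [e e0 he]] := hM y0 g My0 Cg.
exists (fun x => F (\row_j flow V t (\row_i k i x) 0 j)).
  apply: (dsp_comp dC (F := fun v => F (\row_j flow V t v 0 j))) => // m.
  by apply: Cm_comp => // j; apply: flow_Cm; exact: fc_cs fc.
have ck : {for z, continuous (fun x : S => flow V t (\row_i k i x))}.
  apply: (cont_comp (f := fun x : S => \row_i k i x) (g := fun v => flow V t v)).
    by apply: continuous_rowE => i; exact: (C_cont dC (Ck i)).
  exact: (@flow_cont_x _ _ _ _ _ t lV _).
have e2 : 0 < e / 2 by rewrite divr_gt0.
have := ck _ (nbhs_box (flow V t (\row_i k i z)) e2).
apply: filterS2 nM1z => x M1x hb y ey; have [My Ey] := expE x t y M1x tt ey.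
rewrite he//.
  by congr F; rewrite Ey; apply/rowP => j; rewrite mxE.
by move=> i; have := hb i; rewrite -Ey -Ey0 !mxE; lra.
Qed.

(** exp((t + s)X) is exp(tX) o exp(sX). *)
Lemma flow_regular_add s t x y : expv C X s x y -> flow_regular s x ->
  flow_regular t y -> flow_regular (t + s) x.
Proof.
move=> exy hs ht z0 ez0.
have eyz : expv C X t y z0.
  by have := expv_sub sC dX exy ez0; rewrite addrK.
have [cs ss] := hs y exy; have [ct st] := ht z0 eyz; split=> [N nN|g Cg].
  have /nbhs_pairP[A [B [nA nB AB]]] := ct N nN.
  have /nbhs_pairP[A' [B' [nA' nB' AB']]] := cs B nB.
  apply/nbhs_pairP; exists [set u | A (u - s)], B'; split=> //.
    by move: nA => /nbhsR[e e0 he]; apply/nbhsR; exists e => // u hu; apply: he;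
      rewrite -addrA -opprD (addrC s).
  move=> u w Au Bw; have [v ev Bv] := AB' s w (nbhs_singleton nA') Bw.
  have [r er Nr] := AB (u - s) v Au Bv; exists r => //.
  by have := expv_add sC dX ev er; rewrite subrK.
have [g1 Cg1 n1] := st g Cg; have [g2 Cg2 n2] := ss g1 Cg1.
exists g2 => //.
have /nbhs_pairP[A' [B' [nA' nB' AB']]] := cs _ n1.
apply: filterS2 n2 nB' => w hw Bw r er.
have [v ev hv] := AB' s w (nbhs_singleton nA') Bw.
rewrite -(hw v ev); apply: hv.
by have := expv_sub sC dX ev er; rewrite addrK.
Qed.

(** By [flow_regular_local] and [flow_regular_add], regularity is a locally constant
property along an integral curve, and it holds at time 0. *)
Lemma flow_regular_all t x : flow_regular t x.
Proof.
move=> y ey; have [J [c [hc J0 c0 hJ]]] := exp_curve sC dX x.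
have [Jt ct] := (hJ t y).1 ey.
suff : flow_regular t x by apply.
apply: (@interval_const R J [set s | flow_regular s x] hc.1 _ 0 t) => //; last first.
  have [N nN [tau tau0 h]] := flow_regular_local x.
  by apply: h; [exact: nbhs_singleton nN|rewrite normr0].
move=> u Ju; have [N nN [tau tau0 h]] := flow_regular_local (c u).
have hn := icurve_near sC hc Ju nN.
have nt : \forall s \near u, `|s - u| < tau by apply/nbhsR; exists tau.
have eu s : J s -> expv C X s x (c s) by move=> Js; exact/hJ.
apply: filterS2 hn nt => s hN hs Js.
have r1 : flow_regular (s - u) (c u).
  by apply: h => //; exact: nbhs_singleton nN.
have r2 : flow_regular (u - s) (c s).
  by apply: h; [exact: hN|rewrite distrC].
split=> r /=.
  by have := flow_regular_add (eu s Js) r r2; rewrite subrK.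
by have := flow_regular_add (eu u Ju) r r1; rewrite subrK.
Qed.

Lemma flow_near t x y N : expv C X t x y -> nbhs y N ->
  \forall p \near (t, x), exists2 y, expv C X p.1 p.2 y & N y.
Proof. by move=> e; exact: (flow_regular_all e).1. Qed.

Lemma flow_smooth t x y g : expv C X t x y -> C g ->
  exists2 g', C g' & \forall z \near x, forall w, expv C X t z w -> g w = g' z.
Proof. by move=> e; exact: (flow_regular_all e).2. Qed.

Lemma max_der_vector_field : vector_field C X.
Proof.
split; first exact: dX.
rewrite openE => -[t x] [y /= ey].
have nT : nbhs y [set: S] by exact: filterT.
have H := flow_near ey nT.
by apply: (@filterS _ (nbhs (t, x)) _ _ _ _ H) => p [z ez _]; exists z.
Qed.

End Good.

Lemma vector_fieldP X : vector_field C X <-> max_der X.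
Proof. by split; [exact: vector_field_max|exact: max_der_vector_field]. Qed.

End Bony.

(** * Transport of vector fields along flows *)

Section Transport.
Variables (R : realType) (S : topologicalType) (C : set (S -> R)).
Hypothesis sC : subcartesian C.
Let dC := sc_structure sC.
Hypothesis lcS : locally_compact [set: S].

Local Notation vf := (vector_field C).

Lemma vf_der X : vf X -> derivation C X. Proof. by case. Qed.

Lemma vf_max X : vf X -> max_der C X. Proof. exact: vector_field_max. Qed.

(** Fermat's rule is linear, whereas flows of sums are hard to describe. *)
Lemma vf_sum d (a : 'I_d -> S -> R) (W : 'I_d -> (S -> R) -> S -> R) :
  (forall i, C (a i)) -> (forall i, vf (W i)) ->
  vf (fun f z => \sum_i a i z * W i f z).
Proof.
move=> Ca hW; apply/(vector_fieldP sC lcS); split; last first.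
  move=> f s Cf hf; rewrite big1// => i _.
  by have [_ h] := vf_max (hW i); rewrite h// mulr0.
have dW i := vf_der (hW i); split.
- by move=> f Cf; apply: (C_sum dC) => i; apply: (C_mul dC) => //; exact: Defs.der_stable (dW i) _ Cf.
- move=> f g Cf Cg; apply/funext => z; rewrite -big_split; apply: eq_bigr => i _ /=.
  by rewrite (derD (dW i))// mulrDr.
- move=> c f Cf; apply/funext => z; rewrite mulr_sumr; apply: eq_bigr => i _ /=.
  by rewrite (derZ (dW i))//; ring.
- move=> f g Cf Cg; apply/funext => z; rewrite !mulr_sumr -big_split; apply: eq_bigr => i _ /=.
  by rewrite (derM (dW i))//; ring.
Qed.

Section Push.
Variables (W Z : (S -> R) -> S -> R) (t : R).
Hypotheses (vW : vf W) (vZ : vf Z).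
Let mW := vf_max vW.
Let dW := vf_der vW.
Let dZ := vf_der vZ.

(** g' is g o exp(tW) near v. *)
Definition pulls (g g' : S -> R) (v : S) :=
  \forall u \near v, forall w, expv C W t u w -> g w = g' u.

(** The pushforward of Z by exp(tW), where it is defined. *)
Let push (g : S -> R) (w : S) : R :=
  xget 0 [set r | exists v g', [/\ C g', expv C W t v w, pulls g g' v & r = Z g' v]].

Let pushE g g' v w : C g -> C g' -> expv C W t v w -> pulls g g' v -> push g w = Z g' v.
Proof.
move=> Cg Cg' ev pg; apply: xget_unique; first by exists v, g'.
move=> _ [v1 [g1 [Cg1 ev1 pg1 ->]]].
have E := expv_fun sC dW (expv_opp sC dW ev) (expv_opp sC dW ev1); rewrite -{v1}E in ev1 pg1 *.
apply: (der_local dC dZ) => //.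
have n1 : \forall u \near v, exists w, expv C W t u w.
  have nT : nbhs w [set: S] by exact: filterT.
  have /nbhs_pairP[A [B [nA nB AB]]] := flow_near sC lcS mW ev nT.
  by apply: filterS nB => u /(AB _ _ (nbhs_singleton nA))[y ey _]; exists y.
by apply: filterS3 n1 pg pg1 => u [y ey] h1 h2; rewrite -(h1 y ey) (h2 y ey).
Qed.

Let Om := [set w | exists v, expv C W t v w].

Let pullsP g w : C g -> Om w -> exists v g', [/\ C g', expv C W t v w & pulls g g' v].
Proof.
move=> Cg [v ev]; have [g' Cg' h] := flow_smooth sC lcS mW ev Cg.
by exists v, g'; split.
Qed.

Let pulls_val g g' v w : expv C W t v w -> pulls g g' v -> g w = g' v.
Proof. by move=> ev /nbhs_singleton; apply. Qed.

Let push_loc g w : C g -> Om w -> locC C (push g) w.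
Proof.
move=> Cg /[dup] Ow /(pullsP Cg)[v [g' [Cg' ev pg]]].
have ev' := expv_opp sC dW ev.
have CZ : C (Z g') := Defs.der_stable dZ Cg'.
have [h Ch nh] := flow_smooth sC lcS mW ev' CZ.
exists h => //.
have ppg : nbhs v [set u | pulls g g' u] by exact: nbhs_interior.
have /nbhs_pairP[A [B [nA nB AB]]] := flow_near sC lcS mW ev' ppg.
apply: filterS2 nB nh => y By hy.
have [u eu pu] := AB _ _ (nbhs_singleton nA) By.
rewrite /= in eu pu; rewrite -(hy u eu); apply: pushE => //.
by have := expv_opp sC dW eu; rewrite opprK.
Qed.

(** A local maximum of g is carried to one of g', so Fermat's rule is inherited. The
function beta cuts off the result, which is defined on the image of exp(tW) only. *)
Lemma pushforward x y : expv C W t x y -> exists2 Z', vf Z' & forall g g', C g -> C g' ->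
  pulls g g' x -> Z' g y = Z g' x.
Proof.
move=> exy.
have nOm : nbhs y Om.
  have nT : nbhs x [set: S] by exact: filterT.
  have /nbhs_pairP[A [B [nA nB AB]]] := flow_near sC lcS mW (expv_opp sC dW exy) nT.
  apply: filterS nB => w /(AB _ _ (nbhs_singleton nA))[v /= ev _].
  by exists v; have := expv_opp sC dW ev; rewrite opprK.
have [beta [Cb _ b1 b0]] := C_bump dC nOm.
have b0' w : ~ Om w -> beta w = 0 by move=> /b0; exact: nbhs_singleton.
exists (fun g w => beta w * push g w); last first.
  move=> g g' Cg Cg' pg; rewrite (nbhs_singleton b1) mul1r; exact: pushE.
apply/(vector_fieldP sC lcS); split; first split.
- by move=> g Cg; apply: (C_cut dC Cb b0) => w Ow; exact: push_loc.
- move=> f g Cf Cg; apply/funext => w; have [Ow|/b0' ->] := pselect (Om w); last by rewrite !mul0r addr0.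
  have [v [f' [Cf' ev pf]]] := pullsP Cf Ow.
  have [v1 [g' [Cg' ev1 pg]]] := pullsP Cg Ow.
  have E := expv_fun sC dW (expv_opp sC dW ev) (expv_opp sC dW ev1); rewrite -{v1}E in ev1 pg.
  rewrite -mulrDr (pushE Cf Cf' ev pf) (pushE Cg Cg' ev pg); congr (_ * _).
  rewrite -(derD dZ)//; apply: pushE => //; [exact: (C_add dC)|exact: (C_add dC)|].
  by apply: filterS2 pf pg => u h1 h2 z ez; rewrite (h1 z ez) (h2 z ez).
- move=> c g Cg; apply/funext => w; have [Ow|/b0' ->] := pselect (Om w); last by rewrite !mul0r mulr0.
  have [v [g' [Cg' ev pg]]] := pullsP Cg Ow.
  rewrite mulrCA (pushE Cg Cg' ev pg); congr (_ * _).
  rewrite -(derZ dZ)//; apply: pushE => //; [exact: (C_scale dC)|exact: (C_scale dC)|].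
  by apply: filterS pg => u h1 z ez; rewrite (h1 z ez).
- move=> f g Cf Cg; apply/funext => w; have [Ow|/b0' ->] := pselect (Om w); last by rewrite !mul0r !mulr0 addr0.
  have [v [f' [Cf' ev pf]]] := pullsP Cf Ow.
  have [v1 [g' [Cg' ev1 pg]]] := pullsP Cg Ow.
  have E := expv_fun sC dW (expv_opp sC dW ev) (expv_opp sC dW ev1); rewrite -{v1}E in ev1 pg.
  rewrite (pushE Cf Cf' ev pf) (pushE Cg Cg' ev pg) (pulls_val ev pf) (pulls_val ev pg).
  have -> : push (fun z => f z * g z) w = Z (fun z => f' z * g' z) v.
    apply: pushE => //; [exact: (C_mul dC)|exact: (C_mul dC)|].
    by apply: filterS2 pf pg => u h1 h2 z ez; rewrite (h1 z ez) (h2 z ez).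
  by rewrite (derM dZ)//; ring.
- move=> g w Cg gmax; have [Ow|/b0' ->] := pselect (Om w); last by rewrite mul0r.
  have [v [g' [Cg' ev pg]]] := pullsP Cg Ow.
  rewrite (pushE Cg Cg' ev pg) (vf_max vZ).2 ?mulr0//.
  have /nbhs_pairP[A [B [nA nB AB]]] := flow_near sC lcS mW ev gmax.
  have E := pulls_val ev pg.
  apply: filterS2 nB pg => u Bu hu; rewrite -E.
  by have [z /= ez] := AB _ _ (nbhs_singleton nA) Bu; rewrite (hu z ez).
Qed.

Lemma pulls_inv x y g : expv C W t x y -> C g -> exists2 g', C g' & pulls g' g x.
Proof.
move=> exy Cg; have [g' Cg' n] := flow_smooth sC lcS mW (expv_opp sC dW exy) Cg.
exists g' => //.
have /nbhs_pairP[A [B [nA nB AB]]] := flow_near sC lcS mW exy n.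
apply: filterS nB => u Bu w ew; have [z /= ez hz] := AB _ _ (nbhs_singleton nA) Bu.
rewrite (expv_fun sC dW ew ez); apply/esym; apply: hz.
exact: (expv_opp sC dW ez).
Qed.

End Push.

(** The dimension of the span of the vector fields at q is at least d. *)
Definition rank_ge d (q : S) := exists (W : 'I_d -> (S -> R) -> S -> R) (x : 'I_d -> S -> R),
  [/\ forall i, vf (W i), forall j, C (x j) & forall i j, W i (x j) q = (i == j)%:R].

(** Transport the fields forward and the functions along the inverse flow. *)
Lemma rank_push d W t x y : vf W -> expv C W t x y -> rank_ge d x -> rank_ge d y.
Proof.
move=> vW exy [Z [f [vZ Cf hZ]]].
have /choice[Z' hZ'] : forall i, exists Z', vf Z' /\ forall g g', C g -> C g' ->
    pulls W t g g' x -> Z' g y = Z i g' x.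
  by move=> i; have [Z' ? ?] := pushforward vW (vZ i) exy; exists Z'.
have /choice[f' hf'] : forall j, exists g', C g' /\ pulls W t g' (f j) x.
  by move=> j; have [g' ? ?] := pulls_inv vW exy (Cf j); exists g'.
exists Z', f'; split=> [i|j|i j]; [by have [] := hZ' i|by have [] := hf' j|].
have [_ h] := hZ' i; have [Cf' pf] := hf' j.
by rewrite (h _ _ Cf' (Cf j) pf).
Qed.

Lemma rank_orbit d x z : vorbit C x z -> rank_ge d z -> rank_ge d x.
Proof.
move=> [k [xi [t [vxi [p [<- <- hp]]]]]].
have H j : (j <= k)%N -> rank_ge d (p j) -> rank_ge d (p 0%N).
  elim: j => [//|j IH jk /= h]; apply: (IH (ltnW jk)).
  have vj := vxi (Ordinal jk); have e := hp (Ordinal jk).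
  exact: rank_push vj (expv_opp sC (vf_der vj) e) h.
exact: H.
Qed.

(** In a chart of dimension n the identity matrix of size d factors through R^n. *)
Lemma rank_bound q : exists n, forall d, rank_ge d q -> (d <= n)%N.
Proof.
have [n [k [M [cM Mq]]]] := chart_exists sC q.
exists n => d [W [x [vW Cx hW]]]; have [oM Ck hM] := cM.
have /choice[F hF] : forall j, exists F : 'rV[R]_n -> R, forall i, W i (x j) q =
    \sum_l 'D_(delta_mx 0 l) F (\row_m k m q) * W i (k l) q.
  move=> j; have [F hF [e e0 he]] := hM q (x j) Mq (Cx j).
  by exists F => i; exact: (chart_der sC (vf_der (vW i)) cM Mq (Cx j) hF e0 he).
have E : (1%:M : 'M[R]_d) = (\matrix_(i, l) W i (k l) q) *m
    (\matrix_(l, j) 'D_(delta_mx 0 l) (F j) (\row_m k m q)).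
  apply/matrixP => i j; rewrite !mxE -hW hF; apply: eq_bigr => l _.
  by rewrite !mxE mulrC.
rewrite -(mxrank1 R d) E; apply: leq_trans (mxrankM_maxl _ _) _; exact: rank_leq_col.
Qed.

Lemma rank_max q : exists2 d, rank_ge d q & ~ rank_ge d.+1 q.
Proof.
have [n hn] := rank_bound q; apply: contrapT => H.
have : forall d, rank_ge d q.
  elim=> [|d IH].
    exists (fun _ f => f), (fun _ _ => 0); split; by case.
  by apply: contrapT => h; apply: H; exists d.
by move=> /(_ n.+1)/hn; rewrite ltnn.
Qed.

Lemma vorbit_step x z w X t : vf X -> vorbit C x z -> expv C X t z w -> vorbit C x w.
Proof.
move=> vX [k [xi [T [vxi [p [p0 pk hp]]]]]] ezw.
exists k.+1, (fun i => if unlift ord_max i is Some j then xi j else X),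
  (\row_i if unlift ord_max i is Some j then T 0 j else t); split.
  by move=> i; case: unliftP.
exists (fun j => if (j <= k)%N then p j else w); split; rewrite ?ltnn//.
move=> i; rewrite mxE; case: unliftP => [j ->|->].
  by rewrite lift_max ltn_ord (ltnW (ltn_ord j)).
by rewrite /= leqnn ltnn pk.
Qed.

(** * Composed flows *)

(** The curve moves along the orbit: its velocity is a value of a vector field, which may
depend on s. The second clause bounds the components of the velocity near s. *)
Definition vf_velocity (sg : R -> S) (s : R) :=
  (exists2 Z, vf Z & forall g, C g -> is_derive s 1 (fun u : R => g (sg u)) (Z g (sg s))) /\
  (forall g, C g -> exists2 dg : R -> R, {for s, continuous dg} &
     \forall u \near s, is_derive (u : R) 1 (fun u : R => g (sg u)) (dg u)).

Lemma vf_velocity_near sg sg' (s : R) : (\forall u \near s, sg u = sg' u) ->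
  vf_velocity sg s -> vf_velocity sg' s.
Proof.
move=> E [[Z vZ hZ] h2].
have E' g : \forall u \near s, g (sg u) = g (sg' u) :> R by apply: filterS E => u ->.
split.
  exists Z => // g Cg; rewrite -(nbhs_singleton E).
  exact: near_eq_is_derive (E' g) (hZ g Cg).
move=> g Cg; have [dg cdg hdg] := h2 g Cg; exists dg => //.
have nE := nbhs_interior (E' g).
apply: filterS2 nE hdg => u h3 h4; exact: near_eq_is_derive h3 h4.
Qed.

Lemma vf_velocity_cont sg (s : R) N : vf_velocity sg s -> nbhs (sg s) N ->
  \forall u \near s, N (sg u).
Proof.
move=> [[Z vZ hZ] _] /(nbhs_rho dC)[rho [Cr _ r0 hr]].
have cf : {for s, continuous (fun u => rho (sg u))}.
  apply: differentiable_continuous; apply/derivable1_diffP.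
  exact: (@ex_derive _ _ _ _ _ _ _ (hZ rho Cr)).
have := near_preim cf (lt_nbhsl (_ : rho (sg s) < 1)); rewrite r0 ltr01 => /(_ isT).
by apply: filterS => u; exact: hr.
Qed.

Lemma vf_velocity_exp W x sg (s : R) : vf W ->
  (\forall u \near s, expv C W u x (sg u)) -> vf_velocity sg s.
Proof.
move=> vW hs; have [J [c [hc J0 c0 hJ]]] := exp_curve sC (vf_der vW) x.
have nJ : nbhs s J by apply: filterS hs => u /hJ[].
have E : \forall u \near s, c u = sg u by apply: filterS hs => u /hJ[].
have Js := nbhs_singleton nJ.
apply: vf_velocity_near E _; split.
  exists W => // g Cg; have [_ h] := hc.2 g s Cg Js; exact: h.
move=> g Cg; exists (fun u => W g (c u)).
  apply: cont_eps => e e0.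
  have [h _] := hc.2 (W g) s (Defs.der_stable (vf_der vW) Cg) Js.
  by apply: filterS2 nJ (h e e0) => u Ju /(_ Ju); rewrite distrC => /ltW.
have nnJ : nbhs s [set u | nbhs u J] by exact: nbhs_interior.
apply: filterS nnJ => u nu; have [_ h] := hc.2 g u Cg (nbhs_singleton nu); exact: h.
Qed.

(** The pullbacks of functions and the pushforward of the velocity correspond. *)
Lemma vf_velocity_push W t sg sg' (s : R) : vf W -> vf_velocity sg s ->
  (\forall u \near s, expv C W t (sg u) (sg' u)) -> vf_velocity sg' s.
Proof.
move=> vW vs hs; have [[Z vZ hZ] h2] := vs.
have e0 := nbhs_singleton hs.
have key g : C g -> exists g', [/\ C g', pulls W t g g' (sg s) &
    \forall u \near s, g' (sg u) = g (sg' u)].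
  move=> Cg; have [g' Cg' n] := flow_smooth sC lcS (vf_max vW) e0 Cg.
  exists g'; split=> //.
  apply: filterS2 hs (vf_velocity_cont vs n) => u eu hu.
  by rewrite (hu _ eu).
split.
  have [Z' vZ' hZ'] := pushforward vW vZ e0; exists Z' => // g Cg.
  have [g' [Cg' pg E]] := key g Cg; rewrite (hZ' g g' Cg Cg' pg).
  exact: near_eq_is_derive E (hZ g' Cg').
move=> g Cg; have [g' [Cg' pg E]] := key g Cg; have [dg cdg hdg] := h2 g' Cg'.
exists dg => //.
have nE := nbhs_interior E.
apply: filterS2 nE hdg => u h3 h4; exact: near_eq_is_derive h3 h4.
Qed.

Section MultiExp.
Variables (k : nat) (xi : 'I_k -> (S -> R) -> S -> R).
Hypothesis vxi : forall j, vf (xi j).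

Lemma chain_fun (T T' : 'rV[R]_k) p p' j : (j <= k)%N ->
  (forall i : 'I_k, (i < j)%N -> T 0 i = T' 0 i) -> p 0%N = p' 0%N ->
  (forall i : 'I_k, expv C (xi i) (T 0 i) (p i) (p i.+1)) ->
  (forall i : 'I_k, expv C (xi i) (T' 0 i) (p' i) (p' i.+1)) -> p j = p' j.
Proof.
move=> jk hT p0 h h'; elim: j jk hT => [//|j IH jk hT].
have e := h (Ordinal jk); have e' := h' (Ordinal jk).
rewrite /= hT// (IH (ltnW jk)) in e; last by move=> i ij; apply: hT; exact: ltnW.
exact: (expv_fun sC (vf_der (vxi _)) e e').
Qed.

Lemma multi_exp_fun T y z z' : multi_exp C xi T y z -> multi_exp C xi T y z' -> z = z'.
Proof.
by move=> [p [p0 <- hp]] [p' [p0' <- hp']]; apply: chain_fun hp hp' => //; rewrite p0.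
Qed.

Lemma multi_exp_orbit x T y z : vorbit C x y -> multi_exp C xi T y z -> vorbit C x z.
Proof.
move=> oy [p [p0 <- hp]].
have H j : (j <= k)%N -> vorbit C x (p j).
  elim: j => [_|j IH jk]; first by rewrite p0.
  have := hp (Ordinal jk); exact: vorbit_step (vxi _) (IH (ltnW jk)).
exact: H.
Qed.

(** Continuity of each of the flows in turn, from the last to the first. *)
Lemma multi_exp_near T0 y z0 N : multi_exp C xi T0 y z0 -> nbhs z0 N ->
  \forall T \near T0, exists2 z, multi_exp C xi T y z & N z.
Proof.
move=> [p0 [p00 <- hp0]].
suff H j : (j <= k)%N -> forall N, nbhs (p0 j) N -> \forall T \near T0, exists p,
    [/\ p 0%N = y, N (p j) &
        forall i : 'I_k, (i < j)%N -> expv C (xi i) ((T : 'rV[R]_k) 0 i) (p i) (p i.+1)].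
  move=> nN; have := H k (leqnn k) N nN; apply: filterS => T [p [h1 h2 h3]].
  by exists (p k) => //; exists p; split=> // i; exact: h3.
elim: j => [_|j IH jk] {}N nN.
  have Ny := nbhs_singleton nN.
  by apply: (filterS _ (@filterT _ (nbhs T0) _)) => T _; exists p0; split.
have /nbhs_pairP[A [B [nA nB AB]]] := flow_near sC lcS (vf_max (vxi (Ordinal jk)))
  (hp0 (Ordinal jk)) nN.
have cT : {for T0, continuous (fun T : 'rV[R]_k => T 0 (Ordinal jk))}.
  exact: coord_continuous.
have nT := near_preim cT nA.
apply: filterS2 nT (IH (ltnW jk) B nB) => T AT [p [h1 h2 h3]].
have [z ez Nz] := AB _ _ AT h2.
exists (fun m => if (m <= j)%N then p m else z); rewrite ltnn; split=> // i ij.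
rewrite ltnS in ij; rewrite ij; move: ij; rewrite leq_eqVlt => /orP[/eqP ij|ij].
  have -> : i = Ordinal jk by exact: val_inj.
  by rewrite /= ltnn.
by rewrite ij; exact: h3.
Qed.

Definition upd (T : 'rV[R]_k) (i : 'I_k) (s : R) : 'rV[R]_k :=
  \row_j if j == i then s else T 0 j.

(** Moving one of the times, the end point follows an integral curve transported by
the flows that come later. *)
Lemma multi_exp_velocity T (i : 'I_k) y sg (s : R) :
  (\forall u \near s, multi_exp C xi (upd T i u) y (sg u)) -> vf_velocity sg s.
Proof.
move=> hs.
have /choice[p hp] : forall u, exists p : nat -> S, multi_exp C xi (upd T i u) y (sg u) ->
    [/\ p 0%N = y, p k = sg u &
        forall j : 'I_k, expv C (xi j) (upd T i u 0 j) (p j) (p j.+1)].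
  move=> u; have [[p h]|N] := pselect (multi_exp C xi (upd T i u) y (sg u)).
    by exists p.
  by exists (fun=> y) => /N.
have hs0 := nbhs_singleton hs.
have [q0 qk qe] := hp s hs0.
have before u : multi_exp C xi (upd T i u) y (sg u) -> p u i = p s i.
  move=> hu; have [p0 pk pe] := hp u hu.
  apply: (chain_fun (T := upd T i u) (T' := upd T i s)) pe qe; [exact: ltnW| |by rewrite p0].
  by move=> j ji; rewrite !mxE; case: eqP => // e; rewrite e ltnn in ji.
have H j : (i < j <= k)%N -> vf_velocity (fun u => p u j) s.
  elim: j => [//|j IH] /andP[+ jk]; rewrite ltnS leq_eqVlt => /orP[/eqP ij|ij].
    apply: (vf_velocity_exp (W := xi i) (x := p s i)) => //.
    apply: filterS hs => u hu; have [p0 pk pe] := hp u hu.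
    by have := pe i; rewrite mxE eqxx before// -ij.
  apply: (vf_velocity_push (W := xi (Ordinal jk)) (t := T 0 (Ordinal jk))
    (sg := fun u => p u j)) => //; first by apply: IH; rewrite ij ltnW.
  apply: filterS hs => u hu; have [p0 pk pe] := hp u hu.
  have := pe (Ordinal jk); rewrite mxE; case: eqP => // e.
  by rewrite -e /= ltnn in ij.
apply: (vf_velocity_near (sg := fun u => p u k)).
  by apply: filterS hs => u hu; have [] := hp u hu.
by apply: H; rewrite ltn_ord leqnn.
Qed.

End MultiExp.

End Transport.

(** * Slices of orbits *)


Section Prelim.
Variable R : realType.

Lemma near_is_derive_cont (f df : R -> R) (a b : R) :
  (forall u, a <= u <= b -> is_derive u 1 f (df u)) -> {within `[a, b], continuous f}.
Proof.
move=> h; apply: within_eps => u hu d d0.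
have cf : {for u, continuous f}.
  apply: differentiable_continuous; apply/derivable1_diffP.
  exact: (@ex_derive _ _ _ _ _ _ _ (h u hu)).
have := near_preim cf (nbhsx_ballx _ _ d0); apply: filterS => v.
by rewrite /ball/= distrC.
Qed.

Lemma gronwall_sym n (e de : 'I_n -> R -> R) (K a b : R) : 0 <= K ->
  (forall i u, `|u - a| <= `|b - a| -> is_derive u 1 (e i) (de i u)) ->
  (forall i u, `|u - a| <= `|b - a| -> `|de i u| <= K * \sum_j `|e j u|) ->
  (forall i, e i a = 0) -> forall i, e i b = 0.
Proof.
move=> K0 hde hK e0; have [ab|/ltW ba] := leP a b.
  have dist u : a <= u <= b -> `|u - a| <= `|b - a|.
    by case/andP => h1 h2; rewrite !ger0_norm; lra.
  apply: (@gronwall0 _ _ e de K a b) => //.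
  - by move=> i; apply: near_is_derive_cont => u /dist; exact: hde.
  - move=> i u; rewrite in_itv/= => /andP[h1 h2]; apply: hde; apply: dist.
    by rewrite !ltW.
  - move=> i u; rewrite in_itv/= => /andP[h1 h2]; apply: hK; apply: dist.
    by rewrite !ltW.
have dist u : - a <= u <= - b -> `|- u - a| <= `|b - a|.
  by case/andP => h1 h2; rewrite !ler0_norm; lra.
have dr i (u : R) : - a <= u <= - b -> is_derive u 1 (fun s => e i (- s)) (- de i (- u)).
  move=> hu; have := @is_d_comp _ _ (e i) (fun u : R => - u) u 1 _ _
    (hde i _ (dist u hu)) (is_d_opp (is_derive_id u (1 : R))).
  by rewrite mulrN1.
move=> i; rewrite -[b]opprK; have ab : - a <= - b by rewrite lerN2.
apply: (@gronwall0 _ _ (fun i s => e i (- s)) (fun i s => - de i (- s)) K (- a) (- b)) => //.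
- by move=> j; apply: near_is_derive_cont => u; exact: dr.
- by move=> j u; rewrite in_itv/= => /andP[h1 h2]; apply: dr; rewrite !ltW.
- move=> j u; rewrite in_itv/= normrN => /andP[h1 h2]; apply: hK; apply: dist.
  by rewrite !ltW.
- by move=> j; rewrite opprK.
Qed.

Lemma is_derive_dir n (f : 'rV[R]_n -> R) (x v : 'rV[R]_n) (l : R) :
  is_derive (0 : R) 1 (fun h : R => f (h *: v + x)) l -> is_derive x v f l.
Proof.
move=> [hd hv]; apply: DeriveDef; first exact: (iffRL (derivable1P _ _ _) hd).
rewrite -hv /derive; congr (lim _); apply/funext => P; rewrite /= propeqE.
have E : (fun h : R => h^-1 *: (f (h *: v + x) - f x)) =
    (fun h : R => h^-1 *: (f ((h *: (1 : R) + 0) *: v + x) - f ((0 : R) *: v + x))).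
  by apply/funext => h; rewrite addr0 scale0r add0r /GRing.scale/= mulr1.
by rewrite /shift /= E.
Qed.

End Prelim.

Section Slice.
Variables (R : realType) (S : topologicalType) (C : set (S -> R)).
Hypothesis sC : subcartesian C.
Let dC := sc_structure sC.
Hypothesis lcS : locally_compact [set: S].

Local Notation vf := (vector_field C).

Lemma C_det d (a : 'I_d -> 'I_d -> S -> R) : (forall i j, C (a i j)) ->
  C (fun z => \det (\matrix_(i, j) a i j z)).
Proof.
move=> Ca; have -> : (fun z => \det (\matrix_(i, j) a i j z)) =
    (fun z => \sum_(s : 'S_d) (-1) ^+ s * \prod_i a i (s i) z).
  apply/funext => z; rewrite /determinant; apply: eq_bigr => s _.
  by congr (_ * _); apply: eq_bigr => i _; rewrite mxE.
by apply: (C_sum dC) => s; apply: (C_scale dC); apply: (C_prod dC).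
Qed.

(** The fields are multiplied by the inverse of the matrix of the W_i x_j, whose entries
are smooth near p by Cramer's rule. *)
Lemma frame_exists d p : rank_ge C d p -> exists W x,
  [/\ forall i : 'I_d, vf (W i), forall j : 'I_d, C (x j), forall j, x j p = 0 &
      \forall z \near p, forall i j, W i (x j) z = (i == j)%:R].
Proof.
move=> [W [x [vW Cx hW]]].
have dW i := vf_der (vW i).
pose a i j := W i (x j).
have Ca i j : C (a i j) := Defs.der_stable (dW i) (Cx j).
pose A z : 'M[R]_d := \matrix_(i, j) a i j z.
have Cdet : C (fun z => \det (A z)) by exact: C_det.
have Ap : A p = 1%:M by apply/matrixP => i j; rewrite !mxE /a hW.
have dp : \det (A p) != 0 by rewrite Ap det1 oner_neq0.
have Cadj i j : C (fun z => \adj (A z) i j).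
  have -> : (fun z => \adj (A z) i j) = (fun z => (-1) ^+ (j + i) *
      \det (\matrix_(k, l) (fun k l => a (lift j k) (lift i l)) k l z)).
    apply/funext => z; rewrite mxE /cofactor; congr (_ * \det _).
    by apply/matrixP => k l; rewrite !mxE.
  by apply: (C_scale dC); apply: C_det.
have [di Cdi hdi] := locC_inv dC Cdet dp.
pose b i k z := di z * \adj (A z) i k.
exists (fun i f z => \sum_k b i k z * W k f z), (fun j z => x j z - x j p); split.
- by move=> i; apply: vf_sum => // k; apply: (C_mul dC).
- by move=> j; apply: (C_sub dC) => //; exact: C_cst.
- by move=> j; rewrite subrr.
have cdet := C_cont dC Cdet.
have nz : \forall z \near p, \det (A z) != 0.
  have h : nbhs (\det (A p)) [set u : R | u != 0].
    by apply: open_nbhs_nbhs; split=> //; exact: open_neq.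
  exact: near_preim (cdet p) h.
apply: filterS2 hdi nz => z hz nz i j.
have E k : W k (fun z => x j z - x j p) z = A z k j.
  by rewrite (derB dC (dW k))//; [rewrite (der_cst dC (dW k)) subr0 mxE|exact: C_cst].
have := mul_adj_mx (A z) => /matrixP/(_ i j); rewrite !mxE => H.
transitivity (di z * \sum_k \adj (A z) i k * A z k j).
  by rewrite mulr_sumr; apply: eq_bigr => k _; rewrite E /b mulrA.
by rewrite H -hz -[\det _ *+ _]mulr_natr mulrA mulVf// mul1r.
Qed.

Section Frame.
Variables (p : S) (d : nat) (W : 'I_d -> (S -> R) -> S -> R) (x : 'I_d -> S -> R).
Variable N0 : set S.
Hypotheses (vW : forall i, vf (W i)) (Cx : forall j, C (x j)) (xp : forall j, x j p = 0).
Hypotheses (oN0 : open N0) (N0p : N0 p).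
Hypothesis Wx : forall z i j, N0 z -> W i (x j) z = (i == j)%:R.
Hypothesis maxrk : ~ rank_ge C d.+1 p.
Let dW i := vf_der (vW i).

(** Otherwise g, corrected by a combination of the x_i, and Z, corrected by one of the
W_i, would raise the rank at q, and thus at p. *)
Lemma frame_span q Z g : N0 q -> vorbit C p q -> vf Z -> C g ->
  Z g q = \sum_i Z (x i) q * W i g q.
Proof.
move=> Nq oq vZ Cg; apply/eqP; rewrite -subr_eq0; apply/eqP; apply: contrapT => /eqP c0.
set c := _ - _ in c0; apply: maxrk; apply: (rank_orbit sC lcS oq).
have dZ := vf_der vZ.
pose al i := Z (x i) q; pose be i := W i g q.
pose T : 'I_d.+1 -> (S -> R) -> S -> R :=
  fun i => if unlift ord_max i is Some j then W j else Z.
pose co : 'I_d.+1 -> R := fun i => if unlift ord_max i is Some j then - al j / c else c^-1.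
have vT i : vf (T i) by rewrite /T; case: unliftP.
pose Z' f z := \sum_i co i * T i f z.
have vZ' : vf Z' by apply: vf_sum => // i; exact: C_cst.
have Z'E f : Z' f q = c^-1 * (Z f q - \sum_i al i * W i f q).
  rewrite /Z' big_ord_recr /= /co /T unlift_none mulrBr addrC; congr (_ + _).
  rewrite mulr_sumr -sumrN; apply: eq_bigr => i _.
  have -> : widen_ord (leqnSn d) i = lift ord_max i.
    by apply: val_inj; rewrite /= /bump leqNgt ltn_ord.
  by rewrite liftK; ring.
pose g' z := g z - \sum_i be i * x i z.
have Cs : C (fun z => \sum_i be i * x i z) by apply: (C_sum dC) => i; exact: C_scale.
have g'E Y : derivation C Y -> Y g' q = Y g q - \sum_i be i * Y (x i) q.
  move=> dY; rewrite /g' (derB dC dY)// (der_sum dC dY); last by move=> i; exact: C_scale.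
  by congr (_ - _); apply: eq_bigr => i _; rewrite (derZ dY).
have sumd (h : 'I_d -> R) j : \sum_i h i * (i == j)%:R = h j.
  rewrite (bigD1 j)//= eqxx mulr1 big1 ?addr0// => i /negbTE ->.
  by rewrite mulr0.
have Wg' i : W i g' q = 0.
  rewrite g'E//; under eq_bigr do rewrite Wx// eq_sym.
  by rewrite sumd subrr.
exists (fun i => if unlift ord_max i is Some j then W j else Z'),
  (fun i => if unlift ord_max i is Some j then x j else g'); split.
- by move=> i; case: unliftP.
- by move=> j; case: unliftP => // _; exact: (C_sub dC).
- move=> i j; case: (unliftP ord_max i) => [i' ->|->]; case: (unliftP ord_max j) => [j' ->|->].
  + by rewrite Wx// (inj_eq (@lift_inj _ _)).
  + by rewrite Wg' eq_sym (negbTE (neq_lift _ _)).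
  + rewrite Z'E; under eq_bigr do rewrite Wx//.
    by rewrite sumd subrr mulr0 (negbTE (neq_lift _ _)).
  + rewrite Z'E; under eq_bigr do rewrite Wg' mulr0.
    rewrite big1// subr0 eqxx g'E// mulr1n.
    have -> : Z g q - \sum_i be i * Z (x i) q = c.
      by rewrite /c; congr (_ - _); apply: eq_bigr => m _; rewrite mulrC.
    by rewrite mulVf.
Qed.

(** As long as the curve stays in N0, the function x l is affine along it. *)
Lemma one_flow i N : nbhs p N -> exists2 r : R, 0 < r & exists2 N', nbhs p N' &
  forall z tau, N' z -> `|tau| < r -> exists w, [/\ expv C (W i) tau z w, N w &
    forall l, x l w = x l z + (i == l)%:R * tau].
Proof.
move=> nN; have nN1 : nbhs p (N `&` N0) by apply: filterI => //; exact: open_nbhs_nbhs.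
have /nbhs_pairP[A [B [nA nB AB]]] :=
  flow_near sC lcS (vf_max sC (vW i)) (expv0 sC (dW i) p) nN1.
move: nA => /nbhsR[r r0 hr]; exists r => //; exists B => // z tau Bz tr.
have [J [c [hc J0 c0 hJ]]] := exp_curve sC (dW i) z.
have cN s : `|s| < r -> J s /\ N (c s) /\ N0 (c s).
  move=> sr; have As : A s by apply: hr; rewrite subr0.
  by have [w /= /hJ[Js <-] [h1 h2]] := AB s z As Bz.
have [Jt [Nt _]] := cN tau tr.
exists (c tau); split=> //; first exact/hJ.
move=> l; pose e (j : 'I_1) u := x l (c u) - (x l z + (i == l)%:R * u).
suff : e 0 tau = 0 by move=> /eqP; rewrite subr_eq0 => /eqP.
apply: (@gronwall_sym R 1 e (fun _ _ => 0) 0 0 tau) => //.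
- move=> j u; rewrite !subr0 => ut; have ur := le_lt_trans ut tr.
  have [Ju [_ N0u]] := cN u ur.
  have nJ : nbhs u J.
    have [a [b [a1 b1 ab]]] : exists a b, [/\ J a, J b & a < u < b].
      pose m := (`|u| + r) / 2; have mu : `|u| < m by rewrite /m; lra.
      have mr : m < r by rewrite /m; lra.
      have m0 : 0 < m by exact: le_lt_trans mu.
      exists (- m), m; split.
      + by have [] := cN (- m); rewrite ?normrN ?gtr0_norm.
      + by have [] := cN m; rewrite ?gtr0_norm.
      + by rewrite -ltr_norml.
    exact: interior_itv hc.1 a1 b1 ab.
  have [_ /(_ nJ) h1] := hc.2 (x l) u (Cx l) Ju.
  have h2 := is_d_add (is_d_cst (x l z) u (1 : R))
    (is_d_scale (i == l)%:R (is_derive_id u (1 : R))).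
  have := is_d_sub h1 h2; rewrite Wx// add0r mulr1 subrr; exact.
- by move=> j u _; rewrite normr0 mul0r.
- by move=> j; rewrite /e c0 mulr0 addr0 subrr.
Qed.

(** The neighbourhoods are chosen from the last flow to the first, so that every stage
of the composition stays in N0, where the coordinates change linearly. *)
Lemma slice_exists : exists2 r : R, 0 < r & exists Psi : 'rV[R]_d -> S,
  forall t : 'rV[R]_d, (forall i, `|t 0 i| < r) ->
    [/\ multi_exp C W t p (Psi t), N0 (Psi t) & forall l, x l (Psi t) = t 0 l].
Proof.
suff H j : (j <= d)%N -> forall N, nbhs p N -> exists2 r : R, 0 < r &
    forall t : 'rV[R]_d, (forall i, `|t 0 i| < r) -> exists P : nat -> S,
    [/\ P 0%N = p, N (P j),
        forall i : 'I_d, (i < j)%N -> expv C (W i) (t 0 i) (P i) (P i.+1) &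
        forall l : 'I_d, x l (P j) = if (l < j)%N then t 0 l else 0].
  have [r r0 hr] := H d (leqnn d) N0 (open_nbhs_nbhs (conj oN0 N0p)).
  exists r => //.
  have /choice[Psi hPsi] : forall t : 'rV[R]_d, exists z, (forall i, `|t 0 i| < r) ->
      [/\ multi_exp C W t p z, N0 z & forall l, x l z = t 0 l].
    move=> t; have [ht|N] := pselect (forall i, `|t 0 i| < r); last by exists p => /N.
    have [P [P0 NP hP xP]] := hr t ht; exists (P d) => _; split=> //.
      by exists P; split=> // i; exact: hP.
    by move=> l; rewrite xP ltn_ord.
  by exists Psi.
elim: j => [_ N nN|j IH jd N nN].
  exists 1 => // t _; exists (fun=> p); split=> //; exact: nbhs_singleton.
have [r1 r10 [N' nN' h1]] := one_flow (Ordinal jd) nN.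
have [r2 r20 h2] := IH (ltnW jd) N' nN'.
exists (Num.min r1 r2); first by rewrite lt_min r10.
move=> t ht; have [|P [P0 NP hP xP]] := h2 t.
  by move=> i; have := ht i; rewrite lt_min => /andP[].
have [|w [ew Nw xw]] := h1 (P j) (t 0 (Ordinal jd)) NP.
  by have := ht (Ordinal jd); rewrite lt_min => /andP[].
exists (fun m => if (m <= j)%N then P m else w); rewrite ltnn; split=> //.
- move=> i; rewrite ltnS => ij; rewrite ij; move: (ij); rewrite leq_eqVlt => /orP[/eqP ij'|ij'].
    have -> : i = Ordinal jd by exact: val_inj.
    by rewrite /= ltnn.
  by rewrite ij'; exact: hP.
- move=> l; rewrite xw xP ltnS -val_eqE /=; case: (ltngtP l j) => lj; rewrite ?mul0r ?addr0//.
  by rewrite add0r mul1r; congr (t 0 _); exact/val_inj.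
Qed.

Section Param.
Variables (r : R) (Psi : 'rV[R]_d -> S).
Hypothesis r0 : 0 < r.
Hypothesis hPsi : forall t : 'rV[R]_d, (forall i, `|t 0 i| < r) ->
  [/\ multi_exp C W t p (Psi t), N0 (Psi t) & forall l, x l (Psi t) = t 0 l].

Lemma near_small (t : 'rV[R]_d) (a : R) : (forall i, `|t 0 i| < a) ->
  \forall u \near t, forall i, `|(u : 'rV[R]_d) 0 i| < a.
Proof.
move=> ht; have H i : \forall u \near t, `|(u : 'rV[R]_d) 0 i| < a.
  have c : {for t, continuous (fun y : 'rV[R]_d => `|y 0 i|)}.
    by apply: cont_norm; exact: coord_continuous.
  exact: (near_preim c (lt_nbhsl (ht i))).
exact: (filter_forall _ H).
Qed.

Lemma Psi0 : Psi 0 = p.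
Proof.
have [|h _ _] := hPsi (t := 0); first by move=> i; rewrite mxE normr0.
apply: (multi_exp_fun sC vW h); exists (fun=> p); split=> // j.
by rewrite mxE; exact: (expv0 sC (dW j)).
Qed.

Lemma Psi_orbit (t : 'rV[R]_d) : (forall i, `|t 0 i| < r) -> vorbit C p (Psi t).
Proof.
move=> /hPsi[h _ _]; exact: (multi_exp_orbit vW (vorbit_refl C p) h).
Qed.

Lemma Psi_cont f (t : 'rV[R]_d) : C f -> (forall i, `|t 0 i| < r) ->
  {for t, continuous (fun t => f (Psi t))}.
Proof.
move=> Cf ht A nA; have [h _ _] := hPsi ht.
have cf := C_cont dC Cf; have nA' : nbhs (Psi t) [set z | A (f z)] := cf _ _ nA.
have n1 := multi_exp_near sC lcS vW h nA'; have n2 := near_small ht.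
apply: (filterS2 _ _ n2 n1) => u hu [z ez Az].
have [eu _ _] := hPsi hu; rewrite /=.
by rewrite (multi_exp_fun sC vW eu ez).
Qed.

(** The velocity of t_i |-> Psi(t) is that of a vector field Z, which lies in the span of
the frame; its coefficients Z(x_l) can be read off from x(Psi(t)) = t. This replaces the
proof that the fields W_i commute along the orbit. *)
Lemma Psi_derive f (t : 'rV[R]_d) i : C f -> (forall i, `|t 0 i| < r) ->
  is_derive t (delta_mx 0 i) (fun t => f (Psi t)) (W i f (Psi t)).
Proof.
move=> Cf ht; pose sg u := Psi (upd t i u).
have tE : upd t i (t 0 i) = t.
  by apply/rowP => j; rewrite mxE; case: eqP => // ->.
have near_t : \forall u \near t 0 i, forall j, `|upd t i u 0 j| < r.
  have c : continuous (fun u : R => `|u|) by move=> s; exact: norm_continuous.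
  have := near_preim (c (t 0 i)) (lt_nbhsl (ht i)); apply: filterS => u hu j.
  by rewrite mxE; case: ifP.
have hs : \forall u \near t 0 i, multi_exp C W (upd t i u) p (sg u).
  by apply: filterS near_t => u /hPsi[].
have [[Z vZ hZ] _] := multi_exp_velocity sC lcS vW hs.
have [_ N0t xt] := hPsi ht.
have ZE g : C g -> Z g (Psi t) = W i g (Psi t).
  move=> Cg; rewrite (frame_span N0t (Psi_orbit ht) vZ Cg).
  have Zx l : Z (x l) (Psi t) = (l == i)%:R.
    have := hZ (x l) (Cx l); rewrite /sg tE => h1.
    have h2 : is_derive (t 0 i) 1 (fun u : R => x l (Psi (upd t i u))) (l == i)%:R.
      have E : \forall u \near t 0 i, (if l == i then u else t 0 l) = x l (Psi (upd t i u)).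
        by apply: filterS near_t => u /hPsi[_ _ ->]; rewrite mxE.
      apply: near_eq_is_derive E _; case: eqP => _; first exact: is_derive_id.
      exact: is_d_cst.
    by rewrite -(@derive_val _ _ _ _ _ _ _ h1) (@derive_val _ _ _ _ _ _ _ h2).
  rewrite (bigD1 i)//= Zx eqxx mul1r big1 ?addr0// => l li.
  by rewrite Zx (negbTE li) mul0r.
apply: is_derive_dir.
have h1 := hZ f Cf; rewrite [sg (t 0 i)]/sg tE ZE// in h1.
have h3 : is_derive (0 : R) 1 (fun h : R => h + t 0 i) 1.
  have := is_d_add (is_derive_id (0 : R) (1 : R)) (is_d_cst (t 0 i) (0 : R) (1 : R)).
  by rewrite addr0.
have h4 := @is_d_comp _ _ (fun u => f (sg u)) (fun h : R => h + t 0 i) 0 1 _ _.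
rewrite add0r in h4; have := h4 _ _ h1 h3; rewrite mulr1.
have -> // : (fun h : R => f (sg (h + t 0 i))) = (fun h : R => f (Psi (h *: delta_mx 0 i + t))).
apply/funext => h; rewrite /sg; congr (f (Psi _)); apply/rowP => j.
by rewrite !mxE eqxx /=; case: eqP => [->|_]; rewrite ?mulr1 ?mulr0 ?add0r.
Qed.

(** By [Psi_derive] the partial derivatives are sums of functions of the same form. *)
Lemma Psi_Cm m (b : 'rV[R]_d -> R) f a : a < r -> Cinfty R d b ->
  (forall t, ~ box a t -> b t = 0) -> C f -> Cm m (fun t => b t * f (Psi t)).
Proof.
move=> ar hb b0 Cf.
have cont b1 f1 : Cinfty R d b1 -> (forall t, ~ box a t -> b1 t = 0) -> C f1 ->
    continuous (fun t => b1 t * f1 (Psi t)).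
  move=> {}hb {}b0 {}Cf t; have [ht|/boxP/existsNP[i /negP]] := pselect (box a t).
    have hr i : `|t 0 i| < r by apply: le_lt_trans ar; exact: (boxP _ _).1 ht i.
    by apply: cont_mul; [exact: (@Cm_cont _ _ _ _ (hb 0%N) t)|exact: Psi_cont].
  rewrite -ltNge => /out_box_open nt.
  apply: (@cont_near _ _ (fun=> 0)); first exact: cont_cst.
  apply: filterS nt => u ut; rewrite b0 ?mul0r// => /boxP /(_ i).
  by rewrite leNgt ut.
elim: m b f hb b0 Cf => [|m IH] b f hb b0 Cf.
  by split=> //; exact: cont.
have b0' i t : ~ box a t -> 'D_(delta_mx 0 i) b t = 0.
  move=> /boxP/existsNP[j /negP]; rewrite -ltNge => /out_box_open nt.
  have h1 := Cm_is_derive i t (hb 1%N).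
  have h2 : is_derive t (delta_mx 0 i) b 0.
    have E : \forall u \near t, 0 = b u.
      by apply: filterS nt => u ut; rewrite b0// => /boxP /(_ j); rewrite leNgt ut.
    exact: near_eq_is_derive E (is_d_cst 0 t (delta_mx 0 i)).
  exact: (@derive_val _ _ _ _ _ _ _ h2).
apply: (@Cm_intro _ _ _ _ (fun i t => b t * W i f (Psi t) +
    'D_(delta_mx 0 i) b t * f (Psi t))).
- exact: cont.
- move=> i t; have [ht|nb] := pselect (box a t).
    have hr j : `|t 0 j| < r by apply: le_lt_trans ar; exact: (boxP _ _).1 ht j.
    have := is_d_mul (Cm_is_derive i t (hb 1%N)) (Psi_derive i Cf hr).
    by rewrite [_ * f _]mulrC.
  rewrite b0' // b0 // !mul0r addr0.
  move: nb => /boxP/existsNP[j /negP]; rewrite -ltNge => /out_box_open nt.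
  have E : \forall u \near t, 0 = b u * f (Psi u).
    by apply: filterS nt => u ut; rewrite b0 ?mul0r// => /boxP /(_ j); rewrite leNgt ut.
  exact: near_eq_is_derive E (is_d_cst 0 t (delta_mx 0 i)).
- move=> i; apply: Cm_add.
    by apply: IH => //; exact: Defs.der_stable (dW i) _ Cf.
  apply: IH => //; [|exact: b0'].
  by move=> k; exact: Cm_pd (hb k.+1).
Qed.

(** A bump function extends the pullback of f to the slice to all of R^d. *)
Lemma Psi_extend f : C f -> exists F, [/\ Cinfty R d F,
  forall t : 'rV[R]_d, (forall i, `|t 0 i| < r / 2) -> F t = f (Psi t) &
  forall (t : 'rV[R]_d) i, (forall i, `|t 0 i| < r / 2) -> 'D_(delta_mx 0 i) F t = W i f (Psi t)].
Proof.
move=> Cf; pose b := @boxbump R d (r / 2) (3 / 4 * r).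
have rp : 0 < r by []; have r2 : r / 2 < 3 / 4 * r by move: rp; lra.
have FE (t : 'rV[R]_d) : (forall i, `|t 0 i| < r / 2) -> b t * f (Psi t) = f (Psi t).
  by move=> ht; rewrite /b boxbump1 ?mul1r// => i; exact: ltW.
exists (fun t => b t * f (Psi t)); split=> //.
- move=> m; apply: (@Psi_Cm _ _ _ (3 / 4 * r)) => //; first by lra.
    by move=> k; exact: Cm_boxbump.
  move=> t /boxP/existsNP[i /negP]; rewrite -ltNge => /ltW h.
  exact: boxbump0 r2 h.
- move=> t i ht.
  have hr j : `|t 0 j| < r by apply: lt_trans (ht j) _; lra.
  have E : \forall u \near t, f (Psi u) = b u * f (Psi u).
    by apply: filterS (near_small ht) => u /FE.
  have h := near_eq_is_derive E (Psi_derive i Cf hr).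
  exact: (@derive_val _ _ _ _ _ _ _ h).
Qed.

End Param.

End Frame.

End Slice.

(** * Leaves of the orbit topology *)

Section Leaf.
Variables (R : realType) (S : topologicalType) (C : set (S -> R)).
Hypothesis sC : subcartesian C.
Let dC := sc_structure sC.
Hypothesis lcS : locally_compact [set: S].

Local Notation vf := (vector_field C).

Section Data.
Variables (p : S) (d : nat) (W : 'I_d -> (S -> R) -> S -> R) (x : 'I_d -> S -> R).
Variable N0 : set S.
Hypotheses (vW : forall i, vf (W i)) (Cx : forall j, C (x j)) (xp : forall j, x j p = 0).
Hypotheses (oN0 : open N0) (N0p : N0 p).
Hypothesis Wx : forall z i j, N0 z -> W i (x j) z = (i == j)%:R.
Hypothesis maxrk : ~ rank_ge C d.+1 p.
Variables (r : R) (Psi : 'rV[R]_d -> S).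
Hypothesis r0 : 0 < r.
Hypothesis hPsi : forall t : 'rV[R]_d, (forall i, `|t 0 i| < r) ->
  [/\ multi_exp C W t p (Psi t), N0 (Psi t) & forall l, x l (Psi t) = t 0 l].
Variables (n : nat) (k : 'I_n -> S -> R) (V : 'I_d -> 'I_n -> 'rV[R]_n -> R).
Hypothesis ck : chart C k N0.
Hypothesis fc : forall i, fchart C (W i) k N0 (V i).
Variable K : 'I_n -> 'rV[R]_d -> R.
Hypothesis CK : forall l, Cinfty R d (K l).
Hypothesis KE : forall l (t : 'rV[R]_d), (forall i, `|t 0 i| < r / 2) -> K l t = k l (Psi t).
Hypothesis DK : forall l (t : 'rV[R]_d) i, (forall i, `|t 0 i| < r / 2) ->
  'D_(delta_mx 0 i) (K l) t = W i (k l) (Psi t).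

(** The points near p with z = Psi(x(z)), written in the coordinates k. *)
Definition leaf : set S := [set z | [/\ N0 z, forall j, `|x j z| < r / 2 &
  forall l, k l z = K l (\row_j x j z)]].

Lemma leaf_Psi z : leaf z -> z = Psi (\row_j x j z).
Proof.
move=> [Nz xz kz].
have hx i : `|(\row_j x j z) 0 i| < r by rewrite mxE; apply: lt_trans (xz i) _; move: r0; lra.
have [_ NP _] := hPsi hx.
apply: (chart_inj sC ck NP Nz) => l.
by rewrite kz KE// => i; rewrite mxE.
Qed.

Lemma leaf_center : leaf p.
Proof.
have r2 : 0 < r / 2 by rewrite divr_gt0.
have x0 : \row_j x j p = 0 by apply/rowP => j; rewrite !mxE.
split=> // [j|l]; first by rewrite xp normr0.
rewrite x0 KE; last by move=> i; rewrite mxE normr0.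
by rewrite (Psi0 sC vW r0 hPsi).
Qed.

(** The functions k_l - K_l(x) satisfy a linear differential inequality along every
curve in the orbit whose velocity comes from vector fields, so they stay 0. *)
Lemma leaf_along sg (J : set R) a b : is_interval J -> (forall u, J u -> nbhs u J) ->
  (forall u, J u -> [/\ vf_velocity C sg u, vorbit C p (sg u), N0 (sg u) &
     forall j, `|x j (sg u)| < r / 2]) ->
  J a -> J b -> leaf (sg a) -> leaf (sg b).
Proof.
move=> iJ oJ hJ Ja Jb [_ _ la]; have [_ _ Nb xb] := hJ b Jb; split=> //.
pose X u := \row_j x j (sg u); pose Ka u := \row_l k l (sg u); pose KX u := \row_l K l (X u).
have XE u : J u -> forall i, `|X u 0 i| < r / 2.
  by move=> Ju i; rewrite mxE; have [_ _ _ h] := hJ u Ju; exact: h.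
have /choice[A hA] : forall u, exists A : 'I_d -> R, J u ->
    (forall j, is_derive (u : R) 1 (fun u : R => x j (sg u)) (A j)) /\
    (forall l, is_derive (u : R) 1 (fun u : R => k l (sg u)) (\sum_j A j * V j l (Ka u))).
  move=> u; have [Ju|NJ] := pselect (J u); last by exists (fun=> 0) => /NJ.
  have [[[Z vZ hZ] _] ou Nu _] := hJ u Ju; have [_ Ck _] := ck.
  exists (fun j => Z (x j) (sg u)) => _; split=> [j|l]; first exact: hZ (Cx j).
  have := hZ (k l) (Ck l).
  rewrite (frame_span sC lcS vW Cx Wx maxrk Nu ou vZ (Ck l)).
  under [X in is_derive _ _ _ X -> _]eq_bigr do rewrite (fc_eq (fc _) _ Nu).
  exact.
pose e l u := k l (sg u) - K l (X u).
pose de l u := \sum_j A u j * (V j l (Ka u) - V j l (KX u)).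
have dede l (u : R) : J u -> is_derive u 1 (e l) (de l u).
  move=> Ju; have [h1 h2] := hA u Ju.
  have h3 := chain_rule (CK l 1%N) h1.
  have := is_d_sub (h2 l) h3; congr (is_derive _ _ _ _).
  rewrite /de -sumrB; apply: eq_bigr => j _; rewrite DK; last exact: XE.
  have hr i : `|X u 0 i| < r by apply: lt_trans (XE u Ju i) _; move: r0; lra.
  have [_ NP _] := hPsi hr; rewrite (fc_eq (fc j) _ NP) mulrBr [_ * A u j]mulrC.
  congr (_ - A u j * V j l _); apply/rowP => m.
  by rewrite !mxE KE//; exact: XE.
have /choice[L hL] : forall j, exists L, 0 <= L /\ forall l v w,
    `|V j l v - V j l w| <= L * \sum_m `|v 0 m - w 0 m|.
  move=> j; have [L [B lV]] := csfield_lip (fc_cs (fc j)).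
  by exists L; split; [exact: lip_K0 lV|exact: lip_lip lV].
suff : [set u | forall l, e l u = 0] b.
  by move=> eb l; apply/eqP; rewrite -subr_eq0; apply/eqP; exact: eb.
apply: (interval_const iJ _ Ja Jb); last by move=> l; rewrite /e la subrr.
move=> u Ju; have [[_ vu] _ _ _] := hJ u Ju.
have /choice[dg hdg] : forall j, exists dg : R -> R, {for u, continuous dg} /\
    \forall v \near u, is_derive (v : R) 1 (fun v : R => x j (sg v)) (dg v).
  by move=> j; have [dg ? ?] := vu (x j) (Cx j); exists dg.
pose c j := `|dg j u| + 1.
have nA : \forall v \near u, forall j, `|A v j| <= c j.
  have H j : \forall v \near u, `|A v j| <= c j.
    have [cdg ndg] := hdg j; have := near_preim cdg (nbhsx_ballx _ _ ltr01).
    apply: filterS3 (oJ u Ju) ndg => v Jv h1; rewrite /ball/= => h2.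
    have [h3 _] := hA v Jv; have h4 := h3 j.
    have -> : A v j = dg j v.
      by rewrite -(@derive_val _ _ _ _ _ _ _ h4) (@derive_val _ _ _ _ _ _ _ h1).
    have := ler_normB (dg j u) (dg j u - dg j v); rewrite subKr /c; lra.
  exact: (filter_forall _ H).
have /nbhsR[del del0 hdel] : \forall v \near u, J v /\ forall j, `|A v j| <= c j.
  exact: (filterI (oJ u Ju) nA).
pose Kc := \sum_j c j * L j.
have c0 j : 0 <= c j by rewrite /c addr_ge0.
have Kc0 : 0 <= Kc by apply: sumr_ge0 => j _; rewrite mulr_ge0//; exact: (hL j).1.
have deK l v : `|v - u| < del -> `|de l v| <= Kc * \sum_m `|e m v|.
  move=> /hdel[Jv hv]; apply: le_trans (ler_norm_sum _ _ _) _.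
  rewrite /Kc mulr_suml; apply: ler_sum => j _; rewrite normrM -mulrA.
  apply: ler_pM => //; apply: le_trans ((hL j).2 l _ _) _.
  apply: ler_wpM2l; first exact: (hL j).1.
  by apply: ler_sum => m _; rewrite !mxE.
have zero v w : (forall z, `|z - v| <= `|w - v| -> `|z - u| < del) ->
    (forall l, e l v = 0) -> forall l, e l w = 0.
  move=> hz; apply: (gronwall_sym Kc0) => l z /hz hzu; last exact: deK.
  by apply: dede; have [] := hdel z hzu.
apply/nbhsR; exists (del / 2); first by rewrite divr_gt0.
move=> v vu2 Jv; split; apply: zero => z hz.
  have := ler_normD (z - v) (v - u); rewrite addrA subrK (distrC v u) in vu2 hz * => h.
  by move: vu2 hz h; lra.
by move: vu2 hz; lra.
Qed.

(** The times are moved from T0 to T one after the other, and [leaf_along] is applied to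
each segment. *)
Lemma leaf_open m (xi : 'I_m -> (S -> R) -> S -> R) T0 y z0 : (forall j, vf (xi j)) ->
  vorbit C p y -> multi_exp C xi T0 y z0 -> leaf z0 ->
  \forall T \near T0, exists2 z, multi_exp C xi T y z & leaf z.
Proof.
move=> vxi oy hz0 lz0; have [Nz0 xz0 _] := lz0.
pose N1 := [set z | N0 z /\ forall j, `|x j z| < r / 2].
have nN1 : nbhs z0 N1.
  apply: filterI; first exact: open_nbhs_nbhs.
  apply: filter_forall => j.
  have cx : continuous (fun z => `|x j z|).
    by move=> z; apply: cont_norm; exact: (C_cont dC (Cx j)).
  exact: near_preim (cx z0) (lt_nbhsl (xz0 j)).
have /nbhs_ballP[e /= e0 he] := multi_exp_near sC lcS vxi hz0 nN1.
pose B (T : 'rV[R]_m) := forall i, `|T 0 i - T0 0 i| < e.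
have /choice[s hs] : forall T, exists z, B T -> multi_exp C xi T y z /\ N1 z.
  move=> T; have [BT|NB] := pselect (B T); last by exists z0 => /NB.
  have [|z ? ?] := he T; last by exists z.
  by apply: box_ball => // i; rewrite distrC; exact: BT.
have B0 : B T0 by move=> i; rewrite subrr normr0.
have s0 : s T0 = z0 by have [h _] := hs T0 B0; exact: (multi_exp_fun sC vxi h hz0).
have step T i u : B T -> B (upd T i u) -> leaf (s T) -> leaf (s (upd T i u)).
  move=> BT BU lT.
  have TE : upd T i (T 0 i) = T by apply/rowP => j; rewrite mxE; case: eqP => // ->.
  pose J := [set v | `|v - T0 0 i| < e].
  have Bv v : J v -> B (upd T i v).
    by move=> Jv j; rewrite mxE; case: eqP => [->|_]; [exact: Jv|exact: BT].
  have iJ : is_interval J.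
    move=> a b; rewrite /J /= !ltr_norml => /andP[a1 a2] /andP[b1 b2] c /andP[ac cb].
    by rewrite ltr_norml; apply/andP; split; lra.
  have oJ v : J v -> nbhs v J.
    move=> Jv; have c : {for v, continuous (fun v : R => `|v - T0 0 i|)}.
      by apply: cont_norm; apply: cont_sub; [exact: cvg_id|exact: cont_cst].
    exact: near_preim c (lt_nbhsl Jv).
  rewrite -{1}TE in lT.
  apply: (leaf_along (sg := fun v => s (upd T i v)) iJ oJ _ _ _ lT).
  - move=> v Jv; have [h1 [h2 h3]] := hs _ (Bv v Jv); split=> //.
      apply: (multi_exp_velocity sC lcS vxi (T := T) (i := i) (y := y)).
      by apply: filterS (oJ v Jv) => w Jw; have [] := hs _ (Bv w Jw).
    exact: (multi_exp_orbit vxi oy h1).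
  - exact: BT.
  - by have := BU i; rewrite mxE eqxx.
have e2 : 0 < e / 2 by rewrite divr_gt0.
apply: filterS (nbhs_box T0 e2) => T hT.
have BT : B T by move=> i; apply: le_lt_trans (hT i) _; move: e0; lra.
pose Tj j : 'rV[R]_m := \row_i if (i < j)%N then T 0 i else T0 0 i.
have BTj j : B (Tj j).
  by move=> i; rewrite mxE; case: ifP => _; [exact: BT|exact: B0].
have H j : (j <= m)%N -> leaf (s (Tj j)).
  elim: j => [_|j IH jm].
    have -> : Tj 0%N = T0 by apply/rowP => i; rewrite mxE.
    by rewrite s0.
  have E : Tj j.+1 = upd (Tj j) (Ordinal jm) (T 0 (Ordinal jm)).
    apply/rowP => i; rewrite !mxE -val_eqE /= ltnS leq_eqVlt.
    by case: eqP => [ij|_] //=; congr (T 0 _); exact: val_inj.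
  by have := BTj j.+1; rewrite E => B1; apply: step => //; exact: IH (ltnW jm).
have TmE : Tj m = T by apply/rowP => i; rewrite mxE ltn_ord.
exists (s T); first by have [] := hs T BT.
by have := H m (leqnn m); rewrite TmE.
Qed.

End Data.

(** What the theorem needs of the construction around p: a set U that is open in the
orbit topology and on which all smooth functions depend on d coordinates only. *)
Lemma leaf_exists p : exists d (W : 'I_d -> (S -> R) -> S -> R) (x : 'I_d -> S -> R) (U : set S),
  [/\ forall i, vf (W i), forall j, C (x j), U p,
      forall m (xi : 'I_m -> (S -> R) -> S -> R) T0 y z0, (forall j, vf (xi j)) ->
        vorbit C p y -> multi_exp C xi T0 y z0 -> U z0 ->
        \forall T \near T0, exists2 z, multi_exp C xi T y z & U z &
      forall f, C f -> exists F, [/\ Cinfty R d F,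
        forall z, U z -> f z = F (\row_j x j z) &
        forall i, 'D_(delta_mx 0 i) F (\row_j x j p) = W i f p]].
Proof.
have [d rk maxrk] := rank_max sC p.
have [W [x [vW Cx xp Wx]]] := frame_exists sC lcS rk.
have [n [k [M [cM Mp]]]] := chart_exists sC p.
have /choice[NV hNV] : forall i, exists NV : set S * ('I_n -> 'rV[R]_n -> R),
    [/\ fchart C (W i) k NV.1 NV.2, NV.1 p & NV.1 `<=` M].
  move=> i; have [N [V h]] := fchart_in sC (vf_der (vW i)) cM Mp.
  by exists (N, V).
have oM : open M by have [] := cM.
pose Q := [set z | M z /\ (forall i, (NV i).1 z) /\
  forall i j, W i (x j) z = (i == j)%:R].
have nQ : nbhs p Q.
  apply: filterI; first exact: open_nbhs_nbhs.
  apply: filterI => //; apply: filter_forall => i.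
  have [fci Np _] := hNV i; have [oN _ _] := fc_chart fci.
  exact: open_nbhs_nbhs.
pose N0 := interior Q; have oN0 : open N0 by exact: open_interior.
have N0p : N0 p := nQ.
have N0Q z : N0 z -> Q z by exact: interior_subset.
have Wx0 z i j : N0 z -> W i (x j) z = (i == j)%:R by move=> /N0Q[_ [_]]; exact.
have ck : chart C k N0 by apply: chart_sub cM oN0 _ => z /N0Q[].
have fc i : fchart C (W i) k N0 (NV i).2.
  have [fci _ _] := hNV i; apply: fchart_sub fci oN0 _ => z /N0Q[_ [h _]]; exact: h.
have [r r0 [Psi hPsi]] := slice_exists sC lcS vW Cx xp oN0 N0p Wx0.
have ext := Psi_extend sC lcS vW Cx Wx0 maxrk r0 hPsi.
have [_ Ck _] := ck.
have /choice[K hK] := fun l => ext (k l) (Ck l).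
have CK l : Cinfty R d (K l) by have [] := hK l.
have KE l (t : 'rV[R]_d) : (forall i, `|t 0 i| < r / 2) -> K l t = k l (Psi t).
  by have [_ h _] := hK l; exact: h.
have DK l (t : 'rV[R]_d) i : (forall i, `|t 0 i| < r / 2) ->
    'D_(delta_mx 0 i) (K l) t = W i (k l) (Psi t).
  by have [_ _ h] := hK l; exact: h.
exists d, W, x, (leaf x N0 r k K); split=> //.
- exact: (leaf_center vW xp N0p r0 hPsi KE).
- exact: (leaf_open vW Cx oN0 Wx0 maxrk r0 hPsi ck fc CK KE DK).
- move=> f Cf; have [F [CF FE DF]] := ext f Cf; exists F; split=> //.
    move=> z lz; have [_ xz _] := lz.
    rewrite FE; last by move=> i; rewrite mxE.
    by rewrite -(leaf_Psi r0 hPsi ck KE lz).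
  move=> i; have x0 : \row_j x j p = 0 by apply/rowP => j; rewrite !mxE.
  rewrite x0 DF ?(Psi0 sC vW r0 hPsi)// => j.
  by rewrite mxE normr0 divr_gt0.
Qed.

(** On U the function f agrees with F(x), so the hypothesis gives X f = X (F(x)) at p.
The latter is a combination of the numbers W_j f(p), which are 0 when f has a local
maximum at p. *)
Lemma invariant_vector_field X : derivation C X ->
  (forall (x : S) (U : set (orbit_space C x)),
     open U -> orbit_incl C x @^-1` [set x] `<=` U ->
     X @` vanishing C (orbit_incl C x @` U) `<=`
       vanishing C (orbit_incl C x @` U)) -> vf X.
Proof.
move=> dX H; apply/(vector_fieldP sC lcS); split=> // f p Cf fmax.
have [d [W [x [U [vW Cx Up oU ext]]]]] := leaf_exists p.
have [F [CF FE DF]] := ext f Cf.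
pose U' : set (orbit_space C p) := [set z | U (orbit_incl C p z)].
have oU' : open U'.
  rewrite orbit_openE => y k xi vxi.
  exists [set T | exists2 z, multi_exp C xi T (set_val y) z & U z].
    rewrite openE => T0 /= [z0 hz0 Uz0].
    exact: oU vxi (set_valP y) hz0 Uz0.
  move=> T z hz; split=> [Uz|[z' hz' Uz']]; first by exists (set_val z).
  by rewrite /U' /= /orbit_incl (multi_exp_fun sC vxi hz hz').
have hp : orbit_incl C p @^-1` [set p] `<=` U' by move=> z /= zp; rewrite /U' /= zp.
pose g z := f z - F (\row_j x j z).
have CFx : C (fun z => F (\row_j x j z)) by exact: (dsp_comp dC).
have Cg : C g by exact: (C_sub dC).
have vg : vanishing C (orbit_incl C p @` U') g.
  by split=> // _ [z Uz <-]; rewrite /g (FE _ Uz) subrr.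
have [_ h] := H p U' oU' hp (X g) (ex_intro2 _ _ g vg erefl).
have Xg0 : X g p = 0.
  apply: h; exists (mkset (vorbit_refl C p)); last exact: mksetE.
  by rewrite /U' /= /orbit_incl mksetE.
have := Xg0; rewrite /g (derB dC dX)// (der_chain dC dX)// big1 ?subr0// => j _.
have [_ hW] := vf_max sC (vW j).
by rewrite DF hW// mul0r.
Qed.

(** For z in U the points exp(tX)(z) with t small are in U: this is the definition of the
orbit topology for a single vector field. There f vanishes. *)
Lemma vector_field_invariant X : vf X ->
  forall (x : S) (U : set (orbit_space C x)), open U ->
     X @` vanishing C (orbit_incl C x @` U) `<=`
       vanishing C (orbit_incl C x @` U).
Proof.
move=> vX x U oU _ [f [Cf f0] <-]; have dX := vf_der vX.
split; first exact: Defs.der_stable dX _ Cf.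
move=> _ [z0 Uz0 <-]; rewrite /orbit_incl; set z := set_val z0.
have oz : vorbit C x z := set_valP z0.
have [Q oQ hQ] := oU z0 1%N (fun=> X) (fun=> vX).
have [J [c [hc J0 c0 hJ]]] := exp_curve sC dX z.
have nJ : nbhs 0 J.
  have nT : nbhs z [set: S] by exact: filterT.
  have /nbhs_pairP[A [B [nA nB AB]]] := flow_near sC lcS (vf_max sC vX) (expv0 sC dX z) nT.
  by apply: filterS nA => t At; have [y /= /hJ[]] := AB t z At (nbhs_singleton nB).
have mE t : J t -> multi_exp C (fun=> X) (\row_(i < 1) t) z (c t).
  move=> Jt; exists (fun j => if j is 0%N then z else c t); split=> // j.
  by rewrite mxE (ord1 j) /=; exact/hJ.
have Q0 : Q (\row_(i < 1) (0 : R)).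
  by apply/(hQ _ z0); rewrite // -/z; have := mE 0 J0; rewrite c0.
have cr : {for (0 : R), continuous (fun t : R => \row_(i < 1) t)}.
  by apply: continuous_rowE => i; exact: cvg_id.
have nQ := cr _ (open_nbhs_nbhs (conj oQ Q0)).
have [_ /(_ nJ)] := hc.2 f 0 Cf J0; rewrite c0 => h.
apply: max_derive0 h _.
have fc t : J t -> Q (\row_(i < 1) t) -> f (c t) = 0.
  move=> Jt Qt; have oc : vorbit C x (c t).
    by apply: (vorbit_step vX oz (t := t)); exact/hJ.
  apply: f0; exists (mkset oc); last exact: mksetE.
  apply/(hQ (\row_(i < 1) t)) => //; rewrite mksetE -/z; exact: mE.
by apply: filterS2 nJ nQ => t Jt Qt; rewrite (fc t Jt Qt) (fc 0 J0 Q0).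
Qed.

End Leaf.

Theorem proposition4p70 (R : realType) (S : topologicalType)
    (C : set (S -> R)) (X : (S -> R) -> (S -> R)) :
  subcartesian C ->
  locally_compact [set: S] ->
  derivation C X ->
  vector_field C X <->
  (forall (x : S) (U : set (orbit_space C x)),
     open U -> orbit_incl C x @^-1` [set x] `<=` U ->
     X @` vanishing C (orbit_incl C x @` U) `<=`
       vanishing C (orbit_incl C x @` U)).
Proof.
move=> sC lcS dX; split; last exact: invariant_vector_field.
by move=> vX x U oU _; exact: vector_field_invariant.
Qed.
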